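(* A sequence of grapheurs $(\mathsf M_n)\subseteq\mathcal M$ converges weakly to a grapheur $\mathsf M\in\mathcal M$ if and only if $\lim_n W_\square(\mathsf M_n,\mathsf M)=0$. Furthermore: (1) a sequence of graphs $(G_n\in\Delta^{n\times n})$ is quotient-convergent if and only if there is a grapheur $\mathsf M\in\mathcal M$ with $\lim_nW_\square(\mathsf M,\mathsf M_{G_n})=0$; (2) every sequence of graphs $(G_n\in\Delta^{n\times n})$ has a quotient-convergent subsequence; (3) for every grapheur $\mathsf M\in\mathcal M$ there is a sequence $(G_n\in\Delta^{n\times n})$ with $\lim_nW_\square(\mathsf M,\mathsf M_{G_n})=0$.
   Context: $\Delta^{n\times n}$ is the set of $n\times n$ real matrices with nonnegative entries summing to $1$ (adjacency matrices of weighted directed graphs with unit total edge weight). For $f:[n]\to[k]$, $(\rho(f)G)_{i,j}=\sum_{v\in f^{-1}(i),u\in f^{-1}(j)}G_{v,u}$; $F_{k,n}$ is a uniformly random map $[n]\to[k]$; $(G_n\in\Delta^{n\times n})$ is quotient-convergent if for every $k$ the random matrices $\rho(F_{k,n})G_n$ converge in distribution as $n\to\infty$. Let $\lambda$ be Lebesgue measure on $[0,1]$, $\lambda^2$ Lebesgue measure on $[0,1]^2$, and $\lambda_D$ the uniform probability measure on the diagonal $\{(x,x):x\in[0,1]\}$. A grapheur is a random probability measure on $[0,1]^2$ of the form $\mathsf M=\sum_{i,j\in\mathbb N}E_{i,j}\delta_{(T_i,T_j)}+\sum_{i}[\sigma_i(\delta_{T_i}\otimes\lambda)+\varsigma_i(\lambda\otimes\delta_{T_i})]+\theta\lambda^2+\vartheta\lambda_D$,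 where $T_1,T_2,\dots$ are iid uniform on $[0,1]$ and the coefficients are deterministic: $E\in\mathbb R_{\ge0}^{\mathbb N\times\mathbb N}$, $\sigma,\varsigma\in\mathbb R^{\mathbb N}_{\ge0}$, $\theta,\vartheta\ge0$, with $\sum_{i,j}E_{i,j}+\sum_i(\sigma_i+\varsigma_i)+\theta+\vartheta=1$. $\mathcal M$ is the set of (laws of) grapheurs; random measures converge weakly if their laws, as probability measures on the space $\mathcal P([0,1]^2)$ with its weak topology, converge weakly. For $G\in\Delta^{n\times n}$, $\mathsf M_G=\sum_{i,j=1}^nG_{i,j}\delta_{(T_i,T_j)}$ with $T_1,\dots,T_n$ iid uniform on $[0,1]$. For grapheurs $\mathsf M_1,\mathsf M_2$, $W_\square(\mathsf M_1,\mathsf M_2)=\inf_{(\mathsf M_1',\mathsf M_2')}\sup_{S,T\subseteq[0,1]\text{ intervals}}\mathbb E|\mathsf M_1'(S\times T)-\mathsf M_2'(S\times T)|$, the infimum over all couplings (joint realizations) with $\mathsf M_i'$ equal in distribution to $\mathsf M_i$. *)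

(* Defs.v *)
From HB Require Import structures.
From mathcomp Require Import all_boot all_order all_algebra.
From mathcomp Require Import all_classical all_reals all_analysis.
From mathcomp Require Import giry.

Set Implicit Arguments.
Unset Strict Implicit.
Unset Printing Implicit Defensive.

Import Order.TTheory GRing.Theory Num.Def Num.Theory.
Import numFieldNormedType.Exports.

Local Open Scope classical_set_scope.
Local Open Scope ring_scope.

Section grapheurs.
Variable R : realType.

(** The measurable space [R * R] (Borel x Borel = Borel on R^2); all measures
    considered are supported on [0,1]^2. *)
Definition sq01 : set (R * R) := `[0%R, 1%R] `*` `[0%R, 1%R].

(** Random measures take values in the Giry space of (sub)probability measures
    on R*R, with its sigma-algebra generated by the evaluation maps. *)
Definition PM := giry (R * R)%type R.

Definition leb := (@lebesgue_measure R).

Record gcoef := GCoef {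
  gE : nat -> nat -> R ;
  gsig : nat -> R ;
  gvsig : nat -> R ;
  gth : R ;
  gvth : R }.

Definition is_grapheur (c : gcoef) : Prop :=
  [/\ (forall i j, 0 <= gE c i j), (forall i, 0 <= gsig c i),
      (forall i, 0 <= gvsig c i), 0 <= gth c /\ 0 <= gvth c &
      ((\sum_(i <oo) \sum_(j <oo) (gE c i j)%:E)
       + (\sum_(i <oo) (gsig c i + gvsig c i)%:E)
       + (gth c)%:E + (gvth c)%:E = 1)%E ].

(** The value on a set [A] of the grapheur measure with coefficients [c],
    when the sequence of points is [t]:
    sum E_ij delta_(t_i,t_j) + sum [sig_i (delta_t_i x lambda) + vsig_i (lambda x delta_t_i)]
    + th lambda^2 + vth lambda_D  (lambda = Lebesgue measure on [0,1]). *)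
Definition gmeas (c : gcoef) (t : nat -> R) (A : set (R * R)) : \bar R :=
  ((\sum_(i <oo) \sum_(j <oo) ((gE c i j)%:E * (\1_A (t i, t j))%:E))
   + (\sum_(i <oo) ((gsig c i)%:E * leb ([set y | A (t i, y)] `&` `[0%R, 1%R])
                   + (gvsig c i)%:E * leb ([set x | A (x, t i)] `&` `[0%R, 1%R])))
   + (gth c)%:E * (leb \x leb) (A `&` sq01)
   + (gvth c)%:E * leb ([set x | A (x, x)] `&` `[0%R, 1%R]))%E.

(** The grapheur M_G of a graph G in Delta^{m x m}:
    M_G = sum_{i,j < m} G_ij delta_(T_i,T_j), i.e. the grapheur whose only
    nonzero coefficients are E_ij = G_ij for i,j < m. *)
Definition graph_coef (m : nat) (G : 'M[R]_m) : gcoef :=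
  GCoef (fun i j => match (insub i : option 'I_m),
                          (insub j : option 'I_m) with
                    | Some i', Some j' => G i' j'
                    | _, _ => 0 end)
        (fun _ => 0) (fun _ => 0) 0 0.

Definition inDelta (m : nat) (G : 'M[R]_m) : Prop :=
  (forall i j, 0 <= G i j) /\ \sum_i \sum_j G i j = 1.

Definition iid_unif d (Omega : measurableType d) (P : probability Omega R)
    (T : nat -> Omega -> R) : Prop :=
  [/\ (forall i, measurable_fun setT (T i)),
      (forall i (B : set R), measurable B ->
          P (T i @^-1` B) = leb (B `&` `[0%R, 1%R])) &
      (forall (s : seq nat) (B : nat -> set R), uniq s ->
          (forall i, measurable (B i)) ->
          fine (P (\big[setI/setT]_(i <- s) (T i @^-1` B i)))
          = \prod_(i <- s) fine (P (T i @^-1` B i))) ].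

Definition realizes d (Omega : measurableType d) (c : gcoef)
    (T : nat -> Omega -> R) (M : Omega -> PM) : Prop :=
  measurable_fun setT M /\
  forall w (A : set (R * R)), measurable A -> M w A = gmeas c (T ^~ w) A.

Definition grapheur_real d (Omega : measurableType d) (P : probability Omega R)
    (c : gcoef) (M : Omega -> PM) : Prop :=
  exists T, iid_unif P T /\ realizes c T M.

Definition same_law d1 (O1 : measurableType d1) (P1 : probability O1 R)
    (M1 : O1 -> PM) d2 (O2 : measurableType d2) (P2 : probability O2 R)
    (M2 : O2 -> PM) : Prop :=
  forall S : set PM, measurable S -> P1 (M1 @^-1` S) = P2 (M2 @^-1` S).

Definition law_is d (O : measurableType d) (P : probability O R)
    (M : O -> PM) (c : gcoef) : Prop :=
  measurable_fun setT M /\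
  exists d' (O' : measurableType d') (P' : probability O' R) (M' : O' -> PM),
    grapheur_real P' c M' /\ same_law P M P' M'.

Definition P01 (mu : PM) : Prop :=
  mu setT = 1%E /\ mu (~` sq01) = 0%E.

Definition weak_cvg (mus : nat -> PM) (mu : PM) : Prop :=
  forall f : R * R -> R, continuous f -> measurable_fun setT f ->
    (\int[mus k]_x (f x)%:E)%E @[k --> \oo] --> (\int[mu]_x (f x)%:E)%E.

(** Bounded continuous (for the weak topology) functionals on P([0,1]^2).
    The weak topology is metrizable, so continuity = sequential continuity. *)
Definition test_fun (Phi : PM -> R) : Prop :=
  [/\ measurable_fun setT Phi,
      (exists K : R, forall mu, P01 mu -> `|Phi mu| <= K) &
      (forall mus mu, (forall k, P01 (mus k)) -> P01 mu ->
         weak_cvg mus mu -> Phi (mus k) @[k --> \oo] --> Phi mu) ].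

(** Weak convergence of grapheurs (convergence of their laws on P([0,1]^2)).
    All grapheurs are functions of the same iid uniform sequence, so they can
    be realized on a common probability space. *)
Definition grapheur_cvg (cs : nat -> gcoef) (c : gcoef) : Prop :=
  forall d (Omega : measurableType d) (P : probability Omega R)
         (T : nat -> Omega -> R) (Ms : nat -> Omega -> PM) (M : Omega -> PM),
    iid_unif P T -> (forall n, realizes (cs n) T (Ms n)) -> realizes c T M ->
    forall Phi, test_fun Phi ->
      (\int[P]_w (Phi (Ms n w))%:E)%E @[n --> \oo] --> (\int[P]_w (Phi (M w))%:E)%E.

Definition Wsq (c1 c2 : gcoef) : \bar R :=
  ereal_inf [set W | exists d (Omega : measurableType d) (P : probability Omega R)
                            (M1 M2 : Omega -> PM),
     [/\ law_is P M1 c1, law_is P M2 c2 &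
     W = ereal_sup [set e | exists I J : interval R,
             [/\ [set` I] `<=` `[0%R, 1%R], [set` J] `<=` `[0%R, 1%R] &
                 e = (\int[P]_w `| M1 w ([set` I] `*` [set` J])
                                  - M2 w ([set` I] `*` [set` J]) |)%E ] ] ] ].

Definition rho (m k : nat) (f : {ffun 'I_m -> 'I_k}) (G : 'M[R]_m) : 'M[R]_k :=
  \matrix_(i, j) \sum_(v | f v == i) \sum_(u | f u == j) G v u.

Definition Equot (m k : nat) (G : 'M[R]_m) (h : 'M[R]_k -> R) : R :=
  (\sum_(f : {ffun 'I_m -> 'I_k}) h (rho f G)) / #|{ffun 'I_m -> 'I_k}|%:R.

Definition quot_cvg (sz : nat -> nat) (G : forall n, 'M[R]_(sz n)) : Prop :=
  forall k : nat,
    exists d (Omega : measurableType d) (P : probability Omega R)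
           (X : 'I_k.+1 -> 'I_k.+1 -> Omega -> R),
      (forall i j, measurable_fun setT (X i j)) /\
      forall h : 'M[R]_k.+1 -> R, continuous h -> (exists K, forall x, `|h x| <= K) ->
        (Equot (G n) h)%:E @[n --> \oo] -->
        (\int[P]_w (h (\matrix_(i, j) X i j w))%:E)%E.

End grapheurs.

(* Main.v *)
Require Import Defs.
From HB Require Import structures.
From mathcomp Require Import all_boot all_order all_algebra.
From mathcomp Require Import all_classical all_reals all_analysis.
From mathcomp Require Import giry measurable_realfun.
From mathcomp Require Import ring lra zify.

Set SsrOldRewriteGoalsOrder.
Set Implicit Arguments.
Unset Strict Implicit.
Unset Printing Implicit Defensive.

Import Order.TTheory GRing.Theory Num.Def Num.Theory.
Import numFieldNormedType.Exports.
Local Open Scope classical_set_scope.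
Local Open Scope ring_scope.

(* All grapheurs are functions of one iid uniform sequence. Relabelling the
   vertices does not change the law of a grapheur, and after sorting the vertices
   by total degree a diagonal extraction makes every entry, row sum,
   column sum and diagonal sum converge uniformly:
   mass that does not stay on a vertex of large degree spreads into the terms in
   [lambda^2] and [lambda_D] (or into [sigma], [varsigma] when only one end
   spreads). If these data of two grapheurs differ by at most [eta ^ 2], a second
   moment computation, in which the vertices of small degree are averaged out,
   bounds the L1 distance of the two random measures on every rectangle by
   [30 * eta], hence also [Wsq]. So every sequence of grapheurs has a subsequence
   which, suitably coupled, converges both weakly and for [Wsq].

   The law of a grapheur is determined by its values on the cells of regular
   grids. On these values [Wsq] controls all Lipschitz functionals, and for a
   graph they have the law of the random quotient matrix; thus each of the
   notions of convergence identifies the subsequential limits. *)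

(** * Total mass of a grapheur *)

(** The exponent in [eta ^ 2] comes from the second moment: a sum of squares of small numbers is at
    most their maximum times their sum, so data at distance [eta ^ 2] give a variance of order
    [eta ^ 2] and an L1 distance of order [eta]. With [eta = 2^-n] these distances are summable and
    the cell values converge almost surely.

    A grapheur has many coefficient descriptions, so limits are identified through laws alone. That
    two realizations of the same coefficients have the same law is itself derived from graphs: their
    integrals of Lipschitz functionals of the cells are both limits of the numbers
    [Equot (approx_graph c n) h], which depend on [c] only.

    The notion [grapheur_cvg] quantifies over spaces that carry an iid uniform sequence; to draw
    anything from it one such space has to be exhibited, whence the explicit [unif_seq].

    Cell values are not weakly continuous, since mass may sit on cell boundaries. The class
    [grid_fun] contains the bounded continuous functions of the cell values and also, up to a change
    outside [P01], all weakly continuous test functions. *)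

Section Mass.
Context {R : realType}.
Implicit Types (c : gcoef R) (a : nat -> nat -> R).

(** Indicator weights bring sums of different lengths to one common range, where they can be merged
    termwise and compared through [wsum_le]. *)
Lemma sum_widen (f : nat -> R) N M : (N <= M)%N ->
  \sum_(i < N) f i = \sum_(i < M) (i < N)%:R * f i.
Proof.
move=> NM; rewrite (big_ord_widen _ _ NM) big_mkcond; apply: eq_bigr => i _.
by case: ifP => _; rewrite ?mul1r ?mul0r.
Qed.

Lemma sum_pick (f : nat -> R) i0 M : (i0 < M)%N ->
  f i0 = \sum_(i < M) (i == i0 :> nat)%:R * f i.
Proof.
move=> iM; rewrite (bigD1 (Ordinal iM)) //= eqxx mul1r big1 ?addr0// => i ni.
by rewrite (_ : (i == i0 :> nat) = false) ?mul0r//; apply/negbTE.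
Qed.

(** By nonnegativity the square partial sums are cofinal among the finite partial sums. This allows
    [mass] to cut both indices at the same [N]. *)
Lemma nneseries2_cvg a : (forall i j, 0 <= a i j) ->
  ((\sum_(i < N) \sum_(j < N) a i j)%:E @[N --> \oo] -->
   \sum_(i <oo) \sum_(j <oo) (a i j)%:E)%E.
Proof.
move=> a0.
have a0' i j : (0 <= (a i j)%:E)%E by rewrite lee_fin.
pose S N := (\sum_(i < N) \sum_(j < N) a i j)%:E : \bar R.
have SE N : (S N = \sum_(0 <= i < N) \sum_(0 <= j < N) (a i j)%:E)%E.
  rewrite /S -sumEFin big_mkord; apply: eq_bigr => i _.
  by rewrite -sumEFin big_mkord.
have ndS : nondecreasing_seq S.
  move=> N M NM; rewrite !SE.
  apply: (@le_trans _ _ (\sum_(0 <= i < N) \sum_(0 <= j < M) (a i j)%:E)%E).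
    apply: lee_sum => i _; apply: lee_sum_nneg_natr => //.
  by apply: lee_sum_nneg_natr => // i _ _; exact: sume_ge0.
have := ereal_nondecreasing_cvgn ndS.
suff -> : ereal_sup (range S) = (\sum_(i <oo) \sum_(j <oo) (a i j)%:E)%E by [].
apply/eqP; rewrite eq_le; apply/andP; split.
  apply: ge_ereal_sup => _ [N _ <-]; rewrite SE.
  apply: (le_trans _ (nneseries_lim_ge N _)); last first.
    by move=> i _ _; exact: nneseries_ge0.
  by apply: lee_sum => i _; apply: nneseries_lim_ge.
apply: lime_le; first by apply: is_cvg_nneseries => i _ _; exact: nneseries_ge0.
near=> K.
rewrite -nneseries_sum_nat//.
apply: lime_le.
  by apply: is_cvg_nneseries => j _ _; exact: sume_ge0.
near=> M.
apply: (@le_trans _ _ (S (maxn K M))); last by apply: ereal_sup_ubound; exists (maxn K M).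
rewrite exchange_big_nat/= SE.
apply: (@le_trans _ _ (\sum_(0 <= i < K) \sum_(0 <= j < maxn K M) (a i j)%:E)%E).
  by apply: lee_sum => i _; apply: lee_sum_nneg_natr => //; rewrite leq_maxr.
apply: lee_sum_nneg_natr => //; last by rewrite leq_maxl.
by move=> i _ _; exact: sume_ge0.
Unshelve. all: by end_near. Qed.

Definition nonneg_coef c : Prop :=
  [/\ (forall i j, 0 <= gE c i j), (forall i, 0 <= gsig c i),
      (forall i, 0 <= gvsig c i) & 0 <= gth c /\ 0 <= gvth c].

(** The coefficients [gth] and [gvth] are kept in full, so [1 - mass c N] measures exactly what is
    lost by ignoring the vertices from [N] on; all truncation errors are multiples of it. *)
Definition mass c N : R :=
  \sum_(i < N) \sum_(j < N) gE c i j + \sum_(i < N) (gsig c i + gvsig c i)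
  + gth c + gvth c.

Lemma mass_cvg c : nonneg_coef c ->
  ((mass c N)%:E @[N --> \oo] -->
  (\sum_(i <oo) \sum_(j <oo) (gE c i j)%:E)
       + (\sum_(i <oo) (gsig c i + gvsig c i)%:E)
       + (gth c)%:E + (gvth c)%:E)%E.
Proof.
move=> [E0 s0 v0 [t0 w0]].
have h1 := nneseries2_cvg E0.
have sv0 i : 0 <= gsig c i + gvsig c i by rewrite addr_ge0.
have h2 : ((\sum_(i < N) (gsig c i + gvsig c i))%:E @[N --> \oo] -->
    \sum_(i <oo) (gsig c i + gvsig c i)%:E)%E.
  rewrite (_ : (fun N => _) =
    (fun N => \sum_(0 <= i < N) (gsig c i + gvsig c i)%:E)%E).
    by apply: is_cvg_nneseries => i _ _; rewrite lee_fin.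
  by apply/funext => N; rewrite -sumEFin big_mkord.
have p1 : (0 <= \sum_(i <oo) \sum_(j <oo) (gE c i j)%:E)%E.
  by apply: nneseries_ge0 => i _ _; apply: nneseries_ge0 => j _ _; rewrite lee_fin.
have p2 : (0 <= \sum_(i <oo) (gsig c i + gvsig c i)%:E)%E.
  by apply: nneseries_ge0 => i _ _; rewrite lee_fin.
rewrite (_ : (fun N => _) = (fun N => (\sum_(i < N) \sum_(j < N) gE c i j)%:E
   + (\sum_(i < N) (gsig c i + gvsig c i))%:E + (gth c)%:E + (gvth c)%:E)%E); last first.
  by apply/funext => N; rewrite /mass !EFinD.
apply: cvgeD; first by apply: ge0_adde_def; rewrite inE ?lee_fin// !adde_ge0// ?lee_fin.
  apply: cvgeD; first by apply: ge0_adde_def; rewrite inE ?lee_fin// !adde_ge0.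
    by apply: cvgeD => //; apply: ge0_adde_def; rewrite inE.
  exact: cvg_cst.
exact: cvg_cst.
Qed.

(** Turns the identity between extended reals into a real limit, the form in which the normalization
    is used from here on. *)
Lemma is_grapheurP c :
  is_grapheur c <-> nonneg_coef c /\ (mass c N @[N --> \oo] --> (1 : R)).
Proof.
split=> [[E0 s0 v0 tw0 tot]|[nn m1]].
  have nn : nonneg_coef c by [].
  split => //; have := mass_cvg nn; rewrite tot.
  by move/fine_cvgP => [].
case: (nn) => E0 s0 v0 tw0; split => //.
have /cvg_lim := mass_cvg nn; move=> <- //.
apply/cvg_lim => //; apply/fine_cvgP; split; first by near=> n.
exact: m1.
Unshelve. all: by end_near. Qed.

End Mass.

(** * Row, column and diagonal sums, and bounds on their tails *)

Section Sums.
Context {R : realType}.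
Implicit Types (c : gcoef R) (u : nat -> R).

Lemma cvg_sumr I (r : seq I) (F : set_system nat) (FF : Filter F)
    (f : I -> nat -> R) (l : I -> R) :
  (forall i, f i n @[n --> F] --> l i) ->
  \sum_(i <- r) f i n @[n --> F] --> \sum_(i <- r) l i.
Proof.
move=> fl; elim: r => [|i r IH].
  by under eq_cvg do rewrite big_nil; rewrite big_nil; exact: cvg_cst.
by under eq_cvg do rewrite big_cons; rewrite big_cons; exact: cvgD.
Qed.

Lemma sum_mul0 M (f : 'I_M -> R) : \sum_(i < M) 0 * f i = 0.
Proof. by rewrite big1 => // i _; rewrite mul0r. Qed.

Definition tot u : R := limn (fun M => \sum_(i < M) u i).

Lemma tot_cvg u B : (forall i, 0 <= u i) -> (forall M, \sum_(i < M) u i <= B) ->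
  \sum_(i < M) u i @[M --> \oo] --> tot u.
Proof.
move=> u0 uB; apply: nondecreasing_is_cvgn.
  by apply/nondecreasing_seqP => n; rewrite big_ord_recr /= lerDl.
by exists B => _ [M _ <-]; exact: uB.
Qed.

Lemma tot_ge u B N : (forall i, 0 <= u i) -> (forall M, \sum_(i < M) u i <= B) ->
  \sum_(i < N) u i <= tot u.
Proof.
move=> u0 uB; have := tot_cvg u0 uB => /cvgP h.
apply: (nondecreasing_cvgn_le (u_ := fun M => \sum_(i < M) u i)) => //.
by apply/nondecreasing_seqP => n; rewrite big_ord_recr /= lerDl.
Qed.

(** Many small entries of a row may merge into [gsig] in a limit, so [gsig] alone is not continuous
    whereas this total is. The same holds for [gvsig] in [csum] and for [gvth] in [dsum]. *)
Definition rsum c i : R := gsig c i + tot (gE c i).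
Definition csum c j : R := gvsig c j + tot (fun i => gE c i j).
Definition dsum c : R := gvth c + tot (fun i => gE c i i).

(** [csum c] is convertible to [rsum (transp c)], so each bound on rows yields the one on columns
    without a second proof. *)
Definition transp c := GCoef (fun i j => gE c j i) (gvsig c) (gsig c) (gth c) (gvth c).

Lemma mass_transp c N : mass (transp c) N = mass c N.
Proof.
rewrite /mass /= exchange_big /=; congr (_ + _ + _ + _).
by apply: eq_bigr => i _; rewrite addrC.
Qed.

Lemma transp_grapheur c : is_grapheur c -> is_grapheur (transp c).
Proof.
move=> /is_grapheurP [[E0 s0 v0 tw0] m1]; apply/is_grapheurP; split => //.
  by split => // i j; exact: E0.
by under eq_cvg do rewrite mass_transp.
Qed.

Section grapheur.
Variable c : gcoef R.
Hypothesis gc : is_grapheur c.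

Let E0 : forall i j, 0 <= gE c i j. Proof. by case: gc. Qed.
Let s0 : forall i, 0 <= gsig c i. Proof. by case: gc. Qed.
Let v0 : forall i, 0 <= gvsig c i. Proof. by case: gc. Qed.
Let t0 : 0 <= gth c. Proof. by case: gc => _ _ _ []. Qed.
Let w0 : 0 <= gvth c. Proof. by case: gc => _ _ _ []. Qed.

Lemma mass_le1 N : mass c N <= 1.
Proof.
have /is_grapheurP [_ /[dup] m1 /cvg_lim <-//] := gc.
apply: nondecreasing_cvgn_le; last by apply/cvg_ex; exists 1.
apply/nondecreasing_seqP => n; rewrite /mass !lerD2r !big_ord_recr /= !lerD//; last first.
  by rewrite lerDl addr_ge0.
rewrite -[leLHS]addr0 lerD ?sumr_ge0//.
  by apply: ler_sum => i _; rewrite big_ord_recr /= lerDl.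
by rewrite addr_ge0 ?sumr_ge0.
Qed.

(** The source of all tail bounds below: each of them comes from choosing weights that are
    indicators of disjoint regions of the index set. *)
Lemma wsum_le M (w : nat -> nat -> R) (u v : nat -> R) :
  (forall i j, w i j <= 1) -> (forall i, u i <= 1) -> (forall i, v i <= 1) ->
  \sum_(i < M) \sum_(j < M) w i j * gE c i j
  + \sum_(i < M) u i * gsig c i + \sum_(i < M) v i * gvsig c i + gth c + gvth c <= 1.
Proof.
move=> w1 u1 v1; apply: le_trans (mass_le1 M).
rewrite /mass !lerD2r big_split/= addrA !lerD// ler_sum// => i _.
- by apply: ler_sum => j _; rewrite ler_piMl.
- by rewrite ler_piMl.
- by rewrite ler_piMl.
Qed.

Lemma wsum2E N M : (N <= M)%N -> \sum_(i < N) \sum_(j < N) gE c i j =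
  \sum_(i < M) \sum_(j < M) ((i < N)%:R * (j < N)%:R) * gE c i j.
Proof.
move=> NM; rewrite (sum_widen (fun i => \sum_(j < N) gE c i j) NM).
apply: eq_bigr => i _; rewrite (sum_widen (gE c i) NM) mulr_sumr.
by apply: eq_bigr => j _; rewrite mulrA.
Qed.

Lemma wsum1E N M : (N <= M)%N -> \sum_(i < N) \sum_(j < M) gE c i j =
  \sum_(i < M) \sum_(j < M) (i < N)%:R * gE c i j.
Proof.
move=> NM; rewrite (sum_widen (fun i => \sum_(j < M) gE c i j) NM).
by apply: eq_bigr => i _; rewrite mulr_sumr.
Qed.

Lemma wsumdE N M : (N <= M)%N -> \sum_(i < N) gE c i i =
  \sum_(i < M) \sum_(j < M) ((i < N)%:R * (i == j :> nat)%:R) * gE c i j.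
Proof.
move=> NM; rewrite (sum_widen (fun i => gE c i i) NM).
apply: eq_bigr => i _; rewrite (sum_pick (gE c i) (ltn_ord i)) mulr_sumr.
by apply: eq_bigr => j _; rewrite mulrA eq_sym.
Qed.

Lemma row_bound i M : \sum_(j < M) gE c i j <= 1.
Proof.
pose K := maxn i.+1 M.
apply: (@le_trans _ _ (\sum_(j < K) gE c i j)).
  have MK : (M <= K)%N by rewrite leq_maxr.
  rewrite (sum_widen (gE c i) MK); apply: ler_sum => j _.
  by rewrite ler_piMl//; case: (_ < _)%N.
have iK : (i < K)%N by rewrite leq_maxl.
rewrite (sum_pick (fun i => \sum_(j < K) gE c i j) iK).
have := @wsum_le K (fun k _ => (k == i)%:R) (fun=> 0) (fun=> 0).
have le1 (b : bool) : b%:R <= 1 :> R by case: b.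
rewrite (eq_bigr (fun k : 'I_K => (k == i :> nat)%:R * \sum_(j < K) gE c k j)); last first.
  by move=> k _; rewrite mulr_sumr.
rewrite !sum_mul0 !addr0 => /(_ (fun _ _ => le1 _)) /(_ (fun=> ler01) (fun=> ler01)).
by have := t0; have := w0; lra.
Qed.

End grapheur.

Section grapheur_tails.
Variable c : gcoef R.
Hypothesis gc : is_grapheur c.

Let E0 : forall i j, 0 <= gE c i j. Proof. by case: gc. Qed.
Let s0 : forall i, 0 <= gsig c i. Proof. by case: gc. Qed.
Let v0 : forall i, 0 <= gvsig c i. Proof. by case: gc. Qed.
Let t0 : 0 <= gth c. Proof. by case: gc => _ _ _ []. Qed.
Let w0 : 0 <= gvth c. Proof. by case: gc => _ _ _ []. Qed.

Lemma col_bound j M : \sum_(i < M) gE c i j <= 1.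
Proof. exact: (row_bound (transp_grapheur gc) j). Qed.

Lemma diag_bound M : \sum_(i < M) gE c i i <= 1.
Proof.
rewrite (wsumdE c (leqnn M)).
have := @wsum_le _ gc M (fun i j => (i < M)%:R * (i == j)%:R) (fun=> 0) (fun=> 0).
rewrite !sum_mul0 !addr0 => /(_ _ (fun=> ler01) (fun=> ler01)) h.
apply: le_trans (h _); first by rewrite -addrA lerDl addr_ge0.
by move=> i j; case: (_ < _)%N; case: (_ == _); rewrite /=; lra.
Qed.

Lemma rowc i : \sum_(j < M) gE c i j @[M --> \oo] --> tot (gE c i).
Proof. exact: (tot_cvg (E0 i) (row_bound gc i)). Qed.
Arguments rowc : clear implicits.

Lemma colc j : \sum_(i < M) gE c i j @[M --> \oo] --> tot (fun i => gE c i j).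
Proof. exact: (tot_cvg (fun i => E0 i j) (col_bound j)). Qed.
Arguments colc : clear implicits.

Lemma row_ge i N : gsig c i + \sum_(j < N) gE c i j <= rsum c i.
Proof. by rewrite lerD2l; apply: (tot_ge _ (E0 i) (row_bound gc i)). Qed.

Lemma diagc : \sum_(i < M) gE c i i @[M --> \oo] --> tot (fun i => gE c i i).
Proof. exact: (tot_cvg (fun i => E0 i i) diag_bound). Qed.

Lemma diag_ge N : gvth c + \sum_(i < N) gE c i i <= dsum c.
Proof. by rewrite lerD2l; apply: (tot_ge _ (fun i => E0 i i) diag_bound). Qed.

Lemma E_le_row i j : gE c i j <= rsum c i.
Proof.
apply: le_trans (row_ge i j.+1); rewrite big_ord_recr /=.
by rewrite addrA lerDr addr_ge0// sumr_ge0.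
Qed.

Lemma rsum_ge0 i : 0 <= rsum c i. Proof. exact: le_trans (E0 i 0) (E_le_row i 0). Qed.

(** For [N <= i] the row [i] is disjoint from the coefficients counted by [mass c N]. *)
Lemma row_tail N i : (N <= i)%N -> rsum c i + mass c N <= 1.
Proof.
move=> Ni; rewrite -lerBrDr /rsum -lerBrDl.
have /cvgr_to_le := rowc i; apply; near=> M.
suff : mass c N + gsig c i + \sum_(j < M) gE c i j <= 1 by lra.
have iM : (i < M)%N by near: M; exact: nbhs_infty_gt.
have NM : (N <= M)%N by rewrite (leq_trans Ni)// ltnW.
have := @wsum_le _ gc M (fun k j => (k == i)%:R + (k < N)%:R * (j < N)%:R)
  (fun k => (k == i)%:R + (k < N)%:R) (fun k => (k < N)%:R).
set X := _ + _ + _ + _ + _ => h.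
suff : X = mass c N + gsig c i + \sum_(j < M) gE c i j.
  move=> XE; rewrite XE in h.
  apply: h => [k j|k|k]; last by case: (_ < _)%N.
  + have [->|_] := eqVneq k i; first by rewrite ltnNge Ni /= mul0r addr0.
    by case: (_ < _)%N; case: (_ < _)%N; rewrite /=; lra.
  + have [->|_] := eqVneq k i; first by rewrite ltnNge Ni /= addr0.
    by case: (_ < _)%N; rewrite /=; lra.
have XE1 : \sum_(k < M) \sum_(j < M) ((k == i :> nat)%:R + (k < N)%:R * (j < N)%:R) * gE c k j
    = \sum_(k < M) \sum_(j < M) ((k < N)%:R * (j < N)%:R) * gE c k j + \sum_(j < M) gE c i j.
  rewrite (sum_pick (fun i => \sum_(j < M) gE c i j) iM) -big_split.
  apply: eq_bigr => k _; rewrite /= mulr_sumr -big_split.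
  by apply: eq_bigr => j _ /=; rewrite mulrDl addrC.
have XE2 : \sum_(k < M) ((k == i :> nat)%:R + (k < N)%:R) * gsig c k
    = \sum_(k < M) (k < N)%:R * gsig c k + gsig c i.
  rewrite (sum_pick (gsig c) iM) -big_split.
  by apply: eq_bigr => k _; rewrite /= mulrDl addrC.
rewrite /X XE1 XE2 /mass (wsum2E c NM) big_split /=.
by rewrite (sum_widen (gsig c) NM) (sum_widen (gvsig c) NM); ring.
Unshelve. all: by end_near. Qed.

(** The sum collects the entries of the first [N] rows that lie in columns from [N] on, a region
    disjoint from the square block inside [mass c N]. *)
Lemma rows_tail N : \sum_(i < N) (rsum c i - gsig c i - \sum_(j < N) gE c i j)
  + mass c N <= 1.
Proof.
rewrite -lerBrDr.
have : \sum_(i < N) (\sum_(j < M) gE c i j - \sum_(j < N) gE c i j) @[M --> \oo] -->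
  \sum_(i < N) (rsum c i - gsig c i - \sum_(j < N) gE c i j).
  apply: cvg_sumr => i; apply: cvgB; last exact: cvg_cst.
  by rewrite /rsum addrAC subrr add0r; exact: rowc.
move/cvgr_to_le; apply; near=> M.
have NM : (N <= M)%N by near: M; exact: nbhs_infty_ge.
have := @wsum_le _ gc M (fun k j => (k < N)%:R) (fun k => (k < N)%:R) (fun k => (k < N)%:R).
have le1 (b : bool) : b%:R <= 1 :> R by case: b.
move=> /(_ (fun _ _ => le1 _) (fun _ => le1 _) (fun _ => le1 _)).
rewrite -(wsum1E c NM) -(sum_widen (gsig c) NM) -(sum_widen (gvsig c) NM).
by rewrite /mass sumrB big_split /=; lra.
Unshelve. all: by end_near. Qed.

Lemma diag_tail N : dsum c - gvth c - \sum_(i < N) gE c i i + mass c N <= 1.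
Proof.
rewrite -lerBrDr.
have : \sum_(i < M) gE c i i - \sum_(i < N) gE c i i @[M --> \oo] -->
   dsum c - gvth c - \sum_(i < N) gE c i i.
  apply: cvgB; last exact: cvg_cst.
  by rewrite /dsum addrAC subrr add0r; exact: diagc.
move/cvgr_to_le; apply; near=> M.
have NM : (N <= M)%N by near: M; exact: nbhs_infty_ge.
(* The weight is the indicator of the diagonal from [N] on plus that of the [N] by [N] block. The
   factor [(k < M)%:R], equal to one on the range, gives the diagonal sum the shape of [wsumdE]. *)
have := @wsum_le _ gc M (fun k j => (k < M)%:R * (k == j)%:R - (k < N)%:R * (k == j)%:R
    + (k < N)%:R * (j < N)%:R) (fun k => (k < N)%:R) (fun k => (k < N)%:R).
rewrite -(sum_widen (gsig c) NM) -(sum_widen (gvsig c) NM).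
set X := \sum_(i < M) _ => h.
have XE : X = \sum_(i < M) gE c i i - \sum_(i < N) gE c i i + \sum_(i < N) \sum_(j < N) gE c i j.
  rewrite (wsumdE c (leqnn M)) (wsumdE c NM) (wsum2E c NM) -sumrB -big_split.
  apply: eq_bigr => i _ /=; rewrite -sumrB -big_split; apply: eq_bigr => j _ /=.
  by rewrite mulrDl mulrBl.
rewrite XE in h; rewrite /mass big_split/= lerBrDr.
rewrite -!addrA in h *; apply: h; last 2 first.
  by move=> k; case: (_ < _)%N.
  by move=> k; case: (_ < _)%N.
move=> k j; have [->|_] := eqVneq k j; case: (_ < _)%N; case: (_ < _)%N; rewrite /=; try lra;
  case: (_ < _)%N; rewrite /=; lra.
Unshelve. all: by end_near. Qed.

Lemma rsums_le1 N : \sum_(i < N) rsum c i <= 1.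
Proof.
have := rows_tail N; rewrite /mass !sumrB.
set S := \sum_(i < N) rsum c i; rewrite big_split /=.
have : 0 <= \sum_(i < N) gvsig c i by rewrite sumr_ge0.
by have := t0; have := w0; lra.
Qed.

Lemma dsum_le1 : dsum c <= 1.
Proof.
by have := diag_tail 0; rewrite /mass !big_ord0; have := t0; have := w0; lra.
Qed.

Lemma dsum_ge0 : 0 <= dsum c.
Proof. by apply: le_trans (diag_ge 0); rewrite big_ord0 addr0. Qed.

(* The homogenization of [c] beyond the first [N] vertices has a nonnegative
   [lambda^2] coefficient. *)
Lemma homog_le1 N : \sum_(i < N) rsum c i + \sum_(j < N) csum c j
  - \sum_(i < N) \sum_(j < N) gE c i j + dsum c - \sum_(i < N) gE c i i <= 1.
Proof.
have h : \sum_(i < N) (gsig c i + \sum_(j < M) gE c i j)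
  + \sum_(j < N) (gvsig c j + \sum_(i < M) gE c i j)
  - \sum_(i < N) \sum_(j < N) gE c i j + (gvth c + \sum_(i < M) gE c i i) - \sum_(i < N) gE c i i
  @[M --> \oo] --> \sum_(i < N) rsum c i + \sum_(j < N) csum c j
  - \sum_(i < N) \sum_(j < N) gE c i j + dsum c - \sum_(i < N) gE c i i.
  apply: cvgB; last exact: cvg_cst.
  apply: cvgD; last by apply: cvgD; [exact: cvg_cst|exact: diagc].
  apply: cvgB; last exact: cvg_cst.
  apply: cvgD; first by apply: cvg_sumr => i; apply: cvgD; [exact: cvg_cst|exact: rowc].
  by apply: cvg_sumr => i; apply: cvgD; [exact: cvg_cst|exact: colc].
have /cvgr_to_le := h; apply; near=> M.
have NM : (N <= M)%N by near: M; exact: nbhs_infty_ge.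
(* By inclusion and exclusion, the weight is the indicator of the union of the first [N] rows and
   columns, plus that of the diagonal from [N] on. *)
have := @wsum_le _ gc M (fun k j => (k < N)%:R + (j < N)%:R - (k < N)%:R * (j < N)%:R +
   ((k < M)%:R * (k == j)%:R - (k < N)%:R * (k == j)%:R)) (fun k => (k < N)%:R) (fun k => (k < N)%:R).
rewrite -(sum_widen (gsig c) NM) -(sum_widen (gvsig c) NM).
set X := \sum_(i < M) _ => {}h.
have XE : X = \sum_(i < N) \sum_(j < M) gE c i j + \sum_(j < N) \sum_(i < M) gE c i j
  - \sum_(i < N) \sum_(j < N) gE c i j + (\sum_(i < M) gE c i i - \sum_(i < N) gE c i i).
  rewrite (wsum1E c NM) (wsum2E c NM) (wsumdE c (leqnn M)) (wsumdE c NM).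
  rewrite (sum_widen (fun j => \sum_(i < M) gE c i j) NM).
  under [in X in _ + X - _ + _]eq_bigr do rewrite mulr_sumr.
  rewrite [in X in _ + X - _ + _]exchange_big /= -!sumrB -!big_split -!sumrB -!big_split.
  apply: eq_bigr => i _ /=; rewrite -!sumrB -!big_split -!sumrB -!big_split.
  by apply: eq_bigr => j _ /=; ring.
rewrite XE in h; rewrite !big_split/=.
apply: le_trans (h _ _ _); last 2 first.
- by move=> k; case: (_ < _)%N.
- by move=> k; case: (_ < _)%N.
- by have := t0; lra.
move=> k j; have [->|_] := eqVneq k j; case: (_ < _)%N; case: (_ < _)%N; rewrite /=; try lra;
  case: (_ < _)%N; rewrite /=; lra.
Unshelve. all: by end_near. Qed.

End grapheur_tails.
End Sums.

(** * Grapheurs as random measures *)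

Section Realization.
Context {R : realType}.
Implicit Types (c : gcoef R) (t : nat -> R) (A : set (R * R)).

Notation leb := (@lebesgue_measure R).

Let m01 : measurable (`[0%R, 1%R]%classic : set R).
Proof. exact: measurable_itv. Qed.

Lemma measurable_sq01 : measurable (@sq01 R).
Proof. exact: measurableX. Qed.

Definition horiz (x y : R) : R * R := (x, y).
Definition vert (y x : R) : R * R := (x, y).
Definition diagm (x : R) : R * R := (x, x).

Lemma measurable_horiz x : measurable_fun setT (horiz x).
Proof. exact: pair1_measurable. Qed.
Lemma measurable_vert x : measurable_fun setT (vert x).
Proof. exact: pair2_measurable. Qed.
Lemma measurable_diagm : measurable_fun setT diagm.
Proof. exact: measurable_fun_pair. Qed.

Section push.
Variables (f : R -> R * R) (mf : measurable_fun setT f).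
Definition lpush := pushforward (mrestr leb m01) f.
Let push0 : lpush set0 = 0%E. Proof. by rewrite /lpush /pushforward preimage_set0 measure0. Qed.
Let push_ge0 A : (0 <= lpush A)%E. Proof. exact: measure_ge0. Qed.
Let push_sigma_additive : semi_sigma_additive lpush.
Proof. exact: measure_semi_sigma_additive. Qed.
(** The measurability proof is a phantom argument that lets the measure instance be attached to the
    term [mpush mf]. The definition of [gprob] carries [is_grapheur c] for the same purpose. *)
Definition mpush (_ : measurable_fun setT f) := lpush.
HB.instance Definition _ := isMeasure.Build _ _ _ (mpush mf) push0 push_ge0 push_sigma_additive.
End push.

(** [mscale] takes a nonnegative real; the absolute value makes [gmeasure] a measure for every [c],
    equal to [gmeas] as soon as the coefficients are nonnegative. *)
Definition absn (x : R) : {nonneg R} := `|x|%:nng.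

Definition gm1 c t := mseries (fun i => mseries (fun j =>
   mscale (absn (gE c i j)) (dirac (t i, t j))) 0) 0.
Definition gm2 c t := mseries (fun i => measure_add
   (mscale (absn (gsig c i)) (mpush (measurable_horiz (t i))))
   (mscale (absn (gvsig c i)) (mpush (measurable_vert (t i))))) 0.
Section square.
Definition lsq (A : set (R * R)) : \bar R := (leb \x leb)%E (A `&` @sq01 R).
Let lsq0 : lsq set0 = 0%E. Proof. by rewrite /lsq set0I measure0. Qed.
Let lsq_ge0 A : (0 <= lsq A)%E. Proof. exact: measure_ge0. Qed.
Let lsq_sigma_additive : semi_sigma_additive lsq.
Proof.
move=> F mF tF mU.
exact: (@measure_semi_sigma_additive _ _ _ (mrestr (leb \x leb)%E measurable_sq01) F mF tF mU).
Qed.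
HB.instance Definition _ := isMeasure.Build _ _ _ lsq lsq0 lsq_ge0 lsq_sigma_additive.
End square.

Definition gm3 c := mscale (absn (gth c)) lsq.
Definition gm4 c := mscale (absn (gvth c)) (mpush measurable_diagm).

Definition gmeasure c t : {measure set (R * R) -> \bar R} :=
  measure_add (measure_add (measure_add (gm1 c t) (gm2 c t)) (gm3 c)) (gm4 c).

Lemma mscale_normE (m : {measure set (R * R) -> \bar R}) (r : R) A : 0 <= r ->
  mscale (absn (r)) m A = (r%:E * m A)%E.
Proof. by move=> r0; rewrite /mscale; congr (_%:E * _)%E; exact: ger0_norm. Qed.

Lemma gmeasureE c t A : nonneg_coef c -> gmeasure c t A = gmeas c t A.
Proof.
move=> [E0 s0 v0 [t0 w0]].
have -> : gmeasure c t A = (gm1 c t A + gm2 c t A + gm3 c A + gm4 c A)%E.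
  transitivity (measure_add (measure_add (gm1 c t) (gm2 c t)) (gm3 c) A + gm4 c A)%E.
    exact: measure_addE.
  congr (_ + _)%E; transitivity (measure_add (gm1 c t) (gm2 c t) A + gm3 c A)%E.
    exact: measure_addE.
  by congr (_ + _)%E; exact: measure_addE.
rewrite /gmeas; congr (_ + _ + _ + _)%E.
- rewrite /gm1 /mseries; apply: eq_eseriesr => i _; apply: eq_eseriesr => j _.
  exact: mscale_normE.
- rewrite /gm2 /mseries; apply: eq_eseriesr => i _.
  transitivity (mscale (absn (gsig c i)) (mpush (measurable_horiz (t i))) A +
     mscale (absn (gvsig c i)) (mpush (measurable_vert (t i))) A)%E; first exact: measure_addE.
  by congr (_ + _)%E; exact: mscale_normE.
- exact: mscale_normE.
- exact: mscale_normE.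
Qed.

Lemma leb01 : leb `[0%R, 1%R]%classic = 1%E.
Proof. by rewrite lebesgue_measure_itv /= lte_fin ltr01 oppr0 adde0. Qed.

Lemma leb2_sq01 : (leb \x leb)%E (@sq01 R) = 1%E.
Proof.
rewrite product_measure1E// -[RHS]mul1e; congr (_ * _)%E; exact: leb01.
Qed.

Lemma gmeas_setT c t : is_grapheur c -> gmeas c t setT = 1%E.
Proof.
move=> [E0 s0 v0 [t0 w0] <-]; rewrite /gmeas /Defs.leb; congr (_ + _ + _ + _)%E.
- by apply: eq_eseriesr => i _; apply: eq_eseriesr => j _; rewrite indicT mule1.
- by apply: eq_eseriesr => i _; rewrite !setTI leb01 !mule1.
- by rewrite setTI leb2_sq01 mule1.
- by rewrite setTI leb01 mule1.
Qed.

Lemma grapheur_nonneg c : is_grapheur c -> nonneg_coef c.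
Proof. by case. Qed.

Section giry_grapheur.
Variables (c : gcoef R) (gc : is_grapheur c) (t : nat -> R).

Definition gprob (_ : is_grapheur c) : set (R * R) -> \bar R := gmeasure c t.
Let gprob0 : gprob gc set0 = 0%E. Proof. exact: measure0. Qed.
Let gprob_ge0 A : (0 <= gprob gc A)%E. Proof. exact: measure_ge0. Qed.
Let gprob_sigma_additive : semi_sigma_additive (gprob gc).
Proof. exact: measure_semi_sigma_additive. Qed.

HB.instance Definition _ := isMeasure.Build _ _ _ (gprob gc) gprob0 gprob_ge0 gprob_sigma_additive.

Let gprob_setT : (gprob gc setT <= 1)%E.
Proof. by rewrite /gprob gmeasureE ?gmeas_setT//; exact: grapheur_nonneg. Qed.

HB.instance Definition _ := Measure_isSubProbability.Build _ _ _ (gprob gc) gprob_setT.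

Definition gM : PM R := gprob gc.

Lemma gME A : gM A = gmeas c t A.
Proof. by rewrite /gM /= /gprob gmeasureE//; exact: grapheur_nonneg. Qed.

End giry_grapheur.

Lemma measurable_gmeas d (Om : measurableType d) (T : nat -> Om -> R) c A :
  nonneg_coef c -> (forall i, measurable_fun setT (T i)) -> measurable A ->
  measurable_fun setT ((fun w => gmeas c (T ^~ w) A) : Om -> \bar R).
Proof.
move=> [E0 s0 v0 [t0 w0]] mT mA; rewrite /gmeas /Defs.leb.
(* Cutting [A] with a strip turns the slices inside the unit interval into plain sections, whose
   Lebesgue measure is measurable in the base point. *)
have mres : measurable (A `&` (setT `*` `[0%R, 1%R]%classic)) by apply: measurableI => //; exact: measurableX.
have mres' : measurable (A `&` (`[0%R, 1%R]%classic `*` setT)) by apply: measurableI => //; exact: measurableX.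
apply: emeasurable_funD; last exact: measurable_cst.
apply: emeasurable_funD; last exact: measurable_cst.
apply: emeasurable_funD.
  apply: ge0_emeasurable_sum => [i w _ _|i _].
    by apply: nneseries_ge0 => j _ _; rewrite mule_ge0// lee_fin.
  apply: ge0_emeasurable_sum => [j w _ _|j _].
    by rewrite mule_ge0// lee_fin.
  apply: measurable_funeM; apply/measurable_EFinP.
  have -> : (fun w => \1_A (T i w, T j w)) = \1_A \o (fun w => (T i w, T j w)) :> (Om -> R) by [].
  by apply: measurableT_comp => //; exact: measurable_fun_pair.
apply: ge0_emeasurable_sum => [i w _ _|i _].
  by rewrite adde_ge0// mule_ge0// lee_fin.
apply: emeasurable_funD; apply: measurable_funeM.
  rewrite (_ : (fun w => _) = (fun x => leb (xsection (A `&` (setT `*` `[0%R, 1%R]%classic)) x)) \o T i); last first.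
    apply/funext => w /=; congr (leb _); rewrite /xsection; apply/seteqP; split => y /=.
      by move=> [? ?]; rewrite inE.
    by rewrite inE => -[? []].
  by apply: measurableT_comp => //; exact: measurable_fun_xsection.
rewrite (_ : (fun w => _) = (fun x => leb (ysection (A `&` (`[0%R, 1%R]%classic `*` setT)) x)) \o T i); last first.
  apply/funext => w /=; congr (leb _); rewrite /ysection; apply/seteqP; split => y /=.
    by move=> [? ?]; rewrite inE.
  by rewrite inE => -[? []].
by apply: measurableT_comp => //; exact: measurable_fun_ysection.
Qed.

Lemma realizes_gM d (Om : measurableType d) (T : nat -> Om -> R) c (gc : is_grapheur c) :
  (forall i, measurable_fun setT (T i)) -> realizes c T (fun w => gM gc (T ^~ w)).
Proof.
move=> mT; split; last by move=> w A mA; rewrite gME.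
apply: measurable_giry_codensity => // B mB.
under eq_fun do rewrite gME.
exact: (measurable_gmeas (grapheur_nonneg gc)).
Qed.

End Realization.

(** * Truncation to finitely many vertices *)

Section Truncation.
Context {R : realType}.
Implicit Types (c : gcoef R) (t : nat -> R) (A : set (R * R)) (X Y : set R).

Notation leb := (@lebesgue_measure R).

Definition hsec (t : R) A : R := fine (leb ([set y | A (t, y)] `&` `[0%R, 1%R])).
Definition vsec (t : R) A : R := fine (leb ([set x | A (x, t)] `&` `[0%R, 1%R])).
Definition area A : R := fine ((leb \x leb)%E (A `&` @sq01 R)).
Definition dsec A : R := fine (leb ([set x | A (x, x)] `&` `[0%R, 1%R])).

Definition gtrunc c t N A : R :=
  \sum_(i < N) \sum_(j < N) gE c i j * \1_A (t i, t j)
  + \sum_(i < N) (gsig c i * hsec (t i) A + gvsig c i * vsec (t i) A)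
  + gth c * area A + gvth c * dsec A.

Lemma meas_le d (T : measurableType d) (m : {measure set T -> \bar R}) (A B : set T) :
  measurable A -> measurable B -> A `<=` B -> (m A <= m B)%E.
Proof. by move=> mA mB AB; have := @le_measure _ R T m A B; rewrite !inE; apply. Qed.

Lemma prob_set_compl d (T : measurableType d) (m : {measure set T -> \bar R}) (A : set T) : m setT = 1%E ->
  measurable A -> m A \is a fin_num /\ fine (m (~` A)) = 1 - fine (m A).
Proof.
move=> m1 mA; have mAC := measurableC mA.
have lt B : measurable B -> (m B < +oo)%E.
  move=> mB; have le : (m B <= m setT)%E by exact: meas_le.
  by apply: le_lt_trans le _; rewrite m1 ltry.
have fA : m A \is a fin_num by rewrite ge0_fin_numE// lt.
split=> //; apply/eqP; rewrite -subr_eq0; apply/eqP.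
have h : (m A + m (~` A) = 1)%E.
  rewrite -measureU//; last by rewrite setICr.
  by rewrite setUv.
have fC : m (~` A) \is a fin_num by rewrite ge0_fin_numE// lt.
have := congr1 fine h; rewrite fineD//= => <-; ring.
Qed.

Lemma mpush_setT f (mf : measurable_fun setT f) : mpush (R:=R) mf setT = 1%E.
Proof. by rewrite /mpush /lpush /pushforward /mrestr preimage_setT setTI leb01. Qed.

Lemma hsecP (t : R) A : measurable A ->
  leb ([set y | A (t, y)] `&` `[0%R, 1%R]) = (hsec t A)%:E /\ hsec t (~` A) = 1 - hsec t A.
Proof.
move=> mA; have [f c] := prob_set_compl (mpush_setT (measurable_horiz t)) mA.
by split; [rewrite /hsec fineK|exact: c].
Qed.

Lemma vsecP (t : R) A : measurable A ->
  leb ([set x | A (x, t)] `&` `[0%R, 1%R]) = (vsec t A)%:E /\ vsec t (~` A) = 1 - vsec t A.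
Proof.
move=> mA; have [f c] := prob_set_compl (mpush_setT (measurable_vert t)) mA.
by split; [rewrite /vsec fineK|exact: c].
Qed.

Lemma dsecP A : measurable A ->
  leb ([set x | A (x, x)] `&` `[0%R, 1%R]) = (dsec A)%:E /\ dsec (~` A) = 1 - dsec A.
Proof.
move=> mA; have [f c] := prob_set_compl (mpush_setT measurable_diagm) mA.
by split; [rewrite /dsec fineK|exact: c].
Qed.

Lemma areaP A : measurable A ->
  (leb \x leb)%E (A `&` @sq01 R) = (area A)%:E /\ area (~` A) = 1 - area A.
Proof.
move=> mA; have lsqT : @lsq R setT = 1%E by rewrite /lsq setTI leb2_sq01.
have [f c] := prob_set_compl lsqT mA.
by split; [rewrite /area fineK|exact: c].
Qed.

(** Each summand of [gtrunc] is a coefficient times a probability of [A], and these coefficients add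
    up to [mass c N]. *)
Lemma gtruncC c t N A : measurable A -> gtrunc c t N (~` A) = mass c N - gtrunc c t N A.
Proof.
move=> mA; rewrite /gtrunc /mass.
have [_ ->] := areaP mA; have [_ ->] := dsecP mA.
have -> : \sum_(i < N) \sum_(j < N) gE c i j * \1_(~` A) (t i, t j) =
  \sum_(i < N) \sum_(j < N) gE c i j - \sum_(i < N) \sum_(j < N) gE c i j * \1_A (t i, t j).
  rewrite -sumrB; apply: eq_bigr => i _; rewrite -sumrB; apply: eq_bigr => j _.
  by rewrite !indicE in_setC; case: (_ \in A) => /=; ring.
have -> : \sum_(i < N) (gsig c i * hsec (t i) (~` A) + gvsig c i * vsec (t i) (~` A)) =
  \sum_(i < N) (gsig c i + gvsig c i) -
  \sum_(i < N) (gsig c i * hsec (t i) A + gvsig c i * vsec (t i) A).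
  rewrite -sumrB; apply: eq_bigr => i _.
  by have [_ ->] := hsecP (t i) mA; have [_ ->] := vsecP (t i) mA; ring.
ring.
Qed.

Lemma gtrunc_le c t N A : nonneg_coef c -> measurable A ->
  ((gtrunc c t N A)%:E <= gmeas c t A)%E.
Proof.
move=> [E0 s0 v0 [t0 w0]] mA; rewrite /gtrunc /gmeas /Defs.leb !EFinD !EFinM.
have [-> _] := areaP mA; have [-> _] := dsecP mA.
rewrite leeD// leeD// leeD//.
- rewrite -sumEFin; apply: le_trans (nneseries_lim_ge N _); last first.
    by move=> i _ _; apply: nneseries_ge0 => j _ _; rewrite mule_ge0// lee_fin.
  rewrite big_mkord; apply: lee_sum => i _; rewrite -sumEFin.
  apply: le_trans (nneseries_lim_ge N _); last first.
    by move=> j _ _; rewrite mule_ge0// lee_fin.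
  by rewrite big_mkord; apply: lee_sum => j _; rewrite EFinM.
- rewrite -sumEFin; apply: le_trans (nneseries_lim_ge N _); last first.
    by move=> i _ _; rewrite adde_ge0// mule_ge0// lee_fin.
  rewrite big_mkord; apply: lee_sum => i _; rewrite EFinD !EFinM.
  by have [-> _] := hsecP (t i) mA; have [-> _] := vsecP (t i) mA.
Qed.

Lemma gmeas_fin c t A : is_grapheur c -> measurable A -> gmeas c t A \is a fin_num.
Proof.
move=> gc mA; rewrite -(gME gc).
by have [] := prob_set_compl (m := gM gc t) (etrans (gME gc t setT) (gmeas_setT t gc)) mA.
Qed.

(* Both [A] and its complement dominate their truncations, and the total
   defect is [1 - mass c N]. *)
Lemma gmeas_trunc c t N A : is_grapheur c -> measurable A ->
  `|fine (gmeas c t A) - gtrunc c t N A| <= 1 - mass c N.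
Proof.
move=> gc mA; have nn := grapheur_nonneg gc.
have mC := measurableC mA.
have fA := gmeas_fin t gc mA.
have := gtrunc_le t N nn mA; have := gtrunc_le t N nn mC.
rewrite (gtruncC _ _ _ mA).
have hC : fine (gmeas c t (~` A)) = 1 - fine (gmeas c t A).
  rewrite -!(gME gc).
  by have [] := prob_set_compl (m := gM gc t) (etrans (gME gc t setT) (gmeas_setT t gc)) mA.
have fC := gmeas_fin t gc mC.
rewrite -(fineK fA) -(fineK fC) !lee_fin hC => h1 h2.
by rewrite ger0_norm; lra.
Qed.

Definition meas01 X : R := fine (leb (X `&` `[0%R, 1%R])).

Lemma leb_itv01_lty X : measurable X -> (leb (X `&` `[0%R, 1%R]) < +oo)%E.
Proof.
move=> mX; have mXI : measurable (X `&` `[0%R, 1%R]) by exact: measurableI.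
have le : (leb (X `&` `[0%R, 1%R]) <= leb `[0%R, 1%R]%classic)%E by exact: meas_le.
by apply: le_lt_trans le _; rewrite leb01 ltry.
Qed.

Lemma gtrunc_rect c t N X Y : measurable X -> measurable Y ->
  gtrunc c t N (X `*` Y) =
  \sum_(i < N) \sum_(j < N) gE c i j * (\1_X (t i) * \1_Y (t j))
  + \sum_(i < N) (gsig c i * (\1_X (t i) * meas01 Y) + gvsig c i * (meas01 X * \1_Y (t i)))
  + gth c * (meas01 X * meas01 Y) + gvth c * meas01 (X `&` Y).
Proof.
move=> mX mY; rewrite /gtrunc; congr (_ + _ + _ + _).
- apply: eq_bigr => i _; apply: eq_bigr => j _; congr (_ * _).
  by rewrite !indicE in_setX /= -natrM mulnb.
- apply: eq_bigr => i _; congr (_ * _ + _ * _).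
    rewrite /hsec indicE; case: (boolP (_ \in X)).
      rewrite inE mul1r => Xi; congr (fine (leb _)); apply/seteqP; split => y /=.
        by move=> [[]].
      by move=> [].
    rewrite notin_setE mul0r => nX.
    rewrite (_ : _ `&` _ = set0) ?measure0//; apply/seteqP; split => y //= [[]] //.
  rewrite /vsec indicE; case: (boolP (_ \in Y)).
    rewrite inE mulr1 => Xi; congr (fine (leb _)); apply/seteqP; split => y /=.
      by move=> [[]].
    by move=> [].
  rewrite notin_setE mulr0 => nX.
  rewrite (_ : _ `&` _ = set0) ?measure0//; apply/seteqP; split => y //= [[]] //.
- congr (_ * _); rewrite /area /sq01 -setXI.
  rewrite product_measure1E//; last 2 first.
    exact: measurableI. exact: measurableI.
  rewrite fineM//; rewrite ge0_fin_numE//; exact: leb_itv01_lty.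
Qed.

Lemma meas01_ge0 X : 0 <= meas01 X.
Proof. exact: fine_ge0. Qed.

Lemma meas01_le1 X : measurable X -> meas01 X <= 1.
Proof.
move=> mX; have mXI : measurable (X `&` `[0%R, 1%R]) by exact: measurableI.
have le : (leb (X `&` `[0%R, 1%R]) <= leb `[0%R, 1%R]%classic)%E by exact: meas_le.
rewrite /meas01 -lee_fin fineK; first by move: le; rewrite leb01.
by rewrite ge0_fin_numE//; exact: leb_itv01_lty.
Qed.

End Truncation.

(** * L1 bound on rectangles *)

Section FiniteProduct.
Context {R : realType} {I S : finType}.
Variable p : S -> R.
Hypotheses (p0 : forall s, 0 <= p s) (p1 : \sum_s p s = 1).
Implicit Types (psi : {ffun I -> S} -> R).

(** Expectation for the product of copies of [p]. Only the cells of finitely many points matter for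
    a truncated grapheur, so the moment computation is a finite sum. *)
Definition Ex psi : R := \sum_(f : {ffun I -> S}) (\prod_i p (f i)) * psi f.

Definition mean (u : S -> R) : R := \sum_s p s * u s.

Lemma Ex_prod (U : I -> S -> R) :
  Ex (fun f => \prod_i U i (f i)) = \prod_i mean (U i).
Proof.
rewrite /Ex /mean bigA_distr_bigA; apply: eq_bigr => f _.
by rewrite -big_split.
Qed.

Lemma eq_Ex psi1 psi2 : psi1 =1 psi2 -> Ex psi1 = Ex psi2.
Proof. by move=> h; apply: eq_bigr => f _; rewrite h. Qed.

Lemma ExD psi1 psi2 : Ex (fun f => psi1 f + psi2 f) = Ex psi1 + Ex psi2.
Proof. by rewrite /Ex -big_split; apply: eq_bigr => f _ /=; rewrite mulrDr. Qed.

Lemma ExZ a psi : Ex (fun f => a * psi f) = a * Ex psi.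
Proof. by rewrite /Ex mulr_sumr; apply: eq_bigr => f _; rewrite mulrCA. Qed.

Lemma Ex_sum (J : finType) (psi : J -> {ffun I -> S} -> R) :
  Ex (fun f => \sum_j psi j f) = \sum_j Ex (psi j).
Proof. by rewrite /Ex exchange_big /=; apply: eq_bigr => f _; rewrite mulr_sumr. Qed.

Lemma Ex_cst a : Ex (fun=> a) = a.
Proof.
transitivity (a * Ex (fun f => \prod_(i : I) 1)).
  by rewrite -ExZ; apply: eq_Ex => f; rewrite big1// mulr1.
rewrite (Ex_prod (fun _ _ => 1)) big1 ?mulr1// => i _.
by rewrite /mean -[RHS]p1; apply: eq_bigr => s _; rewrite mulr1.
Qed.

Lemma le_Ex psi1 psi2 : (forall f, psi1 f <= psi2 f) -> Ex psi1 <= Ex psi2.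
Proof.
move=> h; apply: ler_sum => f _; rewrite ler_wpM2l//.
by apply: prodr_ge0.
Qed.

Lemma norm_Ex psi B : (forall f, `|psi f| <= B) -> `|Ex psi| <= B.
Proof.
move=> h; rewrite ler_norml; apply/andP; split.
  by rewrite -[leLHS]Ex_cst; apply: le_Ex => f; have := h f; rewrite ler_norml => /andP[].
by rewrite -[leRHS]Ex_cst; apply: le_Ex => f; have := h f; rewrite ler_norml => /andP[].
Qed.

(** Expansion of [0 <= (eta - |psi|) ^ 2]; it plays the part of the Cauchy-Schwarz inequality and
    keeps square roots out of the bounds. *)
Lemma Ex_abs eta psi : 0 < eta -> Ex (fun f => `|psi f|) <=
  eta / 2 + Ex (fun f => psi f ^+ 2) / (2 * eta).
Proof.
move=> e0; rewrite [X in _ + X]mulrC -ExZ -[X in X + _]Ex_cst -ExD.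
apply: le_Ex => f; rewrite -real_normK ?num_real//.
set x := `|psi f|; rewrite -subr_ge0.
have -> : eta / 2 + (2 * eta)^-1 * x ^+ 2 - x = (eta - x) ^+ 2 / (2 * eta).
  by field; rewrite gt_eqF.
by rewrite divr_ge0 ?sqr_ge0// mulr_ge0// ltW.
Qed.

Lemma prod_pick (g : I -> R) i : \prod_m (if m == i then g m else 1) = g i.
Proof. by rewrite -big_mkcond big_pred1_eq. Qed.

(* The factor with an index of its own can be averaged out. *)
Lemma Ex4_alone (u v w z : S -> R) i j k l : mean u = 0 ->
  i != j -> i != k -> i != l ->
  Ex (fun f => u (f i) * (v (f j) * w (f k) * z (f l))) = 0.
Proof.
move=> mu0 ij ik il.
pose g i u m (s : S) : R := if (m : I) == i then (u s : R) else 1.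
transitivity (Ex (fun f => \prod_m (g i u m (f m) * (g j v m (f m) * g k w m (f m) * g l z m (f m))))).
  apply: eq_Ex => f; rewrite !big_split /g /=.
  by rewrite (prod_pick (fun m => u (f m))) (prod_pick (fun m => v (f m)))
     (prod_pick (fun m => w (f m))) (prod_pick (fun m => z (f m))).
rewrite (Ex_prod (fun m s => g i u m s * (g j v m s * g k w m s * g l z m s))).
rewrite (bigD1 i) //= (_ : mean _ = 0) ?mul0r// -[RHS]mu0.
apply: eq_bigr => s _; rewrite /g eqxx.
by rewrite (negbTE ij) (negbTE ik) (negbTE il) !mulr1.
Qed.

Section quadratic.
Variables (x y : S -> R) (e : I -> I -> R).
Hypotheses (mx : mean x = 0) (my : mean y = 0).
Hypotheses (x1 : forall s, `|x s| <= 1) (y1 : forall s, `|y s| <= 1).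
Hypothesis e0 : forall i, e i i = 0.

(** If [i] or [j] does not reappear among [k] and [l], a centered factor stands alone and the
    expectation vanishes. Otherwise [(k, l)] is [(i, j)] or [(j, i)], and all factors are bounded by
    one. *)
Lemma Ex_pair i j k l : i != j -> k != l ->
  `|Ex (fun f => (x (f i) * y (f j)) * (x (f k) * y (f l)))|
  <= ((k == i) && (l == j))%:R + ((k == j) && (l == i))%:R.
Proof.
move=> ij kl.
have [hi|] := boolP ((i == k) || (i == l)); last first.
  rewrite negb_or => /andP[ik il].
  rewrite (_ : Ex _ = 0) ?normr0 ?addr_ge0//.
  transitivity (Ex (fun f => x (f i) * (y (f j) * x (f k) * y (f l)))).
    by apply: eq_Ex => f; ring.
  exact: Ex4_alone.
have [hj|] := boolP ((j == k) || (j == l)); last first.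
  rewrite negb_or => /andP[jk jl].
  rewrite (_ : Ex _ = 0) ?normr0 ?addr_ge0//.
  transitivity (Ex (fun f => y (f j) * (x (f i) * x (f k) * y (f l)))).
    by apply: eq_Ex => f; ring.
  by apply: Ex4_alone => //; rewrite eq_sym.
apply: (@le_trans _ _ 1).
  apply: norm_Ex => f; rewrite !normrM.
  by rewrite mulr_ile1 ?mulr_ge0// mulr_ile1.
case/orP: hi => /eqP hi; case/orP: hj => /eqP hj; subst.
- by rewrite eqxx in ij.
- by rewrite !eqxx lerDl.
- by rewrite !eqxx lerDr.
- by rewrite eqxx in ij.
Qed.

(** By [Ex_pair] only the products of [e i j] with itself and with [e j i] survive; the latter are
    bounded by the mean of the two squares, which gives the factor 2. *)
Lemma Ex_quad_sq :
  Ex (fun f => (\sum_i \sum_j e i j * (x (f i) * y (f j))) ^+ 2)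
  <= 2 * \sum_i \sum_j e i j ^+ 2.
Proof.
have -> : Ex (fun f => (\sum_i \sum_j e i j * (x (f i) * y (f j))) ^+ 2) =
  \sum_i \sum_j \sum_k \sum_l (e i j * e k l) *
     Ex (fun f => (x (f i) * y (f j)) * (x (f k) * y (f l))).
  rewrite (eq_Ex (psi2 := fun f => \sum_i \sum_j \sum_k \sum_l (e i j * e k l) *
     ((x (f i) * y (f j)) * (x (f k) * y (f l))))); last first.
    move=> f; rewrite expr2 mulr_suml; apply: eq_bigr => i _.
    rewrite mulr_suml; apply: eq_bigr => j _; rewrite mulr_sumr; apply: eq_bigr => k _.
    by rewrite mulr_sumr; apply: eq_bigr => l _; ring.
  rewrite Ex_sum; apply: eq_bigr => i _; rewrite Ex_sum; apply: eq_bigr => j _.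
  rewrite Ex_sum; apply: eq_bigr => k _; rewrite Ex_sum; apply: eq_bigr => l _.
  by rewrite ExZ.
apply: (@le_trans _ _ (\sum_i \sum_j (`|e i j| ^+ 2 + `|e i j| * `|e j i|))).
  apply: ler_sum => i _; apply: ler_sum => j _.
  apply: (@le_trans _ _ (\sum_k \sum_l (((k == i) && (l == j))%:R + ((k == j) && (l == i))%:R) *
      (`|e i j| * `|e k l|))).
    apply: ler_sum => k _; apply: ler_sum => l _.
    have [->|ij] := eqVneq i j; first by rewrite e0 normr0 !mul0r mulr0.
    have [->|kl] := eqVneq k l; first by rewrite e0 normr0 mulr0 mul0r mulr0.
    apply: le_trans (ler_norm _) _; rewrite normrM mulrC normrM ler_wpM2r ?mulr_ge0//.
    exact: Ex_pair.
  have pick2 a b : \sum_k \sum_l ((k == a) && (l == b))%:R * (`|e i j| * `|e k l|)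
     = `|e i j| * `|e a b|.
    rewrite (bigD1 a) //= (bigD1 b) //= !eqxx mul1r big1 ?addr0.
      rewrite big1 ?addr0// => k /negbTE ka.
      by rewrite big1// => l _; rewrite ka mul0r.
    by move=> l /negbTE ->; rewrite andbF mul0r.
  rewrite expr2 -!pick2 -big_split /=; apply: ler_sum => k _.
  rewrite -big_split; apply: ler_sum => l _ /=.
  by rewrite mulrDl.
have sw : \sum_i \sum_j `|e j i| ^+ 2 = \sum_i \sum_j `|e i j| ^+ 2 by rewrite exchange_big.
apply: (@le_trans _ _ (\sum_i \sum_j (`|e i j| ^+ 2 + 2^-1 * (`|e i j| ^+ 2 + `|e j i| ^+ 2)))).
  apply: ler_sum => i _; apply: ler_sum => j _; rewrite lerD2l.
  have := sqr_ge0 (`|e i j| - `|e j i|); nra.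
have -> : \sum_i \sum_j (`|e i j| ^+ 2 + 2^-1 * (`|e i j| ^+ 2 + `|e j i| ^+ 2)) =
   \sum_i \sum_j `|e i j| ^+ 2 + 2^-1 * (\sum_i \sum_j `|e i j| ^+ 2 + \sum_i \sum_j `|e j i| ^+ 2).
  rewrite -big_split mulr_sumr -big_split; apply: eq_bigr => i _ /=.
  rewrite -big_split mulr_sumr -big_split; apply: eq_bigr => j _ /=; ring.
rewrite sw (_ : \sum_i \sum_j `|e i j| ^+ 2 = \sum_i \sum_j e i j ^+ 2); last first.
  by apply: eq_bigr => i _; apply: eq_bigr => j _; rewrite real_normK// num_real.
lra.
Qed.
End quadratic.

Lemma Ex2 (u v : S -> R) i j : mean u = 0 -> i != j -> Ex (fun f => u (f i) * v (f j)) = 0.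
Proof.
move=> u0 ij; transitivity (Ex (fun f => u (f i) * (v (f j) * 1 * 1))).
  by apply: eq_Ex => f; rewrite !mulr1.
exact: (@Ex4_alone u v (fun=> 1) (fun=> 1) i j j j).
Qed.

(** Additivity of the variance: the mixed terms are products of independent centered factors. *)
Lemma Ex_lin_sq (v : I -> S -> R) (B : I -> R) :
  (forall i, mean (v i) = 0) -> (forall i s, `|v i s| <= B i) ->
  Ex (fun f => (\sum_i v i (f i)) ^+ 2) <= \sum_i B i ^+ 2.
Proof.
move=> v0 vB.
have -> : Ex (fun f => (\sum_i v i (f i)) ^+ 2) =
  \sum_i \sum_j Ex (fun f => v i (f i) * v j (f j)).
  rewrite (eq_Ex (psi2 := fun f => \sum_i \sum_j v i (f i) * v j (f j))); last first.
    by move=> f; rewrite expr2 mulr_suml; apply: eq_bigr => i _; rewrite mulr_sumr.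
  by rewrite Ex_sum; apply: eq_bigr => i _; rewrite Ex_sum.
apply: ler_sum => i _; rewrite (bigD1 i) //= [X in _ + X]big1 ?addr0; last first.
  by move=> j ji; rewrite Ex2// eq_sym.
apply: le_trans (ler_norm _) _; apply: norm_Ex => f.
by rewrite normrM expr2 ler_pM.
Qed.

(** The second moments are at most [2 * 2 * eta ^ 2] for the quadratic part and [5 * 10 * eta ^ 2]
    for the linear part, so [Ex_abs] gives [(1/2 + 2) * eta] and [(1/2 + 25) * eta], that is
    [28 * eta] in total. *)
Lemma Ex_quad_lin (x y : S -> R) (e : I -> I -> R) (v : I -> S -> R) (B : I -> R) eta :
  0 < eta -> mean x = 0 -> mean y = 0 ->
  (forall s, `|x s| <= 1) -> (forall s, `|y s| <= 1) -> (forall i, e i i = 0) ->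
  (forall i, mean (v i) = 0) -> (forall i s, `|v i s| <= B i) ->
  (forall i j, `|e i j| <= eta ^+ 2) -> \sum_i \sum_j `|e i j| <= 2 ->
  (forall i, B i <= 5 * eta ^+ 2) -> (forall i, 0 <= B i) -> \sum_i B i <= 10 ->
  Ex (fun f => `|\sum_i \sum_j e i j * (x (f i) * y (f j)) + \sum_i v i (f i)|) <= 28 * eta.
Proof.
move=> eta0 mx my x1 y1 e0 mv vB eE eS BE B0 BS.
have eta2 : 0 <= eta ^+ 2 by rewrite sqr_ge0.
have h1 : \sum_i \sum_j e i j ^+ 2 <= 2 * eta ^+ 2.
  apply: (@le_trans _ _ (eta ^+ 2 * \sum_i \sum_j `|e i j|)); last first.
    by rewrite mulrC ler_wpM2r.
  rewrite mulr_sumr; apply: ler_sum => i _; rewrite mulr_sumr; apply: ler_sum => j _.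
  by rewrite -real_normK ?num_real// expr2 ler_wpM2r.
have h2 : \sum_i B i ^+ 2 <= 50 * eta ^+ 2.
  apply: (@le_trans _ _ (5 * eta ^+ 2 * \sum_i B i)).
    by rewrite mulr_sumr; apply: ler_sum => i _; rewrite expr2 ler_wpM2r.
  have : eta ^+ 2 * \sum_i B i <= eta ^+ 2 * 10 by rewrite ler_wpM2l.
  lra.
have q1 := Ex_quad_sq mx my x1 y1 e0.
have q2 := Ex_lin_sq mv vB.
have a1 := Ex_abs (fun f => \sum_i \sum_j e i j * (x (f i) * y (f j))) eta0.
have a2 := Ex_abs (fun f => \sum_i v i (f i)) eta0.
apply: le_trans (le_Ex (fun f => ler_normD _ _)) _; rewrite ExD.
apply: le_trans (lerD a1 a2) _.
set A := Ex (fun f => _ ^+ 2) in a1 q1 *; set C := Ex (fun f => _ ^+ 2) in a2 q2 *.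
have hA : A / (2 * eta) <= 2 * eta.
  by rewrite ler_pdivrMr ?mulr_gt0//; move: q1 h1; rewrite expr2; lra.
have hC : C / (2 * eta) <= 25 * eta.
  by rewrite ler_pdivrMr ?mulr_gt0//; move: q2 h2; rewrite expr2; lra.
lra.
Qed.

End FiniteProduct.

(** * Reduction of integrals to finite product expectations *)

Section Cells.
Context {R : realType}.

Lemma bigsetI_seqP (I : eqType) (V : Type) (s : seq I) (F : I -> set V) w :
  (\big[setI/setT]_(i <- s) F i) w <-> (forall i, i \in s -> F i w).
Proof.
elim: s => [|a s IH]; first by rewrite big_nil.
rewrite big_cons; split => [[Fa /IH h] i|h].
  by rewrite inE => /predU1P[->//|/h].
split; first by apply: h; rewrite mem_head.
by apply/IH => i si; apply: h; rewrite inE si orbT.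
Qed.

Lemma integral_finite_sum d (Om : measurableType d) (P : {finite_measure set Om -> \bar R}) (I : finType)
    (D : I -> set Om) (a : I -> R) : (forall i, measurable (D i)) ->
  (\int[P]_w (\sum_i a i * \1_(D i) w)%:E = (\sum_i a i * fine (P (D i)))%:E)%E.
Proof.
move=> mD.
under eq_integral do rewrite -sumEFin.
rewrite integral_sum//; last first.
  move=> i; under eq_fun do rewrite EFinM.
  by apply: integrableZl => //; exact: integrable_indic.
rewrite -sumEFin; apply: eq_bigr => i _.
under eq_integral do rewrite EFinM.
rewrite integralZl//; last exact: integrable_indic.
rewrite integral_indic// setIT EFinM fineK//.
exact: fin_num_measure.
Qed.

Context d (Om : measurableType d) (P : probability Om R) (T : nat -> Om -> R).
Hypothesis iid : iid_unif P T.
Context {S : finType}.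
Variables (cl : R -> S) (C : S -> set R).
Hypotheses (mC : forall s, measurable (C s)) (clC : forall s t, C s t <-> cl t = s).

Definition cellv N (w : Om) : {ffun 'I_N -> S} := [ffun i : 'I_N => cl (T i w)].

(** The independence clause of [iid_unif] takes a family of sets indexed by all natural numbers;
    [setT] is the padding beyond [N]. *)
Let cset N (f : {ffun 'I_N -> S}) (i : nat) : set R :=
  if (insub i : option 'I_N) is Some i' then C (f i') else setT.

Let cellset N (f : {ffun 'I_N -> S}) : set Om :=
  \big[setI/setT]_(i <- index_iota 0 N) (T i @^-1` cset f i).

Let cset_ord N (f : {ffun 'I_N -> S}) (i : 'I_N) : cset f i = C (f i).
Proof. by rewrite /cset valK. Qed.

Let mcset N (f : {ffun 'I_N -> S}) i : measurable (cset f i).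
Proof. by rewrite /cset; case: insub. Qed.

Lemma cellvE N f w : cellset f w <-> cellv N w = f.
Proof.
rewrite /cellset bigsetI_seqP; split => [h|<- i].
  apply/ffunP => i; rewrite ffunE; apply/clC.
  have := h i; rewrite mem_index_iota /= ltn_ord => /(_ isT).
  by rewrite cset_ord.
rewrite mem_index_iota /= => iN.
rewrite /= -[i]/(val (Ordinal iN)) cset_ord; apply/clC.
by rewrite ffunE.
Qed.

Let mcellset N (f : {ffun 'I_N -> S}) : measurable (cellset f).
Proof.
case: iid => mT _ _; rewrite /cellset; apply: bigsetI_measurable => i _.
by rewrite -[X in measurable X]setTI; exact: mT.
Qed.

Lemma cellv_sumE N (psi : {ffun 'I_N -> S} -> R) w :
  psi (cellv N w) = \sum_f psi f * \1_(cellset f) w.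
Proof.
rewrite (bigD1 (cellv N w)) //= big1 ?addr0.
  rewrite indicE mem_set ?mulr1//; exact/cellvE.
move=> f fn; rewrite indicE memNset ?mulr0// => /cellvE h.
by rewrite h eqxx in fn.
Qed.

Lemma measurable_cellv N (psi : {ffun 'I_N -> S} -> R) :
  measurable_fun setT (fun w => psi (cellv N w)).
Proof.
under eq_fun do rewrite cellv_sumE.
apply: measurable_sum => f; apply: measurable_funM => //.
Qed.

(** The vector of cells takes finitely many values, and by independence the probability of each
    value is a product of cell lengths. *)
Lemma integral_cellv N (psi : {ffun 'I_N -> S} -> R) :
  (\int[P]_w (psi (cellv N w))%:E = (Ex (fun s => meas01 (C s)) psi)%:E)%E.
Proof.
case: (iid) => mT uT ind.
under eq_integral do rewrite cellv_sumE.
rewrite integral_finite_sum//; congr EFin; apply: eq_bigr => f _.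
rewrite mulrC; congr (_ * _).
rewrite /cellset ind ?iota_uniq// big_mkord.
by apply: eq_bigr => i _; rewrite uT ?cset_ord// mC.
Qed.

End Cells.

(** * Homogenized values on a rectangle *)

Section L1bound.
Context {R : realType}.
Implicit Types (c : gcoef R) (x y : nat -> R) (a b g : R).

Definition gclose (e : R) c1 c2 : Prop :=
  [/\ (forall i j, `|gE c1 i j - gE c2 i j| <= e),
      (forall i, `|rsum c1 i - rsum c2 i| <= e),
      (forall i, `|csum c1 i - csum c2 i| <= e) & `|dsum c1 - dsum c2| <= e].

(* Value on a rectangle of the grapheur obtained by spreading uniformly the
   vertices beyond [N]; [a], [b], [g] are the lengths of the two sides and of
   their intersection, [x] and [y] the membership indicators of the vertices. *)
Definition homog c N x y a b g : R :=
  \sum_(i < N) \sum_(j < N) gE c i j * (x i * y j)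
  + \sum_(i < N) ((rsum c i - \sum_(j < N) gE c i j) * (x i * b)
                  + (csum c i - \sum_(j < N) gE c j i) * (a * y i))
  + (1 - \sum_(i < N) rsum c i - \sum_(i < N) csum c i
     + \sum_(i < N) \sum_(j < N) gE c i j - dsum c + \sum_(i < N) gE c i i) * (a * b)
  + (dsum c - \sum_(i < N) gE c i i) * g.

Definition rtrunc c N x y a b g : R :=
  \sum_(i < N) \sum_(j < N) gE c i j * (x i * y j)
  + \sum_(i < N) (gsig c i * (x i * b) + gvsig c i * (a * y i))
  + gth c * (a * b) + gvth c * g.

(** In terms of the centered indicators the partial row and column sums cancel: the linear part
    involves only [rsum], [csum] and the diagonal entries, the constant part only [dsum]. These are
    the data that [gclose] compares, uniformly in [N]. *)
Lemma homog_centered c N x y a b g : homog c N x y a b g =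
  \sum_(i < N) \sum_(j < N) ((i != j :> nat)%:R * gE c i j) * ((x i - a) * (y j - b))
  + \sum_(i < N) (b * (rsum c i - gE c i i) * (x i - a)
       + a * (csum c i - gE c i i) * (y i - b) + gE c i i * (x i * y i - g))
  + (1 - dsum c) * (a * b) + dsum c * g.
Proof.
have -> : \sum_(i < N) \sum_(j < N) ((i != j :> nat)%:R * gE c i j) * ((x i - a) * (y j - b))
  = \sum_(i < N) \sum_(j < N) gE c i j * (x i * y j)
    - \sum_(i < N) (\sum_(j < N) gE c i j) * (x i * b)
    - \sum_(i < N) (\sum_(j < N) gE c j i) * (a * y i)
    + \sum_(i < N) (\sum_(j < N) gE c i j) * (a * b)
    - \sum_(i < N) gE c i i * ((x i - a) * (y i - b)).
  have -> : \sum_(i < N) (\sum_(j < N) gE c j i) * (a * y i) =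
      \sum_(i < N) \sum_(j < N) gE c i j * (a * y j).
    by rewrite exchange_big /=; apply: eq_bigr => i _; rewrite mulr_suml.
  rewrite -!sumrB -big_split -sumrB; apply: eq_bigr => i _ /=.
  rewrite (_ : gE c i i * ((x i - a) * (y i - b)) =
     \sum_(j < N) (j == i :> nat)%:R * (gE c i j * ((x i - a) * (y j - b)))); last first.
    by rewrite -(sum_pick (fun j => gE c i j * ((x i - a) * (y j - b)))).
  rewrite !mulr_suml -!sumrB -big_split -sumrB; apply: eq_bigr => j _ /=.
  by rewrite [j == i :> nat]eq_sym; case: (_ == _) => /=; ring.
rewrite /homog.
have -> : (1 - \sum_(i < N) rsum c i - \sum_(i < N) csum c i
     + \sum_(i < N) \sum_(j < N) gE c i j - dsum c + \sum_(i < N) gE c i i) * (a * b)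
   = (1 - dsum c) * (a * b) + \sum_(i < N) (\sum_(j < N) gE c i j - rsum c i - csum c i + gE c i i) * (a * b).
  by rewrite -mulr_suml [\sum_(i < N) (_ + gE c i i)]big_split /= !sumrB; ring.
have -> : (dsum c - \sum_(i < N) gE c i i) * g = dsum c * g - \sum_(i < N) gE c i i * g.
  by rewrite -mulr_suml; ring.
set S := \sum_(i < N) \sum_(j < N) gE c i j * (x i * y j).
suff : \sum_(i < N) ((rsum c i - \sum_(j < N) gE c i j) * (x i * b)
                  + (csum c i - \sum_(j < N) gE c j i) * (a * y i))
   + \sum_(i < N) (\sum_(j < N) gE c i j - rsum c i - csum c i + gE c i i) * (a * b)
   - \sum_(i < N) gE c i i * g =
   - \sum_(i < N) (\sum_(j < N) gE c i j) * (x i * b)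
    - \sum_(i < N) (\sum_(j < N) gE c j i) * (a * y i)
    + \sum_(i < N) (\sum_(j < N) gE c i j) * (a * b)
    - \sum_(i < N) gE c i i * ((x i - a) * (y i - b))
    + \sum_(i < N) (b * (rsum c i - gE c i i) * (x i - a)
       + a * (csum c i - gE c i i) * (y i - b) + gE c i i * (x i * y i - g)) by lra.
rewrite -big_split -!sumrB -sumrN -!sumrB -!big_split -sumrB -big_split.
by apply: eq_bigr => i _ /=; ring.
Qed.

Lemma sum_scale_bound N (u : 'I_N -> R) (z : 'I_N -> R) B :
  (forall i, 0 <= u i) -> (forall i, 0 <= z i <= 1) -> \sum_(i < N) u i <= B ->
  0 <= \sum_(i < N) u i * z i <= B.
Proof.
move=> u0 z01 uB; apply/andP; split.
  by apply: sumr_ge0 => i _; rewrite mulr_ge0//; case/andP: (z01 i).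
by apply: le_trans uB; apply: ler_sum => i _; rewrite ler_piMr//; case/andP: (z01 i).
Qed.

(** The spread rows, columns and diagonal each weigh at most [tau = 1 - mass c N]. What is left for
    the product term is at most [3 * tau] in absolute value, hence the factor [1 + 1 + 3 + 1]. *)
Lemma homog_trunc c N x y a b g : is_grapheur c ->
  (forall i, 0 <= x i <= 1) -> (forall i, 0 <= y i <= 1) ->
  0 <= a <= 1 -> 0 <= b <= 1 -> 0 <= g <= 1 ->
  `|homog c N x y a b g - rtrunc c N x y a b g| <= 6 * (1 - mass c N).
Proof.
move=> gc x01 y01 a01 b01 g01.
have m01 (u v : R) : 0 <= u <= 1 -> 0 <= v <= 1 -> 0 <= u * v <= 1.
  by move=> /andP[? ?] /andP[? ?]; rewrite mulr_ge0//= mulr_ile1.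
pose u i := rsum c i - gsig c i - \sum_(j < N) gE c i j.
pose v i := csum c i - gvsig c i - \sum_(j < N) gE c j i.
pose w := dsum c - gvth c - \sum_(i < N) gE c i i.
pose tau := 1 - mass c N.
have uB : \sum_(i < N) u i <= tau by have := rows_tail gc N; rewrite /tau /u; lra.
have vB : \sum_(i < N) v i <= tau.
  have : \sum_(i < N) v i + mass (transp c) N <= 1 by exact: (rows_tail (transp_grapheur gc) N).
  by rewrite mass_transp /tau; lra.
have wB : w <= tau by have := diag_tail gc N; rewrite /tau /w; lra.
have u0 i : 0 <= u i by have := row_ge gc i N; rewrite /u; lra.
have v0 i : 0 <= v i.
  have : gvsig c i + \sum_(j < N) gE c j i <= csum c i by exact: (row_ge (transp_grapheur gc) i N).
  by rewrite /v; set A := \sum_(j < N) _; set B := csum c i; lra.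
have w0 : 0 <= w by have := diag_ge gc N; rewrite /w; lra.
have t0 : 0 <= tau by have := mass_le1 gc N; rewrite /tau; lra.
have -> : homog c N x y a b g - rtrunc c N x y a b g =
   \sum_(i < N) u i * (x i * b) + \sum_(i < N) v i * (a * y i)
   + (tau - \sum_(i < N) u i - \sum_(i < N) v i - w) * (a * b) + w * g.
  rewrite /homog /rtrunc.
  have -> : \sum_(i < N) ((rsum c i - \sum_(j < N) gE c i j) * (x i * b)
                  + (csum c i - \sum_(j < N) gE c j i) * (a * y i)) =
     \sum_(i < N) (gsig c i * (x i * b) + gvsig c i * (a * y i)) +
     \sum_(i < N) u i * (x i * b) + \sum_(i < N) v i * (a * y i).
    by rewrite -!big_split; apply: eq_bigr => i _ /=; rewrite /u /v; ring.
  have -> : \sum_(i < N) u i = \sum_(i < N) rsum c i - \sum_(i < N) gsig c i - \sum_(i < N) \sum_(j < N) gE c i j.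
    by rewrite /u !sumrB.
  have -> : \sum_(i < N) v i = \sum_(i < N) csum c i - \sum_(i < N) gvsig c i - \sum_(i < N) \sum_(j < N) gE c i j.
    by rewrite /v !sumrB exchange_big.
  by rewrite /w /tau /mass [\sum_(i < N) (gsig c i + gvsig c i)]big_split /=; ring.
have /andP[A1 A2] := @sum_scale_bound N u (fun i => x i * b) _ (fun i => u0 i) (fun i => m01 _ _ (x01 i) b01) uB.
have /andP[B1 B2] := @sum_scale_bound N v (fun i => a * y i) _ (fun i => v0 i) (fun i => m01 _ _ a01 (y01 i)) vB.
have /andP[C1 C2] := m01 _ _ a01 b01.
have U0 : 0 <= \sum_(i < N) u i by apply: sumr_ge0.
have V0 : 0 <= \sum_(i < N) v i by apply: sumr_ge0.
case/andP: g01 => g0 g1.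
have wg : w * g <= w by rewrite ler_piMr.
have wg0 : 0 <= w * g by rewrite mulr_ge0.
set z := tau - _ - _ - w.
have z1 : `|z * (a * b)| <= 3 * tau.
  rewrite normrM (ger0_norm C1) -[leRHS]mulr1 ler_pM// ler_norml /z; apply/andP; split; lra.
by rewrite -/tau; move: z1; rewrite !ler_norml => /andP[? ?]; apply/andP; split; lra.
Qed.

End L1bound.

(** * L1 distance of two close grapheurs on a rectangle *)

Section L1close.
Context {R : realType}.
Implicit Types (c : gcoef R) (X Y : set R).

(** The two sides of a rectangle may overlap, so the memberships of one point in [X] and in [Y] are
    correlated; the four joint outcomes are the alphabet for [Ex]. *)
Definition cell4 X Y (s : bool * bool) : set R :=
  (if s.1 then X else ~` X) `&` (if s.2 then Y else ~` Y).
Definition idx4 X Y (t : R) : bool * bool := (t \in X, t \in Y).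

Lemma cell4P X Y s t : cell4 X Y s t <-> idx4 X Y t = s.
Proof.
case: s => s1 s2; rewrite /cell4 /idx4 /=; split.
  case: s1; case: s2 => /= -[A B]; congr pair; by [rewrite mem_set | rewrite memNset].
move=> -[<- <-]; split; case: ifPn; rewrite ?inE ?notin_setE//.
Qed.

Lemma measurable_cell4 X Y s : measurable X -> measurable Y -> measurable (cell4 X Y s).
Proof.
move=> mX mY; apply: measurableI; case: ifP => _ //; exact: measurableC.
Qed.

Lemma meas01_setT : meas01 (setT : set R) = 1.
Proof. by rewrite /meas01 setTI leb01. Qed.

Lemma meas01_split X Y : measurable X -> measurable Y ->
  meas01 X = meas01 (X `&` Y) + meas01 (X `&` ~` Y).
Proof.
move=> mX mY; have mXY := measurableI _ _ mX mY.
have mC := measurableC mY.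
have mXC := measurableI _ _ mX mC.
rewrite /meas01 -fineD; last 2 first.
- by rewrite ge0_fin_numE//; exact: leb_itv01_lty.
- by rewrite ge0_fin_numE//; exact: leb_itv01_lty.
congr fine; rewrite -measureU//.
- by congr lebesgue_measure; rewrite -!setIUl -setIUr setUv setIT.
- exact: measurableI.
- exact: measurableI.
- by apply/seteqP; split => // z /= [[[_ ?] _] [[_ ?] _]].
Qed.

Lemma sum_bool2 (F : bool * bool -> R) :
  \sum_s F s = F (true, true) + F (true, false) + F (false, true) + F (false, false).
Proof.
rewrite (eq_bigr (fun s => F (s.1, s.2))); last by case.
by rewrite -(pair_bigA _ (fun u v => F (u, v))) /= !big_bool /= addrA.
Qed.

Section bound.
Variables (X Y : set R).
Hypotheses (mX : measurable X) (mY : measurable Y).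
Let a := meas01 X.
Let b := meas01 Y.
Let g := meas01 (X `&` Y).
Let p s := meas01 (cell4 X Y s).

Let p11 : p (true, true) = g. Proof. by []. Qed.
Let p10 : p (true, true) + p (true, false) = a.
Proof. by rewrite /a (meas01_split mX mY). Qed.
Let p01 : p (true, true) + p (false, true) = b.
Proof. by rewrite /b (meas01_split mY mX) /p /cell4 /= (setIC X) (setIC (~` X)). Qed.
Let p_tot : \sum_s p s = 1.
Proof.
rewrite sum_bool2 p10 -addrA -meas01_setT (meas01_split measurableT mX) setTI; congr (_ + _).
by rewrite setTI (meas01_split (measurableC mX) mY).
Qed.
Let p_ge0 s : 0 <= p s. Proof. exact: meas01_ge0. Qed.

Let a01 : 0 <= a <= 1. Proof. by rewrite meas01_ge0 meas01_le1. Qed.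
Let b01 : 0 <= b <= 1. Proof. by rewrite meas01_ge0 meas01_le1. Qed.
Let g01 : 0 <= g <= 1.
Proof. by rewrite meas01_ge0 meas01_le1//; exact: measurableI. Qed.

Let xs (s : bool * bool) : R := s.1%:R - a.
Let ys (s : bool * bool) : R := s.2%:R - b.
Let zs (s : bool * bool) : R := s.1%:R * s.2%:R - g.

Let mean_xs : mean p xs = 0.
Proof.
rewrite /mean sum_bool2 /xs /=; have := p_tot; rewrite sum_bool2.
by move: p10; set u := p _; set v := p _; set w := p _; set z := p _ => <- h; nra.
Qed.
Let mean_ys : mean p ys = 0.
Proof.
rewrite /mean sum_bool2 /ys /=; have := p_tot; rewrite sum_bool2.
by move: p01; set u := p _; set v := p _; set w := p _; set z := p _ => <- h; nra.
Qed.
Let mean_zs : mean p zs = 0.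
Proof.
rewrite /mean sum_bool2 /zs /=; have := p_tot; rewrite sum_bool2.
by rewrite -p11; set u := p _; set v := p _; set w := p _; set z := p _ => h; nra.
Qed.

Let b1 (t : bool) (u : R) : 0 <= u <= 1 -> `|t%:R - u| <= 1.
Proof.
by move=> /andP[? ?]; rewrite ler_norml; case: t => /=; apply/andP; split; lra.
Qed.
Let xs1 s : `|xs s| <= 1. Proof. exact: b1. Qed.
Let ys1 s : `|ys s| <= 1. Proof. exact: b1. Qed.
Let zs1 s : `|zs s| <= 1. Proof. by rewrite /zs -natrM mulnb; exact: b1. Qed.

Context d (Om : measurableType d) (P : probability Om R) (T : nat -> Om -> R).
Hypothesis iid : iid_unif P T.
Variables (c1 c2 : gcoef R).
Hypotheses (gc1 : is_grapheur c1) (gc2 : is_grapheur c2).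
Variable eta : R.
Hypotheses (eta0 : 0 < eta) (eta1 : eta <= 1).
Hypothesis c12 : gclose (eta ^+ 2) c1 c2.

Let e i j : R := gE c1 i j - gE c2 i j.
Let rho i : R := rsum c1 i - rsum c2 i.
Let kap i : R := csum c1 i - csum c2 i.
(** Contribution of vertex [i] to the linear part of the difference of the two expansions given by
    [homog_centered]. *)
Let vv i s : R := b * (rho i - e i i) * xs s + a * (kap i - e i i) * ys s + e i i * zs s.
Let psi N (f : {ffun 'I_N -> bool * bool}) : R :=
  `|\sum_(i < N) \sum_(j < N) ((i != j :> nat)%:R * e i j) * (xs (f i) * ys (f j)) + \sum_(i < N) vv i (f i)|.

Let Ex_psi N : Ex p (@psi N) <= 28 * eta.
Proof.
have [cE cr cc cd] := c12.
have eta2 : 0 <= eta ^+ 2 by rewrite sqr_ge0.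
have E10 i j : 0 <= gE c1 i j by case: gc1.
have E20 i j : 0 <= gE c2 i j by case: gc2.
have sum_abs (u v : nat -> R) : (forall i, 0 <= u i) -> (forall i, 0 <= v i) ->
    \sum_(i < N) u i <= 1 -> \sum_(i < N) v i <= 1 -> \sum_(i < N) `|u i - v i| <= 2.
  move=> u0 v0 u1 v1; apply: (@le_trans _ _ (\sum_(i < N) (u i + v i))).
    apply: ler_sum => i _; rewrite (le_trans (ler_normB _ _))// !ger0_norm//.
  by rewrite big_split /=; lra.
have rowE c (gc : is_grapheur c) i : \sum_(j < N) gE c i j <= rsum c i.
  by have := row_ge gc i N; case: gc => _ s0 _ _ _; have := s0 i; lra.
have sumE c (gc : is_grapheur c) : \sum_(i < N) \sum_(j < N) gE c i j <= 1.
  by apply: le_trans (rsums_le1 gc N); apply: ler_sum => i _; exact: rowE.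
(* The bound on [vv i] is at most [5 * eta ^ 2], each of its five terms being at most [eta ^ 2]. Its
   sum over [i] is at most [2 + 2 + 3 * 2 = 10], as rows, columns and diagonals of a grapheur have
   total at most one. *)
apply: (@Ex_quad_lin _ _ _ p p_ge0 p_tot xs ys (fun i j : 'I_N => (i != j :> nat)%:R * e i j)
   (fun i : 'I_N => vv i) (fun i : 'I_N => `|rho i| + `|kap i| + 3 * `|e i i|) eta) => //.
- by move=> i; rewrite eqxx mul0r.
- move=> i; transitivity (b * (rho i - e i i) * mean p xs + a * (kap i - e i i) * mean p ys
     + e i i * mean p zs); last by rewrite mean_xs mean_ys mean_zs !mulr0 !addr0.
  rewrite /mean !mulr_sumr -!big_split; apply: eq_bigr => s _ /=; rewrite /vv; ring.
- move=> i s; have n1 (u v w : R) : 0 <= u <= 1 -> `|w| <= 1 -> `|u * v * w| <= `|v|.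
    move=> /andP[u0 u1] w1; rewrite !normrM (ger0_norm u0) -[leRHS]mulr1 ler_pM//.
      by rewrite mulr_ge0.
    by rewrite ler_piMl.
  have l1 := n1 b (rho i - e i i) (xs s) b01 (xs1 s).
  have l2 := n1 a (kap i - e i i) (ys s) a01 (ys1 s).
  have l3 : `|e i i * zs s| <= `|e i i| by rewrite normrM ler_piMr.
  rewrite /vv; apply: le_trans (ler_normD _ _) _.
  apply: le_trans (lerD (ler_normD _ _) (lexx _)) _.
  have := ler_normB (rho i) (e i i); have := ler_normB (kap i) (e i i); lra.
- move=> i j; case: (_ != _); rewrite /= ?mul1r ?mul0r ?normr0//; exact: cE.
- apply: (@le_trans _ _ (\sum_(i < N) \sum_(j < N) (gE c1 i j + gE c2 i j))).
    apply: ler_sum => i _; apply: ler_sum => j _; case: (_ != _) => /=; last first.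
      by rewrite mul0r normr0 addr_ge0.
    by rewrite mul1r (le_trans (ler_normB _ _))// !ger0_norm.
  rewrite (eq_bigr (fun i : 'I_N => \sum_(j < N) gE c1 i j + \sum_(j < N) gE c2 i j)); last first.
    by move=> i _; rewrite big_split.
  by rewrite big_split /=; have := sumE _ gc1; have := sumE _ gc2; lra.
- by move=> i; have := cr i; have := cc i; have := cE i i; rewrite -/(rho i) -/(kap i) -/(e i i); lra.
- rewrite !big_split /= -mulr_sumr.
  have r2 := sum_abs _ _ (fun i => rsum_ge0 gc1 i) (fun i => rsum_ge0 gc2 i) (rsums_le1 gc1 N) (rsums_le1 gc2 N).
  have k2 := sum_abs _ _ (fun i => rsum_ge0 (transp_grapheur gc1) i) (fun i => rsum_ge0 (transp_grapheur gc2) i)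
     (rsums_le1 (transp_grapheur gc1) N) (rsums_le1 (transp_grapheur gc2) N).
  have diag1 c (gc : is_grapheur c) : \sum_(i < N) gE c i i <= 1.
    by apply: le_trans (dsum_le1 gc); have := diag_ge gc N; case: gc => _ _ _ [_ w0] _; lra.
  have e2 := sum_abs (fun i => gE c1 i i) (fun i => gE c2 i i) (fun i => E10 i i) (fun i => E20 i i) (diag1 _ gc1) (diag1 _ gc2).
  have {}k2 : \sum_(i < N) `|kap i| <= 2 by exact: k2.
  have {}e2 : \sum_(i < N) `|e i i| <= 2 by exact: e2.
  have {}r2 : \sum_(i < N) `|rho i| <= 2 by exact: r2.
  lra.
Qed.

(** The factor 7 adds the error 1 of [gmeas_trunc] to the error 6 of [homog_trunc]. The lone [eta]
    bounds the constant terms, which differ by [(dsum c1 - dsum c2) * (g - a * b)]; there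
    [eta ^ 2 <= eta] is used. *)
Let pointwise N w :
  `|fine (gmeas c1 (T ^~ w) (X `*` Y)) - fine (gmeas c2 (T ^~ w) (X `*` Y))|
  <= psi (cellv T (idx4 X Y) N w) + (eta + 7 * (1 - mass c1 N) + 7 * (1 - mass c2 N)).
Proof.
pose x i : R := \1_X (T i w); pose y i : R := \1_Y (T i w).
have x01 i : 0 <= x i <= 1 by rewrite /x indicE; case: (_ \in _) => /=; rewrite ?lexx ler01.
have y01 i : 0 <= y i <= 1 by rewrite /y indicE; case: (_ \in _) => /=; rewrite ?lexx ler01.
have mXY : measurable (X `*` Y) by exact: measurableX.
have t1 := gmeas_trunc (T ^~ w) N gc1 mXY.
have t2 := gmeas_trunc (T ^~ w) N gc2 mXY.
have h1 := homog_trunc N gc1 x01 y01 a01 b01 g01.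
have h2 := homog_trunc N gc2 x01 y01 a01 b01 g01.
rewrite gtrunc_rect// in t1; rewrite gtrunc_rect// in t2.
rewrite -[X in `|_ - X|]/(rtrunc c1 N x y a b g) in t1.
rewrite -[X in `|_ - X|]/(rtrunc c2 N x y a b g) in t2.
have hd : `|homog c1 N x y a b g - homog c2 N x y a b g| <= psi (cellv T (idx4 X Y) N w) + eta.
  rewrite !homog_centered.
  have -> : forall A1 A2 B1 B2 D1 D2 E1 E2 : R,
     A1 + B1 + D1 + E1 - (A2 + B2 + D2 + E2) = (A1 - A2) + (B1 - B2) + ((D1 - D2) + (E1 - E2)).
    by move=> *; ring.
  apply: le_trans (ler_normD _ _) _; apply: lerD.
    rewrite /psi le_eqVlt; apply/orP; left; apply/eqP; congr (`|_ + _|).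
      rewrite -sumrB; apply: eq_bigr => i _; rewrite -sumrB; apply: eq_bigr => j _.
      by rewrite !ffunE /xs /ys /idx4 /x /y !indicE /e /=; ring.
    rewrite -sumrB; apply: eq_bigr => i _.
    by rewrite !ffunE /vv /xs /ys /zs /idx4 /x /y !indicE /rho /kap /e /=; ring.
  have -> : (1 - dsum c1) * (a * b) - (1 - dsum c2) * (a * b) + (dsum c1 * g - dsum c2 * g)
     = (dsum c1 - dsum c2) * (g - a * b) by ring.
  have [_ _ _ cd] := c12.
  have eta2 : eta ^+ 2 <= eta by rewrite expr2 ler_piMr// ltW.
  apply: le_trans (le_trans cd eta2).
  rewrite normrM ler_piMr// ler_norml.
  case/andP: a01 => ? ?; case/andP: b01 => ? ?; case/andP: g01 => ? ?.
  have : 0 <= a * b by rewrite mulr_ge0.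
  have : a * b <= 1 by rewrite mulr_ile1.
  by move=> ? ?; apply/andP; split; lra.
move: t1 t2 h1 h2 hd.
set F1 := fine _; set F2 := fine _; set r1 := rtrunc _ _ _ _ _ _ _; set r2 := rtrunc _ _ _ _ _ _ _.
set H1 := homog _ _ _ _ _ _ _; set H2 := homog _ _ _ _ _ _ _; set Psi := psi _.
move: (mass c1 N) (mass c2 N) => m1 m2.
rewrite !ler_norml => /andP[? ?] /andP[? ?] /andP[? ?] /andP[? ?] /andP[? ?].
by apply/andP; split; lra.
Qed.

(** The moment bound [28 * eta] holds for every [N]; taking [N] large makes the truncation errors at
    most [eta], and the constant terms add another [eta]. *)
Lemma close_L1 : (\int[P]_w (`|fine (gmeas c1 (T ^~ w) (X `*` Y))
    - fine (gmeas c2 (T ^~ w) (X `*` Y))|%:E) <= (30 * eta)%:E)%E.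
Proof.
have [N hN] : exists N, 7 * (1 - mass c1 N) + 7 * (1 - mass c2 N) <= eta.
  have /is_grapheurP[_ m1] := gc1; have /is_grapheurP[_ m2] := gc2.
  have e1 : 0 < eta / 14 by rewrite divr_gt0.
  have /cvgrPdist_le/(_ _ e1) h1 := m1; have /cvgrPdist_le/(_ _ e1) h2 := m2.
  have [N [n1 n2]] : exists N, `|1 - mass c1 N| <= eta / 14 /\ `|1 - mass c2 N| <= eta / 14.
    by have [N _ hN] := filterI h1 h2; exists N; have [] := hN N (leqnn N).
  by exists N; move: n1 n2; rewrite !ler_norml => /andP[_ ?] /andP[_ ?]; lra.
have mXY : measurable (X `*` Y) by exact: measurableX.
have mT : forall i, measurable_fun setT (T i) by case: iid.
have mfin c : is_grapheur c -> measurable_fun setT (fun w => fine (gmeas c (T ^~ w) (X `*` Y))).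
  move=> gc; apply: measurableT_comp => //.
  exact: (measurable_gmeas (grapheur_nonneg gc) mT mXY).
pose psi' (f : {ffun 'I_N -> bool * bool}) : R := psi f + 2 * eta.
apply: (@le_trans _ _ (\int[P]_w (psi' (cellv T (idx4 X Y) N w))%:E)%E).
  apply: ge0_le_integral => //.
  - apply/measurable_EFinP; apply: measurableT_comp => //.
    by apply: measurable_funB; exact: mfin.
  - apply/measurable_EFinP.
    apply: (measurable_cellv iid (C := cell4 X Y)) => //; first by move=> s; exact: measurable_cell4.
    exact: cell4P.
  - move=> w _; rewrite lee_fin; apply: le_trans (pointwise N w) _.
    by rewrite /psi' lerD2l; lra.
rewrite (integral_cellv iid (C := cell4 X Y)); last 2 first.
- by move=> s; exact: measurable_cell4.
- exact: cell4P.
rewrite lee_fin /psi' ExD -/p Ex_cst//.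
by have := Ex_psi N; lra.
Qed.

End bound.
End L1close.

(** * Relabelling and compactness *)

Section Relabel.
Context {R : realType}.
Implicit Types (c : gcoef R) (t : nat -> R) (pi : nat -> nat).

Definition permc pi c := GCoef (fun i j => gE c (pi i) (pi j))
  (fun i => gsig c (pi i)) (fun i => gvsig c (pi i)) (gth c) (gvth c).

Lemma nneseries_perm pi (a : nat -> \bar R) : bijective pi ->
  (forall n, 0 <= a n)%E -> (\sum_(i <oo) a (pi i) = \sum_(i <oo) a i)%E.
Proof.
move=> bpi a0; rewrite nneseries_esumT// [in RHS]nneseries_esumT//.
apply/esym; apply: reindex_esum.
by rewrite setTT_bijective.
Qed.

Lemma permc_grapheur pi c : bijective pi -> is_grapheur c -> is_grapheur (permc pi c).
Proof.
move=> bpi [E0 s0 v0 tw0 tot]; split => //=.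
have E0' i j : (0 <= (gE c i j)%:E)%E by rewrite lee_fin.
rewrite -[RHS]tot; congr (_ + _ + _ + _)%E; last first.
  apply: (nneseries_perm (a := fun i => (gsig c i + gvsig c i)%:E) bpi) => i.
  by rewrite lee_fin addr_ge0.
rewrite -[RHS](nneseries_perm bpi); last by move=> i; exact: nneseries_ge0.
apply: eq_eseriesr => i _.
exact: (nneseries_perm (a := fun j => (gE c (pi i) j)%:E)).
Qed.

Lemma gmeas_permc pi pi' c t A : cancel pi pi' -> cancel pi' pi -> nonneg_coef c ->
  gmeas (permc pi c) t A = gmeas c (fun i => t (pi' i)) A.
Proof.
move=> pK pK' [E0 s0 v0 tw0]; have bpi : bijective pi by exists pi'.
rewrite /gmeas /=; congr (_ + _ + _ + _)%E.
  rewrite -[RHS](nneseries_perm bpi); last first.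
    by move=> i; apply: nneseries_ge0 => j _ _; rewrite mule_ge0// lee_fin.
  apply: eq_eseriesr => i _; rewrite -[RHS](nneseries_perm bpi); last first.
    by move=> j; rewrite mule_ge0// lee_fin.
  by apply: eq_eseriesr => j _; rewrite !pK.
rewrite -[RHS](nneseries_perm bpi); last first.
  by move=> i; rewrite adde_ge0// mule_ge0// lee_fin.
by apply: eq_eseriesr => i _; rewrite !pK.
Qed.

Lemma iid_perm d (Om : measurableType d) (P : probability Om R) (T : nat -> Om -> R) pi pi' :
  cancel pi pi' -> cancel pi' pi -> iid_unif P T -> iid_unif P (fun i => T (pi' i)).
Proof.
move=> pK pK' [mT uT ind]; split => [i|i B mB|s B us mB]; [exact: mT|exact: uT|].
have -> : \big[setI/setT]_(i <- s) (T (pi' i) @^-1` B i) =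
  \big[setI/setT]_(j <- map pi' s) (T j @^-1` B (pi j)).
  by rewrite big_map; apply: eq_bigr => i _; rewrite pK'.
rewrite ind//; last by rewrite map_inj_uniq//; exact: can_inj pK'.
by rewrite big_map; apply: eq_bigr => i _; rewrite pK'.
Qed.

Lemma grapheur_real_perm d (Om : measurableType d) (P : probability Om R)
    (T : nat -> Om -> R) pi pi' c (M : Om -> PM R) :
  cancel pi pi' -> cancel pi' pi -> is_grapheur c -> iid_unif P T ->
  realizes (permc pi c) T M -> grapheur_real P c M.
Proof.
move=> pK pK' gc iid [mM hM]; exists (fun i => T (pi' i)); split.
  exact: iid_perm iid.
split=> // w A mA; rewrite hM// (gmeas_permc _ _ pK pK')//; exact: grapheur_nonneg.
Qed.

Lemma tot_nneseries (u : nat -> R) B : (forall i, 0 <= u i) ->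
  (forall M, \sum_(i < M) u i <= B) -> ((tot u)%:E = \sum_(i <oo) (u i)%:E)%E.
Proof.
move=> u0 uB; apply/esym/cvg_lim => //.
rewrite (_ : (fun n => _) = (EFin \o (fun n => \sum_(i < n) u i))); last first.
  by apply/funext => n /=; rewrite big_mkord sumEFin.
apply: cvg_comp; first exact: (tot_cvg u0 uB).
by [].
Qed.

Lemma rsum_permc pi c i : bijective pi -> is_grapheur c -> rsum (permc pi c) i = rsum c (pi i).
Proof.
move=> bpi gc; have gc' := permc_grapheur bpi gc.
rewrite /rsum /=; congr (_ + _); apply: EFin_inj.
have E0 k j : 0 <= gE c k j by case: gc.
rewrite (tot_nneseries (fun j => E0 (pi i) (pi j)) (row_bound gc' i)).
rewrite (tot_nneseries (fun j => E0 (pi i) j) (row_bound gc (pi i))).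
by apply: (nneseries_perm (a := fun j => (gE c (pi i) j)%:E)) => // j; rewrite lee_fin.
Qed.

Lemma csum_permc pi c i : bijective pi -> is_grapheur c -> csum (permc pi c) i = csum c (pi i).
Proof. by move=> bpi gc; exact: (rsum_permc i bpi (transp_grapheur gc)). Qed.

Definition deg c i : R := rsum c i + csum c i.

(** After sorting in decreasing order, the value of rank [i] is at most the average of the first
    [i.+1] values, hence at most [B / i.+1]. *)
Lemma sort_perm (f : nat -> R) N B : (forall i, 0 <= f i) -> \sum_(i < N) f i <= B ->
  exists pi pi' : nat -> nat, [/\ cancel pi pi', cancel pi' pi,
    (forall i, (i < N)%N -> f (pi i) <= B / i.+1%:R) & (forall i, (N <= i)%N -> pi i = i)].
Proof.
move=> f0 fB.
pose le i j := f j <= f i.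
pose s := sort le (iota 0 N).
have ps : perm_eq s (iota 0 N) by rewrite perm_sort.
have ss : size s = N by rewrite (perm_size ps) size_iota.
have us : uniq s by rewrite (perm_uniq ps) iota_uniq.
have ms i : (i \in s) = (i < N)%N by rewrite (perm_mem ps) mem_iota.
have so : sorted le s by apply: sort_sorted => i j; rewrite /le le_total.
pose pi i := if (i < N)%N then nth 0%N s i else i.
pose pi' i := if (i < N)%N then index i s else i.
have pN i : (i < N)%N -> (nth 0%N s i < N)%N by move=> iN; rewrite -ms mem_nth// ss.
exists pi, pi'; split.
- move=> i; rewrite /pi /pi'; have [iN|/negbTE iN] := boolP (i < N)%N; last by rewrite iN.
  by rewrite pN// index_uniq// ss.
- move=> i; rewrite /pi /pi'; have [iN|/negbTE iN] := boolP (i < N)%N; last by rewrite iN.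
  by rewrite -[X in (_ < X)%N]ss index_mem ms iN nth_index// ms.
- move=> i iN; rewrite /pi iN ler_pdivlMr ?ltr0n//.
  apply: le_trans fB.
  have -> : \sum_(k < N) f k = \sum_(k < N) f (nth 0%N s k).
    rewrite -(big_mkord xpredT f) -(big_mkord xpredT (fun k => f (nth 0%N s k))).
    have -> : \sum_(0 <= k < N) f k = \sum_(k <- iota 0 N) f k by rewrite /index_iota subn0.
    by rewrite -(perm_big _ ps) /= (big_nth 0%N) ss.
  rewrite mulr_natr -[i.+1]card_ord -sumr_const.
  rewrite (sum_widen (fun k => f (nth 0%N s k)) (leqnn N)).
  have wid : \sum_(k < i.+1) f (nth 0%N s i) = \sum_(k < N) (k < i.+1)%:R * f (nth 0%N s i).
    exact: (sum_widen (fun=> f (nth 0%N s i)) iN).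
  rewrite [leLHS]wid; apply: ler_sum => k _.
  rewrite ltn_ord mul1r; case: ltnP => ki; last by rewrite mul0r.
  rewrite mul1r.
  have tr : transitive le by move=> x y z h1 h2; exact: le_trans h2 h1.
  by apply: (sorted_leq_nth tr _ 0%N so) => //; rewrite ?inE ?ss//; rewrite /le => ?.
- by move=> i iN; rewrite /pi ltnNge iN.
Qed.

(** A decreasing enumeration of infinitely many degrees need not be a bijection, for instance when
    some of them vanish. So only the first [N] vertices are sorted; the degrees of the others are
    bounded by [row_tail], which produces the second term. *)
Lemma sorted_grapheur c N : is_grapheur c ->
  exists pi pi' : nat -> nat, [/\ cancel pi pi', cancel pi' pi &
    forall i, deg (permc pi c) i <= 2 / i.+1%:R + 2 * (1 - mass c N)].
Proof.
move=> gc.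
have d0 i : 0 <= deg c i.
  by rewrite addr_ge0//; [exact: rsum_ge0 | exact: (rsum_ge0 (transp_grapheur gc))].
have dB : \sum_(i < N) deg c i <= 2.
  rewrite big_split /=; have := rsums_le1 gc N.
  have : \sum_(i < N) csum c i <= 1 by exact: (rsums_le1 (transp_grapheur gc)).
  by lra.
have [pi [pi' [pK pK' pB pN]]] := sort_perm d0 dB.
have bpi : bijective pi by exists pi'.
have m1 := mass_le1 gc N.
exists pi, pi'; split => // i.
rewrite /deg rsum_permc// csum_permc//.
have [iN|iN] := ltnP i N.
  by apply: le_trans (pB i iN) _; rewrite lerDl; lra.
rewrite pN//; have := row_tail gc iN.
have : csum c i + mass (transp c) N <= 1 by exact: (row_tail (transp_grapheur gc) iN).
have : 0 <= 2 / i.+1%:R :> R by rewrite divr_ge0.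
rewrite mass_transp; set q := 2 / _; lra.
Qed.

End Relabel.

(** * Compactness of the set of grapheurs *)

Section Compactness.
Context {R : realType}.
Implicit Types (c : gcoef R).

Lemma ultra_bounded_cvg (U : set_system nat) (UU : UltraFilter U) (u : nat -> R) a b :
  (forall n, a <= u n <= b) -> exists2 l, u n @[n --> U] --> l & a <= l <= b.
Proof.
move=> ub.
have UuU : UltraFilter (u n @[n --> U]).
  split; first exact: fmap_proper_filter.
  move=> G PG sG; apply/seteqP; split => A; last by move/sG.
  move=> GA; have [//|h] := in_ultra_setVsetC (u @^-1` A) UU.
  have GC : G (~` A) by apply: sG.
  have /filter_ex[x []] : G (A `&` ~` A) by exact: filterI.
  by [].
have h : U (u @^-1` [set` `[a, b]]).
  by apply: filterE => n; rewrite /= in_itv /=; exact: ub.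
have := @segment_compact R a b; rewrite compact_ultra => /(_ _ UuU).
case; first exact: h.
by move=> l [] /=; rewrite in_itv /= => lab ul; exists l.
Qed.

(** The excess of [r], [s] and [d] over the sums of the limit entries becomes [gsig], [gvsig] and
    [gvth], and the mass still missing becomes [gth]. The last hypothesis, the limit form of
    [homog_le1], makes [gth] nonnegative. *)
Lemma limit_grapheur (E : nat -> nat -> R) (r s : nat -> R) (d : R) :
  (forall i j, 0 <= E i j) ->
  (forall i N, \sum_(j < N) E i j <= r i) -> (forall j N, \sum_(i < N) E i j <= s j) ->
  (forall N, \sum_(i < N) E i i <= d) ->
  (forall N, \sum_(i < N) r i + \sum_(j < N) s j - \sum_(i < N) \sum_(j < N) E i j
     + d - \sum_(i < N) E i i <= 1) ->
  exists c, [/\ is_grapheur c, gE c = E, rsum c =1 r, csum c =1 s & dsum c = d].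
Proof.
move=> E0 Er Es Ed h1.
have tle (u : nat -> R) B : (forall i, 0 <= u i) -> (forall M, \sum_(i < M) u i <= B) -> tot u <= B.
  by move=> u0 uB; have /cvgr_to_le := tot_cvg u0 uB; apply; near=> n.
pose sig i := r i - tot (E i).
pose vsig j := s j - tot (fun i => E i j).
pose vth := d - tot (fun i => E i i).
have sig0 i : 0 <= sig i by rewrite subr_ge0; exact: tle.
have vsig0 i : 0 <= vsig i by rewrite subr_ge0; exact: (tle (fun j => E j i)).
have vth0 : 0 <= vth by rewrite subr_ge0; exact: (tle (fun i => E i i)).
pose S N := \sum_(i < N) \sum_(j < N) E i j + \sum_(i < N) (sig i + vsig i).
have SB N : S N <= 1 - vth.
  have a1 : \sum_(i < N) \sum_(j < N) E i j <= \sum_(i < N) tot (E i).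
    by apply: ler_sum => i _; exact: (tot_ge N (E0 i) (Er i)).
  have a2 : \sum_(i < N) \sum_(j < N) E j i <= \sum_(i < N) tot (fun j => E j i).
    by apply: ler_sum => i _; exact: (tot_ge N (fun j => E0 j i) (Es i)).
  have a3 : \sum_(i < N) E i i <= tot (fun i => E i i) by exact: (tot_ge N (fun i => E0 i i) Ed).
  rewrite exchange_big /= in a2.
  have := h1 N; rewrite /S /sig /vsig /vth big_split /= !sumrB; lra.
have Snd : nondecreasing_seq S.
  apply/nondecreasing_seqP => n; rewrite /S !big_ord_recr /= lerD//; last first.
    by rewrite lerDl addr_ge0.
  rewrite -[leLHS]addr0 lerD//; last by rewrite addr_ge0// sumr_ge0.
  by apply: ler_sum => i _; rewrite big_ord_recr /= lerDl.
have Scv : cvgn S by apply: nondecreasing_is_cvgn => //; exists (1 - vth) => _ [N _ <-].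
pose th := 1 - limn S - vth.
have th0 : 0 <= th.
  have : limn S <= 1 - vth by apply: limr_le => //; near=> N; exact: SB.
  by rewrite /th; lra.
exists (GCoef E sig vsig th vth); split => //.
- apply/is_grapheurP; split => //.
  have -> : (1 : R) = limn S + th + vth by rewrite /th; ring.
  apply: cvgD; last exact: cvg_cst.
  apply: cvgD; last exact: cvg_cst.
  exact: Scv.
- by move=> i; rewrite /rsum /= /sig subrK.
- by move=> i; rewrite /csum /= /vsig subrK.
- by rewrite /dsum /= /vth subrK.
Unshelve. all: by end_near. Qed.

(** The degree bound makes all entries with an index beyond some [K] uniformly small, so that
    convergence of finitely many coordinates gives uniform closeness. The conclusion asks for
    arbitrarily late close indices; a subsequence with a prescribed rate is drawn from it in
    [compact_subseq]. *)
Lemma grapheur_compact_sorted (cs : nat -> gcoef R) (tau : nat -> R) :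
  (forall n, is_grapheur (cs n)) -> tau n @[n --> \oo] --> (0 : R) ->
  (forall n i, deg (cs n) i <= 2 / i.+1%:R + tau n) ->
  exists2 c, is_grapheur c & forall e m, 0 < e ->
    exists2 n, (m <= n)%N & gclose e (cs n) c.
Proof.
move=> gc tau0 degB.
(* Along an ultrafilter finer than [\oo] all bounded coordinates converge at once, which performs
   the diagonal extraction in a single step. *)
have [U [UU ooU]] := ultraFilterLemma (F := \oo : set_system nat) _.
have UP : ProperFilter U by exact: ultra_proper.
have r0 n i : 0 <= rsum (cs n) i by exact: rsum_ge0.
have s0 n i : 0 <= csum (cs n) i by exact: (rsum_ge0 (transp_grapheur (gc n))).
have rs1 c i : is_grapheur c -> rsum c i <= 1.
  move=> g; apply: le_trans (rsums_le1 g i.+1); rewrite big_ord_recr /= lerDr.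
  by apply: sumr_ge0 => k _; exact: rsum_ge0.
have E0 n i j : 0 <= gE (cs n) i j by case: (gc n).
have Er n i j : gE (cs n) i j <= rsum (cs n) i by exact: E_le_row.
have Es n i j : gE (cs n) i j <= csum (cs n) j by exact: (E_le_row (transp_grapheur (gc n)) j i).
have rb i : exists l : R, rsum (cs n) i @[n --> U] --> l /\ 0 <= l <= 1.
  have [|l ? ?] := @ultra_bounded_cvg U UU (fun n => rsum (cs n) i) 0 1; last by exists l.
  by move=> n; rewrite r0 rs1.
have sb i : exists l : R, csum (cs n) i @[n --> U] --> l /\ 0 <= l <= 1.
  have [|l ? ?] := @ultra_bounded_cvg U UU (fun n => csum (cs n) i) 0 1; last by exists l.
  by move=> n; rewrite s0 (rs1 (transp (cs n)))//; exact: transp_grapheur.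
have Eb ij : exists l : R, gE (cs n) ij.1 ij.2 @[n --> U] --> l /\ 0 <= l <= 1.
  have [|l ? ?] := @ultra_bounded_cvg U UU (fun n => gE (cs n) ij.1 ij.2) 0 1; last by exists l.
  by move=> n; rewrite E0 (le_trans (Er _ _ _))// rs1.
have [d dU /andP[d0 d1]] : exists2 l : R, dsum (cs n) @[n --> U] --> l & 0 <= l <= 1.
  by apply: ultra_bounded_cvg => n; rewrite dsum_ge0// dsum_le1.
have [r /all_and2[rU r01]] := choice rb.
have [s /all_and2[sU s01]] := choice sb.
have [E' /all_and2[EU' E01']] := choice Eb.
pose E i j := E' (i, j).
have EU i j : gE (cs n) i j @[n --> U] --> E i j by exact: (EU' (i, j)).
have tauU : tau n @[n --> U] --> (0 : R) by apply: cvg_trans tau0; apply: cvg_fmap2.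
have rowle c i N : is_grapheur c -> \sum_(j < N) gE c i j <= rsum c i.
  by move=> g; have := row_ge g i N; case: g => _ sg _ _ _; have := sg i; lra.
have [|||||c [gc' cE cr cc cd]] := @limit_grapheur E r s d.
- by move=> i j; case/andP: (E01' (i, j)).
- move=> i N; apply: (ler_cvg_to (cvg_sumr _ (fun j : 'I_N => EU i j)) (rU i)).
  by near=> n; exact: rowle.
- move=> i N; apply: (ler_cvg_to (cvg_sumr _ (fun j : 'I_N => EU j i)) (sU i)).
  by near=> n; exact: (rowle (transp (cs n)) i N (transp_grapheur (gc n))).
- move=> N; apply: (ler_cvg_to (cvg_sumr _ (fun j : 'I_N => EU j j)) dU).
  near=> n; have := diag_ge (gc n) N; case: (gc n) => _ _ _ [_ w] _; lra.
- move=> N.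
  have h : \sum_(i < N) rsum (cs n) i + \sum_(j < N) csum (cs n) j
   - \sum_(i < N) \sum_(j < N) gE (cs n) i j + dsum (cs n) - \sum_(i < N) gE (cs n) i i @[n --> U]
   --> \sum_(i < N) r i + \sum_(j < N) s j - \sum_(i < N) \sum_(j < N) E i j
     + d - \sum_(i < N) E i i.
    apply: cvgB; last by apply: (cvg_sumr _ (fun j : 'I_N => EU j j)).
    apply: cvgD => //; apply: cvgB; last first.
      by apply: cvg_sumr => i; exact: (cvg_sumr _ (fun j : 'I_N => EU i j)).
    by apply: cvgD; [exact: (cvg_sumr _ (fun j : 'I_N => rU j))|exact: (cvg_sumr _ (fun j : 'I_N => sU j))].
  have /cvgr_to_le := h; apply; near=> n; exact: homog_le1.
exists c => // e m e0.
(* Half of [e] is for the sorted bound at ranks from [K] on, the other half for [tau n]. *)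
have [K KB] : exists K, 2 / K.+1%:R <= e / 2.
  have [K hK] : exists K, 4 / e <= K%:R :> R.
    by exists (Num.bound (4 / e)); apply/ltW; apply: archi_boundP; rewrite divr_ge0// ltW.
  have h : 4 <= K%:R * e by rewrite -ler_pdivrMr.
  by exists K; rewrite ler_pdivrMr// -[K.+1%:R]natr1 mulrDr mulr1 mulrAC [e * _]mulrC; lra.
have KB' i : (K <= i)%N -> 2 / i.+1%:R <= e / 2.
  move=> Ki; apply: le_trans KB; rewrite ler_pM2l// lef_pV2 ?posrE//.
  by rewrite ler_nat ltnS.
have degU i : deg c i <= 2 / i.+1%:R.
  have h1 : deg (cs n) i @[n --> U] --> deg c i.
    have -> : deg c i = r i + s i by rewrite /deg cr cc.
    by apply: cvgD; [exact: rU|exact: sU].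
  have h2 : 2 / i.+1%:R + tau n @[n --> U] --> (2 / i.+1%:R : R).
    by rewrite -[X in _ --> X]addr0; apply: cvgD => //; exact: cvg_cst.
  by apply: (ler_cvg_to h1 h2); near=> n; exact: degB.
have e20 : 0 < e / 2 by rewrite divr_gt0.
have N1 : \forall n \near U, `|0 - tau n| <= e / 2 by exact: (cvgrPdist_le _ _).1.
have N2 : \forall n \near U, forall i : 'I_K, `|r i - rsum (cs n) i| <= e.
  by apply: filter_forall => i; exact: (cvgrPdist_le _ _).1.
have N3 : \forall n \near U, forall i : 'I_K, `|s i - csum (cs n) i| <= e.
  by apply: filter_forall => i; exact: (cvgrPdist_le _ _).1.
have N4 : \forall n \near U, forall i j : 'I_K, `|E i j - gE (cs n) i j| <= e.
  by apply: filter_forall => i; apply: filter_forall => j; exact: (cvgrPdist_le _ _).1.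
have N5 : \forall n \near U, `|d - dsum (cs n)| <= e by exact: (cvgrPdist_le _ _).1.
have N6 : \forall n \near U, (m <= n)%N by apply: ooU; exact: nbhs_infty_ge.
have [n [[[[[n1 n2] n3] n4] n5] n6]] := filter_ex (filterI (filterI (filterI (filterI (filterI N1 N2) N3) N4) N5) N6).
have rc0 i : 0 <= rsum c i by exact: rsum_ge0.
have sc0 i : 0 <= csum c i by exact: (rsum_ge0 (transp_grapheur gc')).
have degn i : (K <= i)%N -> deg (cs n) i <= e.
  move=> Ki; apply: le_trans (degB n i) _; have := KB' i Ki.
  move: n1; rewrite sub0r normrN ler_norml => /andP[_ n1] h.
  by apply: le_trans (lerD h n1) _; lra.
have degc i : (K <= i)%N -> deg c i <= e.
  by move=> Ki; apply: le_trans (degU i) _; apply: le_trans (KB' i Ki) _; lra.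
have diff (u v : R) : 0 <= u -> 0 <= v -> u <= e -> v <= e -> `|u - v| <= e.
  by move=> *; rewrite ler_norml; apply/andP; split; lra.
have rn i : (K <= i)%N -> rsum (cs n) i <= e.
  by move=> Ki; apply: le_trans (degn i Ki); rewrite lerDl.
have sn i : (K <= i)%N -> csum (cs n) i <= e.
  by move=> Ki; apply: le_trans (degn i Ki); rewrite lerDr.
have rcc i : (K <= i)%N -> rsum c i <= e.
  by move=> Ki; apply: le_trans (degc i Ki); rewrite lerDl.
have scc i : (K <= i)%N -> csum c i <= e.
  by move=> Ki; apply: le_trans (degc i Ki); rewrite lerDr.
have Ec0 i j : 0 <= gE c i j by case: gc'.
have Erc i j : gE c i j <= rsum c i by exact: E_le_row.
have Esc i j : gE c i j <= csum c j by exact: (E_le_row (transp_grapheur gc') j i).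
exists n => //; split.
- move=> i j; have [iK|Ki] := ltnP i K; last first.
    by apply: diff => //; [exact: le_trans (Er _ _ _) (rn _ Ki)|exact: le_trans (Erc _ _) (rcc _ Ki)].
  have [jK|Kj] := ltnP j K; last first.
    by apply: diff => //; [exact: le_trans (Es _ _ _) (sn _ Kj)|exact: le_trans (Esc _ _) (scc _ Kj)].
  by rewrite cE distrC; exact: (n4 (Ordinal iK) (Ordinal jK)).
- move=> i; have [iK|Ki] := ltnP i K; last by apply: diff => //; [exact: rn|exact: rcc].
  by rewrite cr distrC; exact: (n2 (Ordinal iK)).
- move=> i; have [iK|Ki] := ltnP i K; last by apply: diff => //; [exact: sn|exact: scc].
  by rewrite cc distrC; exact: (n3 (Ordinal iK)).
- by rewrite cd distrC.
Unshelve. all: by end_near. Qed.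

(** The number [N n] of sorted vertices is chosen so that the mass deficit is at most [n.+1%:R^-1];
    the error term of [sorted_grapheur] then vanishes in the limit. *)
Theorem grapheur_compact (cs : nat -> gcoef R) : (forall n, is_grapheur (cs n)) ->
  exists2 c, is_grapheur c & forall e m, 0 < e -> exists n pi pi',
    [/\ (m <= n)%N, cancel pi pi', cancel pi' pi & gclose e (permc pi (cs n)) c].
Proof.
move=> gc.
have hN n : exists N, 1 - mass (cs n) N <= n.+1%:R^-1.
  have /is_grapheurP[_ /cvgrPdist_le h] := gc n.
  have e0 : 0 < n.+1%:R^-1 :> R by rewrite invr_gt0.
  by have [N /= hN] := filter_ex (h _ e0); exists N; apply: le_trans (ler_norm _) hN.
have [N NB] := choice hN.
have hp n : exists pp : (nat -> nat) * (nat -> nat), [/\ cancel pp.1 pp.2, cancel pp.2 pp.1 &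
    forall i, deg (permc pp.1 (cs n)) i <= 2 / i.+1%:R + 2 * (1 - mass (cs n) (N n))].
  by have [pi [pi' h]] := sorted_grapheur (N n) (gc n); exists (pi, pi').
have [pp ppP] := choice hp.
have gp n : is_grapheur (permc (pp n).1 (cs n)).
  by have [h1 h2 _] := ppP n; apply: permc_grapheur => //; exists (pp n).2.
have [||c gc' cP] := @grapheur_compact_sorted (fun n => permc (pp n).1 (cs n))
   (fun n => 2 * n.+1%:R^-1) gp.
- rewrite -[X in _ --> X](mulr0 2); apply: cvgM; first exact: cvg_cst.
  exact: cvg_harmonic.
- move=> n i; have [_ _ h] := ppP n; apply: le_trans (h i) _.
  by rewrite lerD2l ler_pM2l.
exists c => // e m e0; have [n mn cn] := cP e m e0.
by have [h1 h2 _] := ppP n; exists n, (pp n).1, (pp n).2.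
Qed.

End Compactness.

(** * Cell values and weak convergence *)

Section CellGrid.
Context {R : realType}.
Implicit Types (c : gcoef R) (mu : PM R).

(* Cells are half-open, except the last one. *)
Definition cell (k i : nat) : interval R :=
  Interval (BLeft (i%:R / k.+1%:R)) (BSide (i != k) (i.+1%:R / k.+1%:R)).

Definition csq (k i j : nat) : set (R * R) := [set` cell k i] `*` [set` cell k j].

Lemma measurable_csq k i j : measurable (csq k i j).
Proof. by apply: measurableX; exact: measurable_itv. Qed.

(** The minimum sends the endpoint 1 to the last cell, which is closed on the right. *)
Definition cellid (k : nat) (t : R) : nat := minn k (truncn (t * k.+1%:R)).

Lemma cellP k i t : (i <= k)%N ->
  t \in cell k i = (0 <= t <= 1) && (i == cellid k t).
Proof.
move=> ik; have k0 : 0 < k.+1%:R :> R by rewrite ltr0n.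
have -> : (t \in cell k i) = (i%:R / k.+1%:R <= t) &&
    (if i != k then t < i.+1%:R / k.+1%:R else t <= i.+1%:R / k.+1%:R).
  by rewrite /cell; case: (i != k); rewrite in_itv.
have [t0|t0] := leP 0 t; last first.
  apply/negbTE; rewrite negb_and -ltNge; apply/orP; left.
  by apply: (lt_le_trans t0); rewrite divr_ge0.
have h0 : 0 <= t * k.+1%:R by rewrite mulr_ge0.
rewrite ler_pdivrMr// -truncn_ge_nat// /cellid.
have -> : t <= 1 = (t * k.+1%:R <= k.+1%:R) by rewrite -ler_pdivlMr// divff// gt_eqF.
have [ei|ni] := eqVneq i k.
  subst i; rewrite /= ler_pdivlMr//.
  by rewrite andbC; congr andb; apply/idP/eqP => [/minn_idPl->//|/esym/minn_idPl].
rewrite /= ltr_pdivlMr//.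
have ik' : (i < k)%N by rewrite ltn_neqAle ni.
rewrite -(truncn_lt_nat _ h0).
apply/andP/andP => [[h1 h2]|[h1 /eqP h2]].
  have tE : truncn (t * k.+1%:R) = i by apply/eqP; rewrite eqn_leq h1 andbT -ltnS.
  split; last by rewrite tE; apply/eqP/esym/minn_idPr.
  have /truncn_itv/andP[_ /ltW h3] := h0.
  by rewrite (le_trans h3)// tE ler_nat.
have : (minn k (truncn (t * k.+1%:R)) < k)%N by rewrite -h2.
rewrite gtn_min ltnn /= => h3.
by rewrite (minn_idPr (ltnW h3)) in h2; rewrite h2.
Qed.

Lemma cell_sub k i : (i <= k)%N -> [set` cell k i] `<=` `[0%R, 1%R].
Proof. by move=> ik t /=; rewrite cellP// in_itv => /andP[]. Qed.

Definition cv (k i j : nat) mu : R := fine (mu (csq k i j)).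
Definition cmx (k : nat) mu : 'M[R]_k.+1 := \matrix_(i, j) cv k i j mu.

(** Continuity is required only along sequences all of whose cell values converge. By
    [cells_weak_cvg] such sequences converge weakly, so this condition is weaker than weak
    continuity. *)
Definition grid_fun (G : PM R -> R) : Prop :=
  [/\ measurable_fun setT G, (exists K : R, forall mu, `|G mu| <= K) &
    (forall mus mu, (forall n, P01 (mus n)) -> P01 mu ->
      (forall k i j, cv k i j (mus n) @[n --> \oo] --> cv k i j mu) ->
      G (mus n) @[n --> \oo] --> G mu)].

Lemma P01_le1 mu A : measurable A -> (mu A <= 1)%E.
Proof.
move=> mA; have h : (mu setT <= 1)%E by exact: sprobability_setT.
by apply: le_trans h; exact: meas_le.
Qed.

Lemma mu_fin mu A : measurable A -> mu A \is a fin_num.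
Proof.
move=> mA; rewrite ge0_fin_numE//; apply: le_lt_trans (P01_le1 mu mA) _.
exact: ltry.
Qed.

Lemma measurable_cv k i j : measurable_fun setT (cv k i j).
Proof.
apply: measurableT_comp => //.
exact: (measurable_giry_ev (measurable_csq k i j)).
Qed.

Lemma gmeas_P01 c t : is_grapheur c -> (forall i, 0 <= t i <= 1) ->
  gmeas c t (~` @sq01 R) = 0%E.
Proof.
move=> gc t01.
have sec (u : R) : 0 <= u <= 1 -> [set y | (~` @sq01 R) (u, y)] `&` `[0%R, 1%R] = set0.
  move=> u01; apply/seteqP; split => y //= [+ y01]; apply; split => //=; by rewrite ?in_itv.
have sec' (u : R) : 0 <= u <= 1 -> [set y | (~` @sq01 R) (y, u)] `&` `[0%R, 1%R] = set0.
  move=> u01; apply/seteqP; split => y //= [+ y01]; apply; split => //=; by rewrite ?in_itv.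
have secd : [set x | (~` @sq01 R) (x, x)] `&` `[0%R, 1%R] = set0.
  by apply/seteqP; split => y //= [+ y01]; apply; split.
rewrite /gmeas /Defs.leb secd setICl !measure0 !mule0 !adde0.
rewrite eseries0 ?add0e; last first.
  move=> i _ _; rewrite eseries0// => j _ _.
  rewrite indicE memNset ?mule0// => h; apply: h; split => /=; rewrite ?in_itv; exact: t01.
by rewrite eseries0// => i _ _; rewrite sec// sec'// measure0 !mule0 adde0.
Qed.

Section ae.
Context d (Om : measurableType d) (P : probability Om R) (T : nat -> Om -> R).
Hypothesis iid : iid_unif P T.

Lemma ae_T01 : \forall w \ae P, forall i, 0 <= T i w <= 1.
Proof.
apply: ae_foralln => i; have [mT uT _] := iid.
exists (T i @^-1` (~` `[0%R, 1%R])); split.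
- rewrite -[X in measurable X]setTI; apply: mT => //.
  by apply: measurableC; exact: measurable_itv.
- have mC : measurable (~` `[0%R, 1%R] : set R) by apply: measurableC; exact: measurable_itv.
  by apply: (etrans (uT i _ mC)); rewrite setICl /Defs.leb measure0.
- by move=> w /= h; rewrite in_itv.
Qed.

Lemma ae_P01 c M : is_grapheur c -> realizes c T M -> \forall w \ae P, P01 (M w).
Proof.
move=> gc [mM hM]; have := ae_T01; apply: filterS => w t01; split.
  by rewrite hM// gmeas_setT.
rewrite hM; first exact: gmeas_P01.
by apply: measurableC; exact: measurable_sq01.
Qed.

Lemma nneseries_cvg0 (u : nat -> R) : (forall n, 0 <= u n) ->
  (\sum_(n <oo) (u n)%:E < +oo)%E -> u n @[n --> \oo] --> (0 : R).
Proof.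
move=> u0 uoo; apply: cvg_series_cvg_0.
apply: nondecreasing_is_cvgn.
  by apply/nondecreasing_seqP => n; rewrite /series /= big_nat_recr//= lerDl.
exists (fine (\sum_(n <oo) (u n)%:E)) => _ [n _ <-].
rewrite -lee_fin fineK.
  by rewrite /series /= -sumEFin; apply: nneseries_lim_ge => i _ _; rewrite lee_fin.
by rewrite ge0_fin_numE//; apply: nneseries_ge0 => i _ _; rewrite lee_fin.
Qed.

Variables (cs : nat -> gcoef R) (c : gcoef R) (Ms : nat -> Om -> PM R) (M : Om -> PM R).
Hypotheses (gcs : forall n, is_grapheur (cs n)) (gc : is_grapheur c).
Hypotheses (rMs : forall n, realizes (cs n) T (Ms n)) (rM : realizes c T M).
Hypothesis fast : forall n, gclose ((2^-1 ^+ n) ^+ 2) (cs n) c.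

(* Summability of the L1 distances gives almost sure convergence on all cells,
   without extracting a further subsequence. *)
Lemma ae_cells : \forall w \ae P, forall k i j, cv k i j (Ms n w) @[n --> \oo] --> cv k i j (M w).
Proof.
apply: ae_foralln => k; apply: ae_foralln => i; apply: ae_foralln => j.
have mcv (M' : Om -> PM R) : measurable_fun setT M' -> measurable_fun setT (fun w => cv k i j (M' w)).
  by move=> mM'; apply: measurableT_comp mM'; exact: measurable_cv.
pose f n w := `|cv k i j (Ms n w) - cv k i j (M w)|.
have mf n : measurable_fun setT (fun w => (f n w)%:E).
  apply/measurable_EFinP; apply: measurableT_comp => //; apply: measurable_funB; apply: mcv.
    by case: (rMs n).
  by case: rM.
have f0 n w : (0 <= (f n w)%:E)%E by rewrite lee_fin /f.
have fi n : (\int[P]_w (f n w)%:E <= (30 * 2^-1 ^+ n)%:E)%E.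
  have e0 : 0 < 2^-1 ^+ n :> R by rewrite exprn_gt0.
  have e1 : 2^-1 ^+ n <= 1 :> R by apply: exprn_ile1; lra.
  have mI (l : nat) : measurable [set` cell k l] by exact: measurable_itv.
  have := close_L1 (mI i) (mI j) iid (gcs n) gc e0 e1 (fast n).
  apply: le_trans; rewrite le_eqVlt; apply/orP; left; apply/eqP.
  apply: eq_integral => w _; rewrite /f /cv.
  have [_ hM] := rM; have [_ hMn] := rMs n.
  by rewrite hM ?hMn//; exact: measurable_csq.
(* Exchanging sum and integral leaves a geometric series, by the choice [eta = 2^-n] in [fast]. *)
have sfin : (\int[P]_w (\sum_(n <oo) (f n w)%:E) < +oo)%E.
  rewrite integral_nneseries//.
  apply: (@le_lt_trans _ _ (\sum_(n <oo) (30 * 2^-1 ^+ n)%:E)%E).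
    by apply: lee_nneseries => // n _ _; exact: integral_ge0.
  rewrite (_ : (\sum_(n <oo) _)%E = (30 * (1 - 2^-1)^-1)%:E) ?ltry//.
  apply/cvg_lim => //; rewrite (_ : (fun n => _) = EFin \o series (geometric 30 2^-1)); last first.
    by apply/funext => n /=; rewrite -sumEFin.
  apply: cvg_comp; first by apply: cvg_geometric_series; rewrite ger0_norm//; lra.
  by [].
have msf : measurable_fun setT (fun w => (\sum_(n <oo) (f n w)%:E)%E).
  by apply: ge0_emeasurable_sum.
have intf : P.-integrable setT (fun w => (\sum_(n <oo) (f n w)%:E)%E).
  apply/integrableP; split => //.
  by under eq_integral do rewrite gee0_abs ?nneseries_ge0//.
have := integrable_ae measurableT intf.
apply: filterS => w /(_ I) wfin; apply/subr_cvg0.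
have : f n w @[n --> \oo] --> (0 : R).
  apply: nneseries_cvg0 => [n|]; first by rewrite /f.
  by rewrite -ge0_fin_numE//; exact: nneseries_ge0.
by move=> h; apply/norm_cvg0P.
Qed.

Lemma fast_cvg G : grid_fun G ->
  (\int[P]_w (G (Ms n w))%:E @[n --> \oo] --> \int[P]_w (G (M w))%:E)%E.
Proof.
move=> [mG [K GK] Gc].
have mM : measurable_fun setT M by case: rM.
have mMs n : measurable_fun setT (Ms n) by case: (rMs n).
have [|||||_ _] := @dominated_convergence _ Om R P setT measurableT (fun n w => (G (Ms n w))%:E)
  (fun w => (G (M w))%:E) (cst K%:E); last by [].
- by move=> n; apply/measurable_EFinP; exact: measurableT_comp mG (mMs n).
- by apply/measurable_EFinP; exact: measurableT_comp mG mM.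
- have h1 := ae_cells; have h2 := ae_P01 gc rM.
  have h3 : \forall w \ae P, forall n, P01 (Ms n w).
    by apply: ae_foralln => n; exact: ae_P01 (gcs n) (rMs n).
  apply: filterS3 h1 h2 h3 => w k1 k2 k3 _.
  by apply: cvg_EFin; [near=> n|apply: Gc].
- exact: finite_measure_integrable_cst.
- by apply: aeW => w n _; rewrite lee_fin.
Unshelve. all: by end_near. Qed.

End ae.
End CellGrid.

(** * Step functions on grids and weak convergence *)

Section StepApprox.
Context {R : realType}.
Implicit Types (mu : PM R) (f : R * R -> R).

Definition gridval f (k i j : nat) : R := f (i%:R / k.+1%:R, j%:R / k.+1%:R).

Lemma cellid_le k (t : R) : (cellid k t <= k)%N.
Proof. exact: geq_minl. Qed.

Lemma cell_dist k i (t : R) : t \in cell k i -> `|t - i%:R / k.+1%:R| <= k.+1%:R^-1.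
Proof.
move=> h; have {h} : i%:R / k.+1%:R <= t <= i.+1%:R / k.+1%:R.
  by move: h; rewrite /cell; case: (i != k); rewrite in_itv /= => /andP[-> //= /ltW].
rewrite -[i.+1%:R]natr1 mulrDl mul1r => /andP[h1 h2].
by rewrite ger0_norm ?subr_ge0// lerBlDl.
Qed.

(** Uniform continuity on the compact square, obtained from the covering form of compactness with
    the mesh as the parameter. *)
Lemma uniform_step f e : continuous f -> 0 < e -> \forall k \near \oo,
  forall z, @sq01 R z -> forall i j, z.1 \in cell k i -> z.2 \in cell k j ->
    `|f z - gridval f k i j| <= e.
Proof.
move=> fc e0.
have cK : compact (@sq01 R) by apply: compact_setX; exact: segment_compact.
move/compact_near_coveringP : cK => /(_ nat \oo (fun (k : nat) (z : R * R) => forall i j, z.1 \in cell k i -> z.2 \in cell k j ->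
    `|f z - gridval f k i j| <= e) _); apply => -[x y] _.
have e2 : 0 < e / 2 by rewrite divr_gt0.
have /cvgrPdist_le/(_ _ e2) := fc (x, y).
rewrite near_simpl => -[[A B] /= [Ax By] AB].
have [d1 /= d10 dA] := Ax.
have [d2 /= d20 dB] := By.
pose d := Num.min d1 d2.
have d0 : 0 < d by rewrite lt_min d10.
have d20' : 0 < d / 2 by rewrite divr_gt0.
have hk : \forall k \near \oo, k.+1%:R^-1 < d / 2.
  near=> k; near: k; exact: (near_infty_natSinv_lt (PosNum d20')).
(* With radius and mesh both below [d / 2], the point and the corner of its cell lie within [d] of
   the center, where [f] varies by at most [e / 2]. *)
exists ([set z | `|x - z.1| < d / 2 /\ `|y - z.2| < d / 2], [set k | k.+1%:R^-1 < d / 2]).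
  split => //=; exists ([set u | `|x - u| < d / 2], [set u | `|y - u| < d / 2]) => //=.
  by split; exists (d / 2).
move=> [[u v] k] /= [[xu yv] kd] i j ui vj.
have kd' : d / 2 + k.+1%:R^-1 <= d by rewrite {2}(splitr d) lerD2l ltW.
have ud := cell_dist ui; have vd := cell_dist vj.
have AB' u' v' : `|x - u'| < d -> `|y - v'| < d -> `|f (x, y) - f (u', v')| <= e / 2.
  move=> h1 h2; apply: (AB (u', v')); split => /=.
    by apply: dA; apply: lt_le_trans h1 _; rewrite ge_min lexx.
  by apply: dB; apply: lt_le_trans h2 _; rewrite ge_min lexx orbT.
have h1 : `|f (x, y) - f (u, v)| <= e / 2.
  by apply: AB'; [apply: lt_trans xu _|apply: lt_trans yv _]; lra.
have tri (p q r : R) : `|p - r| <= `|p - q| + `|q - r|.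
  by have := ler_distD q p r.
have h2 : `|f (x, y) - gridval f k i j| <= e / 2.
  apply: AB'.
    by apply: le_lt_trans (tri _ u _) _; rewrite (lt_le_trans (ltr_leD xu ud))//; exact: kd'.
  by apply: le_lt_trans (tri _ v _) _; rewrite (lt_le_trans (ltr_leD yv vd))//; exact: kd'.
apply: le_trans (tri _ (f (x, y)) _) _.
by rewrite distrC in h1; apply: le_trans (lerD h1 h2) _; lra.
Unshelve. all: by end_near. Qed.

Lemma P01_ae mu : P01 mu -> \forall z \ae mu, @sq01 R z.
Proof.
move=> [_ mu0]; exists (~` @sq01 R); split => //.
by apply: measurableC; exact: measurable_sq01.
Qed.

Definition stepfun f k (z : R * R) : R :=
  \sum_(p : 'I_k.+1 * 'I_k.+1) gridval f k p.1 p.2 * \1_(csq k p.1 p.2) z.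

Lemma stepfunE f k z : @sq01 R z ->
  stepfun f k z = gridval f k (cellid k z.1) (cellid k z.2).
Proof.
move=> [z1 z2]; rewrite /= !in_itv /= in z1 z2.
have c1 : (cellid k z.1 < k.+1)%N by rewrite ltnS cellid_le.
have c2 : (cellid k z.2 < k.+1)%N by rewrite ltnS cellid_le.
rewrite /stepfun (bigD1 (Ordinal c1, Ordinal c2)) //= big1 ?addr0.
  rewrite indicE mem_set ?mulr1//; split => /=; rewrite cellP ?cellid_le//.
    by rewrite z1 eqxx.
  by rewrite z2 eqxx.
move=> [i j] /= ij; rewrite indicE memNset ?mulr0// => -[/=].
have ik : (i <= k)%N by rewrite -ltnS.
have jk : (j <= k)%N by rewrite -ltnS.
rewrite (cellP _ ik) (cellP _ jk) z1 z2 /= => /eqP h1 /eqP h2; move/negP: ij; apply.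
by apply/eqP; congr pair; apply: val_inj.
Qed.

Lemma measurable_stepfun f k : measurable_fun setT (stepfun f k).
Proof.
apply: measurable_sum => p; apply: measurable_funM => //.
by apply: measurable_indic; exact: measurable_csq.
Qed.

Lemma ae_bounded_integrable d (T : measurableType d) (m : {finite_measure set T -> \bar R})
    (g : T -> R) B : measurable_fun setT g -> (m setT <= 1)%E -> 0 <= B ->
  (\forall z \ae m, `|g z| <= B) ->
  m.-integrable setT (EFin \o g) /\ `|fine (\int[m]_z (g z)%:E)| <= B.
Proof.
move=> mg m1 B0 gB.
have mg' : measurable_fun setT (EFin \o g) by exact/measurable_EFinP.
have h : (\int[m]_z `|(g z)%:E| <= B%:E)%E.
  apply: (@le_trans _ _ (B%:E * m setT)%E).
    apply: integral_le_bound => //.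
    by apply: filterS gB => z + _; rewrite lee_fin.
  by rewrite -[leRHS]mule1 lee_wpmul2l.
have ig : m.-integrable setT (EFin \o g).
  apply/integrableP; split => //.
  by apply: le_lt_trans h _; exact: ltry.
split=> //; rewrite -lee_fin; apply: le_trans h.
have fi : (\int[m]_z (g z)%:E)%E \is a fin_num by exact: integrable_fin_num ig.
rewrite (_ : `|fine _|%:E = `|\int[m]_z (g z)%:E|%E); last first.
  by rewrite -fine_abse// fineK// abse_fin_num.
exact: le_abse_integral.
Qed.

Definition gridint f k mu : R := \sum_(p : 'I_k.+1 * 'I_k.+1) gridval f k p.1 p.2 * cv k p.1 p.2 mu.

Lemma integral_stepfun f k mu : (\int[mu]_z (stepfun f k z)%:E = (gridint f k mu)%:E)%E.
Proof.
exact: (integral_finite_sum mu (fun p : 'I_k.+1 * 'I_k.+1 => gridval f k p.1 p.2)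
  (fun p => measurable_csq k p.1 p.2)).
Qed.

(** The test functions of [weak_cvg] may be unbounded off the square, so integrability is obtained
    here too, from the bounded step function and the support of [mu]. *)
Lemma step_approx mu f k e : P01 mu -> measurable_fun setT f -> 0 <= e ->
  (forall z, @sq01 R z -> forall i j, z.1 \in cell k i -> z.2 \in cell k j ->
    `|f z - gridval f k i j| <= e) ->
  mu.-integrable setT (EFin \o f) /\ `|fine (\int[mu]_z (f z)%:E) - gridint f k mu| <= e.
Proof.
move=> muP mf e0 fe; have mu1 : (mu setT <= 1)%E by case: muP => ->.
have ms := measurable_stepfun f k.
have hae : \forall z \ae mu, `|f z - stepfun f k z| <= e.
  apply: filterS (P01_ae muP) => z sz; rewrite stepfunE//; apply: fe => //.
    by case: sz => /= z1 _; rewrite in_itv /= in z1; rewrite cellP ?cellid_le// z1 eqxx.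
  by case: sz => /= _ z2; rewrite in_itv /= in z2; rewrite cellP ?cellid_le// z2 eqxx.
have [i1 b1] := ae_bounded_integrable (measurable_funB mf ms) mu1 e0 hae.
pose B := \sum_(p : 'I_k.+1 * 'I_k.+1) `|gridval f k p.1 p.2|.
have B0 : 0 <= B by apply: sumr_ge0.
have sB : \forall z \ae mu, `|stepfun f k z| <= B.
  apply: aeW => z; apply: le_trans (ler_norm_sum _ _ _) _; apply: ler_sum => p _.
  by rewrite normrM ler_piMr// indicE; case: (_ \in _); rewrite /= ?normr1 ?normr0.
have [i2 _] := ae_bounded_integrable ms mu1 B0 sB.
have fE : EFin \o f = (EFin \o (f \- stepfun f k)) \+ (EFin \o stepfun f k).
  by apply/funext => z /=; rewrite -EFinD subrK.
have i3 : mu.-integrable setT (EFin \o f) by rewrite fE; exact: integrableD.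
split=> //; apply: le_trans b1; rewrite le_eqVlt; apply/orP; left; apply/eqP.
congr (`|_|); rewrite (_ : gridint f k mu = fine (\int[mu]_z (stepfun f k z)%:E)); last first.
  by rewrite integral_stepfun.
rewrite -fineB; last 2 first.
- exact: integrable_fin_num i3.
- exact: integrable_fin_num i2.
by congr fine; rewrite -integralB_EFin.
Qed.

Lemma gridint_cvg f mus mu k : (forall k i j, cv k i j (mus n) @[n --> \oo] --> cv k i j mu) ->
  gridint f k (mus n) @[n --> \oo] --> gridint f k mu.
Proof.
by move=> h; apply: cvg_sumr => p; apply: cvgM; [exact: cvg_cst|exact: h].
Qed.

Lemma gridint_lim f mu : continuous f -> measurable_fun setT f -> P01 mu ->
  gridint f k mu @[k --> \oo] --> fine (\int[mu]_z (f z)%:E).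
Proof.
move=> fc mf muP; apply/cvgrPdist_le => e e0.
have := uniform_step fc e0; apply: filterS => k hk.
by have [_] := step_approx muP mf (ltW e0) hk.
Qed.

Lemma cells_weak_cvg mus mu : (forall n, P01 (mus n)) -> P01 mu ->
  (forall k i j, cv k i j (mus n) @[n --> \oo] --> cv k i j mu) -> weak_cvg mus mu.
Proof.
move=> musP muP h f fc mf.
have [k1 hk1] := filter_ex (uniform_step fc ltr01).
have i1 n := (step_approx (musP n) mf ler01 hk1).1.
have i2 := (step_approx muP mf ler01 hk1).1.
have f2 : (\int[mu]_x (f x)%:E)%E \is a fin_num by exact: integrable_fin_num i2.
rewrite -[X in _ --> X](fineK f2); apply/fine_cvgP; split.
  by near=> n; exact: integrable_fin_num (i1 n).
apply/cvgrPdist_le => e e0.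
have e3 : 0 < e / 3 by rewrite divr_gt0.
have [k hk] := filter_ex (uniform_step fc e3).
have [_ a2] := step_approx muP mf (ltW e3) hk.
have := gridint_cvg (f := f) (k := k) h => /cvgrPdist_le/(_ _ e3); apply: filterS => n hn.
have [_ a1] := step_approx (musP n) mf (ltW e3) hk.
move: a1 a2 hn => /=; set x := fine _; set y := fine _; set u := gridint _ _ _; set v := gridint _ _ _.
by rewrite !ler_norml => /andP[? ?] /andP[? ?] /andP[? ?]; apply/andP; split; lra.
Unshelve. all: by end_near. Qed.

Lemma max_lip (a x y : R) : `|Num.max a x - Num.max a y| <= `|x - y|.
Proof.
have h := ler_norm (x - y); have h' := ler_norm (y - x); rewrite distrC in h'.
rewrite ler_norml; case: (leP a x) => ax; case: (leP a y) => ay; apply/andP; split; lra.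
Qed.

Lemma clamp_lip (K x y : R) :
  `|Num.max (- K) (Num.min K x) - Num.max (- K) (Num.min K y)| <= `|x - y|.
Proof.
apply: le_trans (max_lip _ _ _) _.
have h := ler_norm (x - y); have h' := ler_norm (y - x); rewrite distrC in h'.
rewrite ler_norml; case: (leP K x) => ax; case: (leP K y) => ay; apply/andP; split; lra.
Qed.

Lemma cvg_lip (L : R) (G : R -> R) (u : nat -> R) (l : R) :
  (forall x y, `|G x - G y| <= L * `|x - y|) ->
  u n @[n --> \oo] --> l -> G (u n) @[n --> \oo] --> G l.
Proof.
move=> GL ul; apply/subr_cvg0/norm_cvg0P.
apply: (@squeeze_cvgr _ _ _ _ (cst 0) (fun n => L * `|u n - l|)).
- by near=> n; rewrite normr_ge0 GL.
- exact: cvg_cst.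
- rewrite -[X in _ --> X](mulr0 L); apply: cvgM; first exact: cvg_cst.
  by apply/norm_cvg0P/subr_cvg0.
Unshelve. all: by end_near. Qed.

(** A test function is bounded on [P01] only, whereas [grid_fun] asks for a global bound; clamping
    between [- K'] and [K'] changes nothing on [P01] and, being Lipschitz, preserves limits. *)
Lemma test_fun_grid (Phi : PM R -> R) : test_fun Phi ->
  exists2 G, grid_fun G & forall mu, P01 mu -> G mu = Phi mu.
Proof.
move=> [mPhi [K PhiK] Pc].
pose K' := `|K|.
exists (fun mu => Num.max (- K') (Num.min K' (Phi mu))).
  split.
  - have h1 : measurable_fun setT (cst K' \min Phi) by apply: measurable_minr => //; exact: measurable_cst.
    have h2 : measurable_fun setT (cst (- K') \max (cst K' \min Phi)).
      by apply: measurable_maxr => //; exact: measurable_cst.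
    exact: h2.
  - exists K'; move=> mu; have K0 : 0 <= K' by exact: normr_ge0.
    rewrite ler_norml le_max lexx /= ge_max ge_min lexx /= andbT.
    by lra.
  - move=> mus mu musP muP h.
    have := Pc mus mu musP muP (cells_weak_cvg musP muP h) => hp.
    have lip (x y : R) : `|Num.max (- K') (Num.min K' x) - Num.max (- K') (Num.min K' y)| <= 1 * `|x - y|.
      by rewrite mul1r; exact: clamp_lip.
    exact: (cvg_lip lip hp).
move=> mu muP; have := PhiK mu muP => h.
have : `|Phi mu| <= K' by apply: le_trans h (ler_norm _).
by rewrite ler_norml => /andP[h1 h2]; rewrite (min_idPr h2) (max_idPr h1).
Qed.

End StepApprox.

(** * Determination of laws *)

Section LawDetermination.
Context {R : realType}.
Implicit Types (mu : PM R).

Lemma bounded_cvg d (T : measurableType d) (m : {finite_measure set T -> \bar R})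
    (g_ : nat -> T -> R) (g : T -> R) K :
  (forall n, measurable_fun setT (g_ n)) -> measurable_fun setT g ->
  (forall n x, `|g_ n x| <= K) -> (\forall x \ae m, g_ n x @[n --> \oo] --> g x) ->
  (\int[m]_x (g_ n x)%:E @[n --> \oo] --> \int[m]_x (g x)%:E)%E.
Proof.
move=> mg_ mg gK gc.
have [|||||_ _] := @dominated_convergence _ T R m setT measurableT (fun n x => (g_ n x)%:E)
  (fun x => (g x)%:E) (cst K%:E); last by [].
- by move=> n; exact/measurable_EFinP.
- exact/measurable_EFinP.
- by apply: filterS gc => x gx _; apply: cvg_EFin => //; near=> n.
- exact: finite_measure_integrable_cst.
- by apply: aeW => x n _; rewrite lee_fin.
Unshelve. all: by end_near. Qed.

Definition goodf (f : R * R -> R) : Prop :=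
  [/\ continuous f, measurable_fun setT f & forall z, 0 <= f z <= 1].

Definition fint (f : R * R -> R) mu : R := fine (\int[mu]_z (f z)%:E).

Lemma goodf_fin f mu : goodf f -> (\int[mu]_z (f z)%:E)%E \is a fin_num.
Proof.
move=> [_ mf f01]; apply: integrable_fin_num => //.
apply: measurable_bounded_integrable => //.
  have h : (mu setT <= 1)%E by exact: sprobability_setT.
  by apply: le_lt_trans h _; exact: ltry.
exists 1; split => // x x1 z _ /=; case/andP: (f01 z) => f0 f1.
by rewrite ger0_norm// (le_trans f1)// ltW.
Qed.

Lemma measurable_fint f : goodf f -> measurable_fun setT (fint f).
Proof.
move=> [_ mf f01]; apply: measurableT_comp => //.
apply: measurable_giry_int; first exact/measurable_EFinP.
by move=> z; rewrite lee_fin; case/andP: (f01 z).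
Qed.

(** A weakly continuous approximation of the indicator of [cyl r f a]: it equals one on the cylinder
    and is eventually zero, as [m] grows, at each point outside. *)
Definition Psi (m r : nat) (f : nat -> R * R -> R) (a : nat -> R) mu : R :=
  Num.max 0 (1 - m%:R * \sum_(i < r) Num.max 0 (fint (f i) mu - a i)).

Lemma Psi_bound m r f a mu : 0 <= Psi m r f a mu <= 1.
Proof.
rewrite /Psi le_max lexx /= ge_max ler01 /= gerBl mulr_ge0// sumr_ge0// => i _.
by rewrite le_max lexx.
Qed.

Lemma Psi_norm m r f a mu : `|Psi m r f a mu| <= 1.
Proof. by have /andP[? ?] := Psi_bound m r f a mu; rewrite ger0_norm. Qed.

Lemma measurable_Psi m r f a : (forall i, goodf (f i)) -> measurable_fun setT (Psi m r f a).
Proof.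
move=> gf.
have h i : measurable_fun setT (cst 0 \max (fun mu => fint (f i) mu - a i)).
  apply: measurable_maxr => //; apply: measurable_funB => //.
  exact: measurable_fint.
have h2 : measurable_fun setT (cst 0 \max (fun mu => 1 - m%:R * \sum_(i < r) Num.max 0 (fint (f i) mu - a i))).
  apply: measurable_maxr => //; apply: measurable_funB => //; apply: measurable_funM => //.
  by apply: measurable_sum => i; exact: h.
exact: h2.
Qed.

Lemma cvg_max0 (u : nat -> R) l : u n @[n --> \oo] --> l ->
  Num.max 0 (u n) @[n --> \oo] --> Num.max 0 l.
Proof.
have lip (x y : R) : `|Num.max 0 x - Num.max 0 y| <= 1 * `|x - y|.
  by rewrite mul1r; exact: max_lip.
exact: (cvg_lip lip).
Qed.

Lemma test_fun_Psi m r f a : (forall i, goodf (f i)) -> test_fun (Psi m r f a).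
Proof.
move=> gf; split; first exact: measurable_Psi.
  by exists 1 => mu _; exact: Psi_norm.
move=> mus mu musP muP wc; apply: cvg_max0.
apply: cvgB; first exact: cvg_cst.
apply: cvgM; first exact: cvg_cst.
apply: cvg_sumr => i; apply: cvg_max0; apply: cvgB; last exact: cvg_cst.
have [cf mf _] := gf i.
have := wc (f i) cf mf; rewrite -[X in _ --> X -> _](fineK (goodf_fin mu (gf i))).
by move/fine_cvgP => [].
Qed.

Definition cyl (r : nat) (f : nat -> R * R -> R) (a : nat -> R) : set (PM R) :=
  [set mu | forall i, (i < r)%N -> fint (f i) mu <= a i].

Lemma Psi_cyl r f a mu : Psi m r f a mu @[m --> \oo] --> (\1_(cyl r f a) mu : R).
Proof.
pose s := \sum_(i < r) Num.max 0 (fint (f i) mu - a i).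
have t0 (i : 'I_r) : 0 <= Num.max 0 (fint (f i) mu - a i) by rewrite le_max lexx.
rewrite indicE; have [|] := boolP (mu \in cyl r f a).
  rewrite inE => h; have s0 : s = 0.
    by apply: big1 => i _; apply/max_idPl; rewrite subr_le0; exact: h.
  rewrite (_ : (fun m => _) = cst 1); first exact: cvg_cst.
  by apply/funext => m; rewrite /Psi -/s s0 mulr0 subr0 /= (max_idPr ler01).
rewrite notin_setE => h.
have s0 : 0 < s.
  rewrite lt_neqAle sumr_ge0 ?andbT//; apply/eqP => /esym s0; apply: h => i ir.
  have /eqP := s0; rewrite /s psumr_eq0// => /allP /(_ (Ordinal ir)).
  rewrite mem_index_enum => /(_ isT) /= /eqP /max_idPl; rewrite subr_le0; exact.
apply: cvg_near_cst; near=> m.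
rewrite /Psi -/s; apply/max_idPl; rewrite subr_le0 -ler_pdivrMr//.
by near: m; exact: nbhs_infty_ger.
Unshelve. all: by end_near. Qed.

Lemma measurable_cyl r f a : (forall i, goodf (f i)) -> measurable (cyl r f a).
Proof.
move=> gf; rewrite (_ : cyl r f a = \big[setI/setT]_(i < r) (fint (f i) @^-1` [set x | x <= a i])).
  apply: bigsetI_measurable => i _; rewrite -[X in measurable X]setTI.
  apply: measurable_fint => //.
  by rewrite (_ : [set x | _] = `]-oo, a i]%classic) //; apply/seteqP; split => x /=; rewrite in_itv.
rewrite -(big_mkord xpredT (fun i => fint (f i) @^-1` [set x | x <= a i])).
apply/seteqP; split => mu /=.
  by move=> h; apply/bigsetI_seqP => i; rewrite mem_index_iota => ir; exact: h.
by move=> /bigsetI_seqP h i ir; apply: h; rewrite mem_index_iota.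
Qed.

Definition cyls : set (set (PM R)) :=
  [set C | exists r f a, (forall i, goodf (f i)) /\ C = cyl r f a].

Lemma cyls_setI : setI_closed cyls.
Proof.
move=> _ _ [r1 [f1 [a1 [g1 ->]]]] [r2 [f2 [a2 [g2 ->]]]].
exists (r1 + r2)%N, (fun i => if (i < r1)%N then f1 i else f2 (i - r1)%N),
  (fun i => if (i < r1)%N then a1 i else a2 (i - r1)%N); split.
  by move=> i; case: ifP.
apply/seteqP; split => mu /=.
  move=> [h1 h2] i ir; case: ifP => ir1; first exact: h1.
  by apply: h2; lia.
move=> h; split => i ir.
  by have := h i; rewrite ir; apply; rewrite ltn_addr.
have := h (r1 + i)%N; rewrite ltn_add2l ir ltnNge leq_addr /= addKn.
by apply.
Qed.

(** * The cylinders generate the evaluation sigma-algebra *)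

Section generation.
Let GT := g_sigma_algebraType cyls.
Let mev (A : set (R * R)) := measurable_fun (setT : set GT) ((fun mu : PM R => mu A) : GT -> \bar R).

Let mfint f : goodf f -> measurable_fun (setT : set GT) (fint f : GT -> R).
Proof.
move=> gf; apply: (@measurability _ _ GT R setT (fint f) (@RGenOInfty.G R) (RGenOInfty.measurableE R)).
move=> _ [_ [x ->] <-].
have -> : setT `&` fint f @^-1` `]x, +oo[ = ~` cyl 1 (fun=> f) (fun=> x).
  apply/seteqP; split => mu /=.
    by rewrite in_itv /= andbT => -[_ xf] h; have := h 0%N isT; rewrite leNgt xf.
  move=> h; split => //; rewrite in_itv /= andbT ltNge; apply/negP => fx.
  by apply: h => i _.
apply: (@measurableC _ GT); apply: sub_sigma_algebra.
by exists 1%N, (fun=> f), (fun=> x).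
Qed.

(** Pointwise approximability of the indicator by continuous functions: for two such sets, the
    products of the approximations are functions in [goodf] whose integrals tend to the measure of
    the rectangle. *)
Definition raylike (A : set R) : Prop := exists alpha : nat -> R -> R,
  forall m, [/\ continuous (alpha m), measurable_fun setT (alpha m),
     (forall t, 0 <= alpha m t <= 1) & forall t, alpha n t @[n --> \oo] --> (\1_A t : R)].

Lemma raylike_setT : raylike setT.
Proof.
exists (fun _ _ => 1) => m; split => //.
- by move=> x; exact: cvg_cst.
- by move=> t; rewrite ler01 lexx.
- by move=> t; rewrite indicT; exact: cvg_cst.
Qed.

Definition ramp (x : R) (m : nat) (t : R) : R := Num.max 0 (Num.min 1 (m%:R * (t - x))).

Lemma raylike_ray x : raylike `]x, +oo[%classic.
Proof.
exists (ramp x) => m; split.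
- have lip (u v : R) : `|ramp x m u - ramp x m v| <= m%:R * `|u - v|.
    apply: le_trans (max_lip _ _ _) _.
    have -> : m%:R * `|u - v| = `|m%:R * (u - x) - m%:R * (v - x)|.
      by rewrite -mulrBr normrM ger0_norm//; congr (_ * `|_|); ring.
    set p := m%:R * (u - x); set q := m%:R * (v - x).
    have h := ler_norm (p - q); have h' := ler_norm (q - p); rewrite distrC in h'.
    by rewrite ler_norml; case: (leP 1 p) => ax; case: (leP 1 q) => ay; apply/andP; split; lra.
  move=> u; apply/cvgrPdist_le => e e0.
  have m1 : 0 < m%:R + 1 :> R by rewrite ltr_wpDl.
  near=> v; apply: le_trans (lip _ _) _.
  have h : `|u - v| <= e / (m%:R + 1).
    by near: v; apply: cvgr_dist_le => //; rewrite divr_gt0.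
  apply: (@le_trans _ _ (m%:R * (e / (m%:R + 1)))); first by rewrite ler_wpM2l.
  by rewrite mulrCA ler_piMr ?ltW// ltr_pdivrMr// mul1r ltrDl.
- have h1 : measurable_fun setT (cst 1 \min (fun t => m%:R * (t - x))).
    by apply: measurable_minr => //; apply: measurable_funM => //; apply: measurable_funB.
  by have h2 : measurable_fun setT (cst 0 \max (cst 1 \min (fun t => m%:R * (t - x)))) by apply: measurable_maxr.
- move=> t; rewrite /ramp le_max lexx /= ge_max ler01 /= ge_min lexx//.
- move=> t; rewrite indicE; have [|] := boolP (t \in `]x, +oo[%classic).
    rewrite inE /= in_itv /= andbT => xt; apply: cvg_near_cst; near=> n.
    have h : 1 <= n%:R * (t - x).
      by rewrite -ler_pdivrMr ?subr_gt0//; near: n; exact: nbhs_infty_ger.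
    by rewrite /ramp (min_idPl h) (max_idPr ler01).
  rewrite notin_setE /= in_itv /= andbT => /negP; rewrite -leNgt => tx.
  rewrite (_ : (fun n => _) = cst 0); first exact: cvg_cst.
  apply/funext => n; rewrite /ramp.
  have h : n%:R * (t - x) <= 0 by rewrite mulr_ge0_le0// subr_le0.
  by rewrite (min_idPr (le_trans h ler01)) (max_idPl h).
Unshelve. all: by end_near. Qed.

Let mev_rays A B : measurable A -> measurable B -> raylike A -> raylike B -> mev (A `*` B).
Proof.
move=> mA mB [al hal] [be hbe].
pose f m (z : R * R) := al m z.1 * be m z.2.
have gf m : goodf (f m).
  have [ca ma a01 _] := hal m; have [cb mb b01 _] := hbe m; split.
  - move=> z; apply: cvgM.
      by apply: (@cvg_comp _ _ _ fst (al m)); [exact: cvg_fst|exact: ca].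
    by apply: (@cvg_comp _ _ _ snd (be m)); [exact: cvg_snd|exact: cb].
  - by apply: measurable_funM; [exact: (measurableT_comp ma measurable_fst)|exact: (measurableT_comp mb measurable_snd)].
  - move=> z; have /andP[? ?] := a01 z.1; have /andP[? ?] := b01 z.2.
    by rewrite mulr_ge0//= mulr_ile1.
apply: (@emeasurable_fun_cvg _ GT R setT (fun m mu => (fint (f m) mu)%:E)).
  by move=> m; apply/measurable_EFinP; exact: mfint.
move=> mu _; have mAB : measurable (A `*` B) by exact: measurableX.
have := @bounded_cvg _ _ (mu : {finite_measure set _ -> \bar R}) f (fun z => \1_(A `*` B) z) 1.
rewrite integral_indic// setIT => h.
rewrite [X in X @ _](_ : _ = (fun m => \int[mu]_z (f m z)%:E)%E); last first.
  by apply/funext => m; rewrite /fint fineK//; exact: goodf_fin.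
apply: h.
- by move=> m; case: (gf m).
- exact: measurable_indic.
- by move=> m z; case: (gf m) => _ _ f01; have /andP[? ?] := f01 z; rewrite ger0_norm.
- apply: aeW => z; have -> : \1_(A `*` B) z = \1_A z.1 * \1_B z.2 :> R.
    by rewrite !indicE in_setX -natrM mulnb.
  by have [_ _ _ ha] := hal 0%N; have [_ _ _ hb] := hbe 0%N; apply: cvgM; [exact: ha|exact: hb].
Qed.

Let mevD A B : measurable A -> measurable B -> A `<=` B -> mev A -> mev B -> mev (B `\` A).
Proof.
move=> mA mB AB hA hB; apply: (@eq_measurable_fun _ _ GT (\bar R) setT (fun mu : PM R => mu B - mu A)%E).
  move=> mu _; apply/esym; rewrite measureD//.
    by rewrite (_ : B `&` A = A)//; exact/setIidPr.
  by rewrite -ge0_fin_numE//; exact: mu_fin.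
exact: emeasurable_funB.
Qed.

Let mevU (F : nat -> set (R * R)) : (forall n, measurable (F n)) -> trivIset setT F ->
  (forall n, mev (F n)) -> mev (\bigcup_n F n).
Proof.
move=> mF tF hF; apply: (@eq_measurable_fun _ _ GT (\bar R) setT (fun mu : PM R => \sum_(n <oo) mu (F n))%E).
  by move=> mu _; rewrite measure_semi_bigcup//; exact: bigcup_measurable.
apply: (@ge0_emeasurable_sum _ GT R setT (fun n (mu : PM R) => mu (F n)) xpredT) => [k mu _ _|k _].
  exact: measure_ge0.
exact: hF.
Qed.

Let ray_setI : setI_closed (@RGenOInfty.G R).
Proof.
move=> _ _ [x ->] [y ->]; exists (Num.max x y).
apply/seteqP; split => t /=; rewrite !in_itv /= !andbT gt_max.
  by move=> [-> ->].
by move=> /andP.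
Qed.

Let mray A : @RGenOInfty.G R A -> measurable A.
Proof. by move=> [x ->]; exact: measurable_itv. Qed.

Let ray_gen (A : set R) : measurable A -> <<s @RGenOInfty.G R >> A.
Proof.
rewrite (_ : <<s @RGenOInfty.G R >> = measurable)//.
exact: (esym (RGenOInfty.measurableE R)).
Qed.

(** Dynkin induction on the first side, from open rays. The whole line is not a ray, so it enters
    through [raylike_setT] in order to handle complements. [mev_rect] repeats this on the second
    side and [mev_all] on the product. *)
Let mev_ray A B : measurable A -> measurable B -> raylike B -> mev (A `*` B).
Proof.
move=> mA mB rB; move: A {mA} (ray_gen mA).
have := @dynkin_induction _ R (@RGenOInfty.G R) (fun A => mev (A `*` B))
  (RGenOInfty.measurableE R) ray_setI.
apply.
- by apply: mev_rays => //; exact: raylike_setT.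
- by move=> A hA; apply: mev_rays => //; [exact: mray|case: hA => x ->; exact: raylike_ray].
- move=> A mA hA; rewrite (_ : ~` A `*` B = (setT `*` B) `\` (A `*` B)).
    apply: mevD => //; [exact: measurableX|exact: measurableX|by move=> z []|].
    by apply: mev_rays => //; exact: raylike_setT.
  by apply/seteqP; split => z /= [h1 h2]; split => //; [case|case: h1 => _ ? ?; apply: h2|case: h1].
- move=> F mF tF hF; rewrite (_ : _ `*` B = \bigcup_n (F n `*` B)); last first.
    apply/seteqP; split => z /=; first by move=> [[n _ ?] ?]; exists n.
    by move=> [n _ [? ?]]; split => //; exists n.
  apply: mevU => //; first by move=> n; exact: measurableX.
  by move/trivIsetP: tF => tF; apply/trivIsetP => i j _ _ ij; rewrite -setXI tF// set0X.
Qed.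

Let mev_rect A B : measurable A -> measurable B -> mev (A `*` B).
Proof.
move=> mA mB; move: B {mB} (ray_gen mB).
have := @dynkin_induction _ R (@RGenOInfty.G R) (fun B => mev (A `*` B))
  (RGenOInfty.measurableE R) ray_setI.
apply.
- by apply: mev_ray => //; exact: raylike_setT.
- by move=> B hB; apply: mev_ray => //; [exact: mray|case: hB => x ->; exact: raylike_ray].
- move=> B mB hB; rewrite (_ : A `*` ~` B = (A `*` setT) `\` (A `*` B)).
    apply: mevD => //; [exact: measurableX|exact: measurableX|by move=> z []|].
    by apply: mev_ray => //; exact: raylike_setT.
  by apply/seteqP; split => z /= [h1 h2]; split => //; [case|case: h1|case: h1 => ? _ ?; apply: h2].
- move=> F mF tF hF; rewrite (_ : A `*` _ = \bigcup_n (A `*` F n)); last first.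
    apply/seteqP; split => z /=; first by move=> [? [n _ ?]]; exists n.
    by move=> [n _ [? ?]]; split => //; exists n.
  apply: mevU => //; first by move=> n; exact: measurableX.
  by move/trivIsetP: tF => tF; apply/trivIsetP => i j _ _ ij; rewrite -setXI tF// setX0.
Qed.

Lemma mev_all (A : set (R * R)) : measurable A -> mev A.
Proof.
move: A; rewrite measurable_prod_measurableType.
apply: dynkin_induction => /=.
- by rewrite measurable_prod_measurableType.
- move=> _ _ [A1 mA1 [A2 mA2 <-]] [B1 mB1 [B2 mB2 <-]].
  exists (A1 `&` B1); first exact: measurableI.
  by exists (A2 `&` B2); [exact: measurableI|rewrite setXI].
- by rewrite -setXTT; exact: mev_rect.
- by move=> _ [A mA [B mB <-]]; exact: mev_rect.
- move=> A mA hA; rewrite -setTD; apply: mevD => //.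
  by rewrite -setXTT; exact: mev_rect.
- exact: mevU.
Qed.

Lemma measurable_cyls (C : set (PM R)) : measurable C -> <<s cyls >> C.
Proof.
move: C; apply: smallest_sub; first exact: smallest_sigma_algebra.
move=> C [A mA [B mB <-]].
have := mev_all mA measurableT mB.
by [].
Qed.

End generation.

(** Letting [m] grow, the two laws agree on all cylinders, a family that is stable under
    intersection and generates the sigma-algebra. *)
Lemma Psi_same_law d1 (O1 : measurableType d1) (P1 : probability O1 R) (M1 : O1 -> PM R)
    d2 (O2 : measurableType d2) (P2 : probability O2 R) (M2 : O2 -> PM R) :
  measurable_fun setT M1 -> measurable_fun setT M2 ->
  (forall m r f a, (forall i, goodf (f i)) ->
    \int[P1]_w (Psi m r f a (M1 w))%:E = \int[P2]_w (Psi m r f a (M2 w))%:E)%E ->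
  same_law P1 M1 P2 M2.
Proof.
move=> mM1 mM2 h S mS.
have lim d (O : measurableType d) (P : probability O R) (M : O -> PM R) :
    measurable_fun setT M -> forall r f a, (forall i, goodf (f i)) ->
    (\int[P]_w (Psi m r f a (M w))%:E @[m --> \oo] --> P (M @^-1` cyl r f a))%E.
  move=> mM r f a gf; have mC : measurable (M @^-1` cyl r f a).
    by rewrite -[X in measurable X]setTI; apply: mM => //; exact: measurable_cyl.
  have -> : P (M @^-1` cyl r f a) = (\int[P]_w (\1_(M @^-1` cyl r f a) w)%:E)%E.
    by rewrite integral_indic// setIT.
  apply: (@bounded_cvg _ _ P _ _ 1).
  - by move=> m; apply: measurableT_comp mM; exact: measurable_Psi.
  - exact: measurable_indic.
  - by move=> m w; exact: Psi_norm.
  - by apply: aeW => w; exact: Psi_cyl.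
have agree C : cyls C -> P1 (M1 @^-1` C) = P2 (M2 @^-1` C).
  move=> [r [f [a [gf ->]]]].
  have l1 := lim _ _ P1 M1 mM1 r f a gf; have l2 := lim _ _ P2 M2 mM2 r f a gf.
  have e : (fun m => \int[P1]_w (Psi m r f a (M1 w))%:E)%E = (fun m => \int[P2]_w (Psi m r f a (M2 w))%:E)%E.
    by apply/funext => m; exact: h.
  rewrite e in l1; exact: (cvg_unique _ l1 l2).
pose m1 := giry_map mM1 (P1 : subprobability O1 R).
pose m2 := giry_map mM2 (P2 : subprobability O2 R).
have cT : cyls setT.
  exists 0%N, (fun=> cst 1), (fun=> 0); split.
    move=> _; split => //; first by move=> x; exact: cvg_cst.
    by move=> z; rewrite /= ler01 lexx.
  by apply/seteqP; split => // mu _ i.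
have := @g_sigma_algebra_measure_unique _ R (PM R) cyls _ (fun=> setT) (fun=> cT) _ m1 m2
   cyls_setI agree _ S (measurable_cyls mS).
apply.
- by move=> _ [r [f [a [gf ->]]]]; exact: measurable_cyl.
- by apply/seteqP; split => // mu _; exists 0%N.
- move=> _; have hh : (m1 setT <= 1)%E by exact: sprobability_setT.
  by apply: le_lt_trans hh _; exact: ltry.
Qed.

End LawDetermination.

(** * Functionals of the matrix of cell values *)

Section CellFunctionals.
Context {R : realType}.
Implicit Types (mu : PM R).

Lemma cvg_mx k (A_ : nat -> 'M[R]_k.+1) (A : 'M[R]_k.+1) :
  (forall i j, A_ n i j @[n --> \oo] --> A i j) -> A_ n @[n --> \oo] --> A.
Proof.
move=> h; apply/cvg_ballP => e e0.
have : \forall n \near \oo, forall i j, ball (A i j) e (A_ n i j).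
  by apply: filter_forall => i; apply: filter_forall => j; move: e e0; apply/cvg_ballP; exact: h.
by apply: filterS => n hn; split => // i j; exact: hn.
Qed.

(** The Lipschitz condition is for the entrywise l1 distance, whose expectation is a sum of terms
    that [Wsq] bounds one cell at a time. *)
Definition liph k (h : 'M[R]_k.+1 -> R) : Prop := (exists K, forall x, `|h x| <= K) /\
  exists2 L, 0 <= L & forall x y, `|h x - h y| <= L * \sum_i \sum_j `|x i j - y i j|.

Lemma liph_continuous k (h : 'M[R]_k.+1 -> R) : liph h -> continuous h.
Proof.
move=> [_ [L L0 hL]] x.
have FF : Filter (nbhs (x : 'M[R]_k.+1)) by exact: nbhs_filter.
apply/(@cvgrPdist_le _ _ _ _ FF) => e e0.
pose D := L * (k.+1%:R * k.+1%:R) + 1.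
have D0 : 0 < D by rewrite ltr_wpDl// mulr_ge0// mulr_ge0.
near=> y; apply: le_trans (hL _ _) _.
have xy : forall i j, `|x i j - y i j| <= e / D.
  have : ball x (e / D) y by near: y; apply: nbhsx_ballx; rewrite divr_gt0.
  by move=> [_ h1] i j; apply/ltW; exact: h1.
apply: (@le_trans _ _ (L * (k.+1%:R * k.+1%:R * (e / D)))).
  rewrite ler_wpM2l//; apply: (@le_trans _ _ (\sum_(i < k.+1) \sum_(j < k.+1) (e / D))).
    by apply: ler_sum => i _; apply: ler_sum => j _.
  by rewrite !sumr_const card_ord -!mulrnA -[leLHS]mulr_natl natrM.
have -> : L * (k.+1%:R * k.+1%:R * (e / D)) = e * ((L * (k.+1%:R * k.+1%:R)) / D) by ring.
by rewrite ler_piMr ?ltW// ltr_pdivrMr// mul1r ltrDl.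
Unshelve. all: by end_near. Qed.

Section measurable_cells.
Variables (k : nat) (h : 'M[R]_k.+1 -> R).

Let rmx n mu : 'M[R]_k.+1 := \matrix_(i, j) ((truncn (cv k i j mu * n.+1%:R))%:R / n.+1%:R).

Let fmx n (F : {ffun 'I_k.+1 * 'I_k.+1 -> 'I_n.+2}) : 'M[R]_k.+1 :=
  \matrix_(i, j) ((F (i, j))%:R / n.+1%:R).

Let cv01 i j mu : 0 <= cv k i j mu <= 1.
Proof.
rewrite /cv fine_ge0//= -lee_fin fineK; last exact: mu_fin (measurable_csq k i j).
exact: P01_le1 (measurable_csq k i j).
Qed.

Let dset n (F : {ffun 'I_k.+1 * 'I_k.+1 -> 'I_n.+2}) : set (PM R) :=
  \big[setI/setT]_(p <- enum {: 'I_k.+1 * 'I_k.+1})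
    (cv k p.1 p.2 @^-1` `[(F p)%:R / n.+1%:R, (F p).+1%:R / n.+1%:R[%classic).

Let rtr n mu : {ffun 'I_k.+1 * 'I_k.+1 -> 'I_n.+2} :=
  [ffun p : 'I_k.+1 * 'I_k.+1 => inord (truncn (cv k p.1 p.2 mu * n.+1%:R))].

Let tr_lt n i j mu : (truncn (cv k i j mu * n.+1%:R) < n.+2)%N.
Proof.
have /andP[c0 c1] := cv01 i j mu.
rewrite ltnS -(ler_nat R); apply: (@le_trans _ _ (cv k i j mu * n.+1%:R)).
  have h0 : 0 <= cv k i j mu * n.+1%:R by rewrite mulr_ge0.
  by have /truncn_itv/andP[] := h0.
by rewrite ler_piMl.
Qed.

Let dsetP n F mu : dset F mu <-> rtr n mu = F.
Proof.
rewrite /dset bigsetI_seqP; split => [H|<- p _ /=].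
  apply/ffunP => p; rewrite ffunE; apply: val_inj; rewrite /= inordK ?tr_lt//.
  have := H p; rewrite mem_enum => /(_ isT) /=; rewrite in_itv /= ler_pdivrMr// ltr_pdivlMr//.
  exact: truncn_def.
rewrite in_itv /= ffunE inordK ?tr_lt// ler_pdivrMr// ltr_pdivlMr//.
have /andP[c0 _] := cv01 p.1 p.2 mu.
by apply: truncn_itv; rewrite mulr_ge0.
Qed.

Let mdset n (F : {ffun 'I_k.+1 * 'I_k.+1 -> 'I_n.+2}) : measurable (dset F).
Proof.
apply: bigsetI_measurable => p _; rewrite -[X in measurable X]setTI.
by apply: (@measurable_cv R k p.1 p.2) => //; exact: measurable_itv.
Qed.

Let rmxE n mu : h (rmx n mu) = \sum_F h (@fmx n F) * \1_(dset F) mu.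
Proof.
rewrite (bigD1 (rtr n mu)) //= big1 ?addr0.
  rewrite indicE mem_set ?mulr1; last exact/dsetP.
  by congr h; apply/matrixP => i j; rewrite !mxE ffunE inordK ?tr_lt.
move=> F fn; rewrite indicE memNset ?mulr0// => /dsetP h'.
by rewrite h' eqxx in fn.
Qed.

(** Rounding the cell values down to multiples of [n.+1%:R^-1] gives functions with finitely many
    values that converge pointwise. The type ['I_n.+2] has room for the value one, whose rounding is
    [n.+1]. *)
Lemma measurable_cells : continuous h -> measurable_fun setT (fun mu => h (cmx k mu)).
Proof.
move=> hc; apply/measurable_EFinP.
apply: (@emeasurable_fun_cvg _ _ R setT (fun n mu => (h (rmx n mu))%:E)).
  move=> n; apply/measurable_EFinP; under eq_fun do rewrite rmxE.
  apply: measurable_sum => F; apply: measurable_funM; first exact: measurable_cst.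
  by have := @measurable_indic _ _ R setT (dset F) (mdset F).
move=> mu _; apply: cvg_EFin; first by near=> n.
apply: (@cvg_comp _ _ _ (fun n => rmx n mu) h); last exact: hc.
apply: cvg_mx => i j; rewrite /rmx.
under eq_cvg do rewrite mxE; rewrite mxE.
have /andP[c0 _] := cv01 i j mu.
apply/cvgrPdist_le => e e0; near=> n.
have h0 : 0 <= cv k i j mu * n.+1%:R by rewrite mulr_ge0.
have /andP[t1 t2] := truncn_itv h0.
have q1 : (truncn (cv k i j mu * n.+1%:R))%:R / n.+1%:R <= cv k i j mu by rewrite ler_pdivrMr.
rewrite ger0_norm ?subr_ge0// lerBlDl.
apply: (@le_trans _ _ ((truncn (cv k i j mu * n.+1%:R)).+1%:R / n.+1%:R)).
  by rewrite ler_pdivlMr// ltW.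
rewrite -[_.+1%:R]natr1 mulrDl mul1r lerD2l.
by near: n; apply: filterS (near_infty_natSinv_lt (PosNum e0)) => n /ltW.
Unshelve. all: by end_near. Qed.

Lemma grid_fun_cells : continuous h -> (exists K, forall x, `|h x| <= K) ->
  grid_fun (fun mu => h (cmx k mu)).
Proof.
move=> hc [K hK]; split; first exact: measurable_cells.
  by exists K => mu; exact: hK.
move=> mus mu _ _ H; apply: (@cvg_comp _ _ _ (fun n => cmx k (mus n)) h); last exact: hc.
by apply: cvg_mx => i j; under eq_cvg do rewrite mxE; rewrite mxE; exact: H.
Qed.

End measurable_cells.

(** Replacing the integrals inside [Psi] by sums over a grid gives Lipschitz functions of the cell
    values, which converge to [Psi] on [P01] as the grid is refined. *)
Lemma cell_same_law d1 (O1 : measurableType d1) (P1 : probability O1 R) (M1 : O1 -> PM R)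
    d2 (O2 : measurableType d2) (P2 : probability O2 R) (M2 : O2 -> PM R) :
  measurable_fun setT M1 -> measurable_fun setT M2 ->
  (\forall w \ae P1, P01 (M1 w)) -> (\forall w \ae P2, P01 (M2 w)) ->
  (forall k (h : 'M[R]_k.+1 -> R), liph h ->
    \int[P1]_w (h (cmx k (M1 w)))%:E = \int[P2]_w (h (cmx k (M2 w)))%:E)%E ->
  same_law P1 M1 P2 M2.
Proof.
move=> mM1 mM2 a1 a2 H; apply: Psi_same_law => // m r f a gf.
pose hk k (x : 'M[R]_k.+1) := Num.max 0 (1 - m%:R * \sum_(i < r)
   Num.max 0 (\sum_(p : 'I_k.+1 * 'I_k.+1) gridval (f i) k p.1 p.2 * x p.1 p.2 - a i)).
have h01 k (x : 'M[R]_k.+1) : `|hk k x| <= 1.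
  rewrite /hk ger0_norm ?le_max ?lexx// ge_max ler01 /= gerBl mulr_ge0// sumr_ge0// => i _.
  by rewrite le_max lexx.
have lh k : liph (hk k).
  split; first by exists 1; exact: h01.
  (* Each of the [r] grid sums moves by at most the l1 distance of the matrices, since the grid
     values of [f i] lie in the unit interval. *)
  exists (m%:R * r%:R); first by rewrite mulr_ge0.
  move=> x y; apply: le_trans (max_lip _ _ _) _.
  rewrite opprB addrC addrA subrK -mulrBr normrM ger0_norm// -mulrA ler_wpM2l//.
  rewrite -sumrB; apply: le_trans (ler_norm_sum _ _ _) _.
  apply: (@le_trans _ _ (\sum_(i < r) \sum_i \sum_j `|x i j - y i j|)); last first.
    by rewrite sumr_const card_ord mulr_natl.
  apply: ler_sum => i _; apply: le_trans (max_lip _ _ _) _.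
  rewrite opprB addrA subrK distrC -sumrB pair_bigA /=; apply: le_trans (ler_norm_sum _ _ _) _.
  apply: ler_sum => p _; rewrite -mulrBr normrM ler_piMl//.
  by have [_ _ /(_ (p.1%:R / k.+1%:R, p.2%:R / k.+1%:R)) /andP[? ?]] := gf i; rewrite /gridval ger0_norm.
have lim d (O : measurableType d) (P : probability O R) (M : O -> PM R) :
    measurable_fun setT M -> (\forall w \ae P, P01 (M w)) ->
    (\int[P]_w (hk k (cmx k (M w)))%:E @[k --> \oo] --> \int[P]_w (Psi m r f a (M w))%:E)%E.
  move=> mM aM; apply: (@bounded_cvg _ _ _ P _ _ 1).
  - move=> k; have hm := measurable_cells (liph_continuous (lh k)).
    exact: (measurableT_comp hm mM).
  - by apply: measurableT_comp mM; exact: measurable_Psi.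
  - by move=> k w; exact: h01.
  - apply: filterS aM => w Pw; apply: cvg_max0; apply: cvgB; first exact: cvg_cst.
    apply: cvgM; first exact: cvg_cst.
    apply: cvg_sumr => i; apply: cvg_max0; apply: cvgB; last exact: cvg_cst.
    have [cf mf _] := gf i.
    rewrite (_ : (fun k => _) = (fun k => gridint (f i) k (M w))); first exact: gridint_lim.
    by apply/funext => k; apply: eq_bigr => p _; rewrite mxE.
have l1 := lim _ _ P1 M1 mM1 a1; have l2 := lim _ _ P2 M2 mM2 a2.
have e : (fun k => \int[P1]_w (hk k (cmx k (M1 w)))%:E)%E = (fun k => \int[P2]_w (hk k (cmx k (M2 w)))%:E)%E.
  by apply/funext => k; exact: H.
rewrite e in l1; exact: (cvg_unique _ l1 l2).
Qed.

End CellFunctionals.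

(** * Graphs and their quotients *)

Section Graphs.
Context {R : realType}.

Lemma graph_gE m (G : 'M[R]_m) (i j : 'I_m) : gE (graph_coef G) i j = G i j.
Proof. by rewrite /= !valK. Qed.

Lemma graph_gE_out m (G : 'M[R]_m) i j : ~~ ((i < m) && (j < m))%N -> gE (graph_coef G) i j = 0.
Proof.
move=> h /=; case: insubP => [i' im _|//]; case: insubP => [j' jm _|//].
by rewrite im jm in h.
Qed.

Lemma sum_out (f : nat -> R) m N : (m <= N)%N -> (forall i, (m <= i)%N -> f i = 0) ->
  \sum_(i < N) f i = \sum_(i < m) f i.
Proof.
move=> mN f0; rewrite (sum_widen f mN); apply: eq_bigr => i _.
by case: ltnP => h; [rewrite mul1r|rewrite mul0r f0].
Qed.

Lemma mass_graph m (G : 'M[R]_m) N : inDelta G -> (m <= N)%N -> mass (graph_coef G) N = 1.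
Proof.
move=> [G0 G1] mN; rewrite /mass [in X in _ + X + _ + _]big1 => [|i _]; last by rewrite /= addr0.
rewrite !addr0 (sum_out (f := fun i => \sum_(j < N) gE (graph_coef G) i j) mN).
  rewrite -[RHS]G1; apply: eq_bigr => i _.
  rewrite (sum_out (f := gE (graph_coef G) i) mN).
    by apply: eq_bigr => j _; rewrite graph_gE.
  by move=> j mj; rewrite graph_gE_out// negb_and -!leqNgt mj orbT.
move=> i mi; rewrite big1// => j _; rewrite graph_gE_out// negb_and -!leqNgt mi//.
Qed.

Lemma graph_grapheur m (G : 'M[R]_m) : inDelta G -> is_grapheur (graph_coef G).
Proof.
move=> GD; apply/is_grapheurP; split.
  split => //= i j; case: GD => G0 _.
  by case: insub => // i'; case: insub.
apply: cvg_near_cst; near=> N; apply: mass_graph => //.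
by near: N; exact: nbhs_infty_ge.
Unshelve. all: by end_near. Qed.

Section quotient.
Variable k : nat.

(** Points outside the unit interval go to class 0, so that the classes partition the line as the
    reduction to [Ex] requires; this adds no mass, see [meas01_cellC]. *)
Definition cellord (t : R) : 'I_k.+1 := if 0 <= t <= 1 then inord (cellid k t) else ord0.

Definition cellC (i : 'I_k.+1) : set R :=
  [set` cell k i] `|` (if i == ord0 then ~` `[0%R, 1%R] else set0).

Lemma cellCP i t : cellC i t <-> cellord t = i.
Proof.
have ik : (i <= k)%N by rewrite -ltnS.
rewrite /cellC /cellord /=; have [t01|t01] := boolP (0 <= t <= 1).
  split.
    case; last by case: ifP => // _ /=; rewrite in_itv /= t01.
    by rewrite /= cellP// t01 /= => /eqP ie; apply: val_inj; rewrite /= inordK// ?ie// ltnS cellid_le.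
  by move=> <-; left; rewrite /= inordK ?ltnS ?cellid_le// cellP ?cellid_le// t01 eqxx.
split.
  case; first by rewrite /= cellP// (negbTE t01).
  by case: eqP => // ->.
by move=> <-; right; rewrite eqxx /= in_itv /=; exact/negP.
Qed.

Lemma measurable_cellC i : measurable (cellC i).
Proof.
apply: measurableU; first exact: measurable_itv.
by case: ifP => // _; apply: measurableC; exact: measurable_itv.
Qed.

Lemma meas01_cellC i : meas01 (cellC i) = k.+1%:R^-1.
Proof.
have ik : (i <= k)%N by rewrite -ltnS.
rewrite /meas01 (_ : cellC i `&` _ = [set` cell k i]); last first.
  apply/seteqP; split => t /=.
    by move=> [[//|]]; case: ifP => // _ /= ? ?.
  by move=> ti; split; [left|exact: (cell_sub ik)].
rewrite lebesgue_measure_itv /cell /= lte_fin.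
have -> : i%:R / k.+1%:R < i.+1%:R / k.+1%:R :> R by rewrite ltr_pM2r ?invr_gt0// ltr_nat.
by rewrite -EFinB /= -[i.+1%:R]natr1 mulrDl mul1r addrAC subrr add0r.
Qed.

Context d (Om : measurableType d) (P : probability Om R) (T : nat -> Om -> R).
Hypothesis iid : iid_unif P T.
Variables (m : nat) (G : 'M[R]_m) (M : Om -> PM R).
Hypotheses (GD : inDelta G) (rM : realizes (graph_coef G) T M).

Lemma cells_graph w : (forall i, 0 <= T i w <= 1) ->
  cmx k (M w) = rho (cellv T cellord m w) G.
Proof.
move=> t01; apply/matrixP => i j; rewrite !mxE /cv.
have [_ hM] := rM; rewrite hM; last exact: measurable_csq.
have gG := graph_grapheur GD.
have mI l : measurable [set` cell k l] by exact: measurable_itv.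
(* A graph has no mass beyond its [m] vertices, so the truncation bound becomes an equality. *)
have := gmeas_trunc (T ^~ w) m gG (measurable_csq k i j).
rewrite mass_graph// subrr normr_le0 subr_eq0 => /eqP ->.
rewrite gtrunc_rect// /= [in X in _ + X + _ + _]big1 ?mul0r ?addr0; last first.
  by move=> l _; rewrite !mul0r addr0.
have cE (v : 'I_m) (l : 'I_k.+1) : \1_[set` cell k l] (T v w) = (cellv T cellord m w v == l)%:R :> R.
  rewrite indicE ffunE; congr (nat_of_bool _)%:R; apply/idP/eqP.
    by rewrite inE => h; apply/cellCP; left.
  move=> /cellCP h; rewrite inE; case: h => //; case: ifP => // _ /=.
  by rewrite in_itv /= t01.
rewrite [RHS]big_mkcond; apply: eq_bigr => v _.
under eq_bigr do rewrite !valK cE cE.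
case: eqP => _ /=; last by rewrite big1// => u _; rewrite mul0r mulr0.
rewrite [RHS]big_mkcond; apply: eq_bigr => u _.
by case: eqP => _ /=; rewrite mul1r ?mulr1 ?mulr0.
Qed.

(** The [k.+1] cells have equal length, so the map sending each vertex to the cell of its point is
    uniform among all maps. *)
Lemma integral_cells_graph (h : 'M[R]_k.+1 -> R) : continuous h ->
  (\int[P]_w (h (cmx k (M w)))%:E = (Equot G h)%:E)%E.
Proof.
move=> hc; have mM : measurable_fun setT M by case: rM.
transitivity (\int[P]_w (h (rho (cellv T cellord m w) G))%:E)%E.
  apply: ae_eq_integral => //.
  - by apply/measurable_EFinP; exact: (measurableT_comp (measurable_cells hc) mM).
  - apply/measurable_EFinP.
    exact: (measurable_cellv iid measurable_cellC cellCP (fun f => h (rho f G))).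
  - by have := ae_T01 iid; apply: filterS => w t01 _; rewrite cells_graph.
rewrite (integral_cellv iid measurable_cellC cellCP (fun f => h (rho f G))).
congr EFin; rewrite /Equot /Ex mulr_suml; apply: eq_bigr => f _.
rewrite mulrC; congr (_ * _).
under eq_bigr do rewrite meas01_cellC.
by rewrite prodr_const card_ffun !card_ord natrX exprVn.
Qed.

End quotient.
End Graphs.

(** * Approximation of a grapheur by graphs *)

Section GraphApprox.
Context {R : realType}.
Implicit Types (c : gcoef R).

Lemma tot_fin (u : nat -> R) m : (forall i, (m <= i)%N -> u i = 0) -> tot u = \sum_(i < m) u i.
Proof.
move=> u0; apply: lim_near_cst => //; near=> N; apply: sum_out => //.
by near: N; exact: nbhs_infty_ge.
Unshelve. all: by end_near. Qed.

Definition heavy (n : nat) : nat := n./2.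
Definition nlight (n : nat) : R := (n.+1 - heavy n)%:R.
(** The mass lost by dropping the vertices from [heavy n] on is put into the uniform part, so that
    the total weight of [approx_graph] is exactly one ([light_tot]). *)
Definition thlight c n : R := gth c + (1 - mass c (heavy n)).

(* The first half of the vertices carries the atoms of [c]; the second half is
   exchangeable and carries its diffuse parts. *)
Definition gblock c (n i j : nat) : R :=
  if (i < heavy n)%N then
    if (j < heavy n)%N then gE c i j else gsig c i / nlight n
  else if (j < heavy n)%N then gvsig c j / nlight n
  else thlight c n / nlight n ^+ 2 + (i == j)%:R * (gvth c / nlight n).

Definition approx_graph c n : 'M[R]_n.+1 := \matrix_(i, j) gblock c n i j.

Lemma heavy_lt n : (heavy n < n.+1)%N.
Proof. by rewrite /heavy; lia. Qed.

Lemma nlight_gt0 n : 0 < nlight n.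
Proof. by rewrite ltr0n subn_gt0 heavy_lt. Qed.

Lemma sum_light n (f : nat -> R) : \sum_(i < n.+1) f i =
  \sum_(i < heavy n) f i + \sum_(heavy n <= i < n.+1) f i.
Proof.
rewrite -(big_mkord xpredT f) -(big_mkord xpredT (fun i : nat => f i)).
by rewrite (big_cat_nat (n := heavy n))//; exact: ltnW (heavy_lt n).
Qed.

Lemma sum_light_cst n (x : R) : \sum_(heavy n <= i < n.+1) x / nlight n = x.
Proof.
rewrite big_const_nat iter_addr_0 -mulr_natr -/(nlight n) divfK// gt_eqF//.
exact: nlight_gt0.
Qed.

Lemma gblock_row_heavy c n i : (i < heavy n)%N ->
  \sum_(j < n.+1) gblock c n i j = \sum_(j < heavy n) gE c i j + gsig c i.
Proof.
move=> ih; rewrite sum_light; congr (_ + _).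
  by apply: eq_bigr => j _; rewrite /gblock ih ltn_ord.
rewrite -[RHS](sum_light_cst n) !big_nat; apply: eq_bigr => j /andP[hj _].
by rewrite /gblock ih ltnNge hj.
Qed.

Lemma gblock_row_light c n i : (heavy n <= i)%N -> (i < n.+1)%N ->
  \sum_(j < n.+1) gblock c n i j =
  (\sum_(j < heavy n) gvsig c j + thlight c n + gvth c) / nlight n.
Proof.
move=> hi im; rewrite sum_light [in RHS]mulrDl [X in _ = X + _]mulrDl mulr_suml -addrA; congr (_ + _).
  by apply: eq_bigr => j _; rewrite /gblock ltnNge hi /= ltn_ord.
transitivity (\sum_(heavy n <= j < n.+1) (thlight c n / nlight n / nlight n +
     (i == j)%:R * (gvth c / nlight n))).
  rewrite !big_nat; apply: eq_bigr => j /andP[hj _].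
  by rewrite /gblock !ltnNge hi hj /= expr2 invfM -mulrA.
rewrite big_split /= sum_light_cst; congr (_ + _).
rewrite (big_cat_nat (n := i)) ?(ltnW im)//= big_nat big1 ?add0r; last first.
  by move=> j /andP[_ ji]; rewrite eq_sym (ltn_eqF ji) mul0r.
rewrite big_ltn// eqxx mul1r big_nat big1 ?addr0// => j /andP[ji _].
by rewrite (ltn_eqF ji) mul0r.
Qed.

Lemma gblock_transp c n i j : gblock (transp c) n i j = gblock c n j i.
Proof.
rewrite /gblock /thlight mass_transp /=.
by case: ifP => _; case: ifP => _ //=; rewrite eq_sym.
Qed.

Section approx.
Variable c : gcoef R.
Hypothesis gc : is_grapheur c.

Let E0 : forall i j, 0 <= gE c i j. Proof. by case: gc. Qed.
Let s0 : forall i, 0 <= gsig c i. Proof. by case: gc. Qed.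
Let v0 : forall i, 0 <= gvsig c i. Proof. by case: gc. Qed.
Let t0 : 0 <= gth c. Proof. by case: gc => _ _ _ []. Qed.
Let w0 : 0 <= gvth c. Proof. by case: gc => _ _ _ []. Qed.

Lemma thlight_ge0 n : 0 <= thlight c n.
Proof. by have := mass_le1 gc (heavy n); have := t0; rewrite /thlight; lra. Qed.

Lemma light_tot n : \sum_(i < heavy n) \sum_(j < heavy n) gE c i j + \sum_(i < heavy n) gsig c i
  + \sum_(j < heavy n) gvsig c j + thlight c n + gvth c = 1.
Proof. by rewrite /thlight /mass big_split /=; ring. Qed.

Lemma gblock_ge0 n i j : 0 <= gblock c n i j.
Proof.
rewrite /gblock; do 2 case: ifP => _ //; rewrite ?divr_ge0//.
by rewrite addr_ge0// ?divr_ge0 ?exprn_ge0 ?thlight_ge0// mulr_ge0// divr_ge0.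
Qed.

Lemma approx_graph_inDelta n : inDelta (approx_graph c n).
Proof.
split; first by move=> i j; rewrite mxE gblock_ge0.
transitivity (\sum_(i < n.+1) \sum_(j < n.+1) gblock c n i j).
  by apply: eq_bigr => i _; apply: eq_bigr => j _; rewrite mxE.
rewrite (sum_light n (fun i => \sum_(j < n.+1) gblock c n i j)).
rewrite (eq_bigr (fun i : 'I_(heavy n) => \sum_(j < heavy n) gE c i j + gsig c i)); last first.
  by move=> i _; rewrite gblock_row_heavy.
have -> : \sum_(heavy n <= i < n.+1) \sum_(j < n.+1) gblock c n i j =
   \sum_(j < heavy n) gvsig c j + thlight c n + gvth c.
  rewrite -[RHS](sum_light_cst n) !big_nat; apply: eq_bigr => i /andP[hi im].
  by rewrite gblock_row_light.
by rewrite big_split /= -[RHS](light_tot n); ring.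
Qed.

Lemma approx_gE n i j : (i < n.+1)%N -> (j < n.+1)%N ->
  gE (graph_coef (approx_graph c n)) i j = gblock c n i j.
Proof. by move=> im jm; rewrite (graph_gE _ (Ordinal im) (Ordinal jm)) mxE. Qed.

Lemma approx_rsum n i : (i < n.+1)%N ->
  rsum (graph_coef (approx_graph c n)) i = \sum_(j < n.+1) gblock c n i j.
Proof.
move=> im; rewrite /rsum add0r (tot_fin (m := n.+1)).
  by apply: eq_bigr => j _; rewrite approx_gE.
by move=> j mj; rewrite graph_gE_out// negb_and -!leqNgt mj orbT.
Qed.

Lemma approx_rsum_out n i : (n.+1 <= i)%N -> rsum (graph_coef (approx_graph c n)) i = 0.
Proof.
move=> mi; rewrite /rsum add0r (tot_fin (m := 0%N)) ?big_ord0// => j _.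
by rewrite graph_gE_out// negb_and -!leqNgt mi.
Qed.

(** The first term bounds everything carried by the vertices of [c] that are dropped, the second one
    the row of a single light vertex of the graph. *)
Let err n : R := (1 - mass c (heavy n)) + (nlight n)^-1.

Lemma approx_rsum_close n i : `|rsum (graph_coef (approx_graph c n)) i - rsum c i| <= err n.
Proof.
have inv0 : 0 <= (nlight n)^-1 by rewrite invr_ge0.
have m1 := mass_le1 gc (heavy n).
have r0 := rsum_ge0 gc i.
have [im|mi] := ltnP i n.+1; last first.
  rewrite approx_rsum_out// sub0r normrN ger0_norm//.
  have hi : (heavy n <= i)%N by apply: leq_trans mi; exact: ltnW (heavy_lt n).
  by have := row_tail gc hi; rewrite /err; lra.
rewrite approx_rsum//; have [ih|hi] := ltnP i (heavy n).
  rewrite gblock_row_heavy//.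
  have le : gsig c i + \sum_(j < heavy n) gE c i j <= rsum c i by exact: row_ge.
  pose u k := rsum c k - gsig c k - \sum_(j < heavy n) gE c k j.
  have u0 k : 0 <= u k by have := row_ge gc k (heavy n); rewrite /u; lra.
  have ui : u i <= \sum_(k < heavy n) u k.
    by rewrite (bigD1 (Ordinal ih)) //= lerDl sumr_ge0.
  have h : \sum_(k < heavy n) u k + mass c (heavy n) <= 1 by exact: rows_tail.
  rewrite distrC ger0_norm; last by lra.
  by move: ui; rewrite /err /u; lra.
rewrite gblock_row_light//.
set X := _ / _.
have X01 : 0 <= X <= (nlight n)^-1.
  rewrite /X divr_ge0//=; last by rewrite addr_ge0// addr_ge0 ?thlight_ge0// sumr_ge0.
  rewrite ler_piMl//; have := light_tot n.
  have : 0 <= \sum_(i < heavy n) \sum_(j < heavy n) gE c i j.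
    by apply: sumr_ge0 => *; apply: sumr_ge0.
  have : 0 <= \sum_(i < heavy n) gsig c i by apply: sumr_ge0.
  lra.
have := row_tail gc hi.
case/andP: X01 => ? ? ?; rewrite ler_norml /err; apply/andP; split; lra.
Qed.

Lemma approx_dsum_close n : `|dsum (graph_coef (approx_graph c n)) - dsum c| <= err n.
Proof.
have inv0 : 0 <= (nlight n)^-1 by rewrite invr_ge0.
have m1 := mass_le1 gc (heavy n).
have -> : dsum (graph_coef (approx_graph c n)) =
   \sum_(i < heavy n) gE c i i + thlight c n / nlight n + gvth c.
  rewrite /dsum add0r (tot_fin (m := n.+1)); last first.
    by move=> j mj; rewrite graph_gE_out// negb_and -!leqNgt mj.
  transitivity (\sum_(i < n.+1) gblock c n i i).
    by apply: eq_bigr => i _; rewrite approx_gE.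
  rewrite (sum_light n (fun i => gblock c n i i)) -addrA; congr (_ + _).
    by apply: eq_bigr => i _; rewrite /gblock ltn_ord.
  rewrite -[in RHS](sum_light_cst n (gvth c)) -(sum_light_cst n (thlight c n / nlight n)) -big_split.
  rewrite !big_nat; apply: eq_bigr => i /andP[hi _].
  by rewrite /gblock ltnNge hi /= eqxx mul1r expr2 invfM -mulrA.
have X01 : 0 <= thlight c n / nlight n <= (nlight n)^-1.
  rewrite divr_ge0 ?thlight_ge0//= ler_piMl//; have := light_tot n.
  have : 0 <= \sum_(i < heavy n) \sum_(j < heavy n) gE c i j.
    by apply: sumr_ge0 => *; apply: sumr_ge0.
  have : 0 <= \sum_(i < heavy n) gsig c i by apply: sumr_ge0.
  have : 0 <= \sum_(i < heavy n) gvsig c i by apply: sumr_ge0.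
  have := w0; lra.
have := diag_tail gc (heavy n); have := diag_ge gc (heavy n).
case/andP: X01 => ? ? ? ?; rewrite ler_norml /err; apply/andP; split; lra.
Qed.

Lemma approx_gE_close n i j :
  `|gE (graph_coef (approx_graph c n)) i j - gE c i j| <= err n.
Proof.
have inv0 : 0 <= (nlight n)^-1 by rewrite invr_ge0.
have m1 := mass_le1 gc (heavy n).
have hn := ltnW (heavy_lt n).
have lt := light_tot n.
have S0 : 0 <= \sum_(i < heavy n) \sum_(j < heavy n) gE c i j.
  by apply: sumr_ge0 => *; apply: sumr_ge0.
have S1 : 0 <= \sum_(i < heavy n) gsig c i by apply: sumr_ge0.
have S2 : 0 <= \sum_(i < heavy n) gvsig c i by apply: sumr_ge0.
have th0 := thlight_ge0 n; have vth0 := w0.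
have [/andP[ih jh]|hh] := boolP ((i < heavy n) && (j < heavy n))%N.
  rewrite approx_gE ?(leq_trans ih)// ?(leq_trans jh)//.
  by rewrite /gblock ih jh subrr normr0 /err addr_ge0// subr_ge0.
have Ec : 0 <= gE c i j <= 1 - mass c (heavy n).
  rewrite E0 /=; move: hh; rewrite negb_and -!leqNgt => /orP[hi|hj].
    by have := row_tail gc hi; have := E_le_row gc i j; lra.
  have : csum c j + mass (transp c) (heavy n) <= 1 by exact: (row_tail (transp_grapheur gc) hj).
  have : gE c i j <= csum c j by exact: (E_le_row (transp_grapheur gc) j i).
  by rewrite mass_transp; lra.
have Gb : 0 <= gE (graph_coef (approx_graph c n)) i j <= (nlight n)^-1; last first.
  case/andP: Ec => ? ?; case/andP: Gb => ? ?.
  by rewrite ler_norml /err; apply/andP; split; lra.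
have [/andP[im jm]|/graph_gE_out ->] := boolP ((i < n.+1) && (j < n.+1))%N; last by rewrite lexx.
rewrite approx_gE// gblock_ge0 /=.
have l1 : 1 <= nlight n by rewrite ler1n subn_gt0 heavy_lt.
have one (u : nat -> R) l : (forall a, 0 <= u a) -> (l < heavy n)%N -> u l <= \sum_(a < heavy n) u a.
  by move=> u0 lh; rewrite (bigD1 (Ordinal lh)) //= lerDl sumr_ge0.
rewrite /gblock; case: ifP => ih; case: ifP => jh.
- by rewrite ih jh in hh.
- by rewrite ler_piMl//; have := one (gsig c) i s0 ih; lra.
- by rewrite ler_piMl//; have := one (gvsig c) j v0 jh; lra.
- apply: (@le_trans _ _ (thlight c n / nlight n + gvth c / nlight n)).
    apply: lerD; last by case: (_ == _); rewrite ?mul1r ?mul0r ?divr_ge0.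
    by rewrite ler_wpM2l// lef_pV2 ?posrE ?exprn_gt0 ?nlight_gt0// expr2 ler_peMl.
  by rewrite -mulrDl ler_piMl//; lra.
Qed.

Lemma err_cvg : err n @[n --> \oo] --> (0 : R).
Proof.
have /is_grapheurP[_ m1] := gc.
rewrite -[X in _ --> X]addr0; apply: cvgD.
  rewrite -(subrr 1); apply: cvgB; first exact: cvg_cst.
  apply: (@cvg_comp _ _ _ heavy (mass c) _ _ _ _ m1).
  move=> A [N _ hN]; exists (N.*2) => // n /= Nn; apply: hN => /=; rewrite /heavy; lia.
apply/cvgrPdist_le => e e0; near=> n.
rewrite sub0r normrN ger0_norm ?invr_ge0// invf_ple ?posrE ?nlight_gt0//.
apply: (@le_trans _ _ (heavy n)%:R).
  near: n; have [N hN] : exists N, e^-1 <= N%:R :> R.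
    by exists (Num.bound e^-1); apply/ltW/archi_boundP; rewrite invr_ge0 ltW.
  exists (N.*2) => // n /= Nn; apply: le_trans hN _; rewrite ler_nat /heavy; lia.
by rewrite ler_nat /heavy; lia.
Unshelve. all: by end_near. Qed.

End approx.

(** Transfers the estimate on row sums to column sums in [approx_gclose]. *)
Lemma transp_graph n (c : gcoef R) : transp (graph_coef (approx_graph c n)) =
  graph_coef (approx_graph (transp c) n).
Proof.
rewrite /transp /graph_coef /=; congr GCoef.
apply/funext => i; apply/funext => j.
by case: insub => [i'|]; case: insub => [j'|] //; rewrite !mxE gblock_transp.
Qed.

Lemma approx_gclose c e : is_grapheur c -> 0 < e ->
  \forall n \near \oo, gclose e (graph_coef (approx_graph c n)) c.
Proof.
move=> gc e0; have /cvgrPdist_le/(_ _ e0) := err_cvg gc; apply: filterS => n.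
rewrite sub0r normrN => hn.
have {}hn : (1 - mass c (heavy n)) + (nlight n)^-1 <= e by apply: le_trans (ler_norm _) hn.
split.
- by move=> i j; apply: le_trans (approx_gE_close gc n i j) hn.
- by move=> i; apply: le_trans (approx_rsum_close gc n i) hn.
- move=> i; have := approx_rsum_close (transp_grapheur gc) n i.
  rewrite mass_transp -transp_graph => h; exact: le_trans h hn.
- exact: le_trans (approx_dsum_close gc n) hn.
Qed.

End GraphApprox.

(** * An iid uniform sequence *)

(* The binary digits of even and of odd rank of a uniform point give two
   independent uniform points; iterating on the second one yields the sequence. *)

Section BinaryShift.
Context {R : realType}.

Section unif.
Definition unif01 (A : set R) : \bar R := lebesgue_measure (A `&` `[0%R, 1%R]).
Let unif0 : unif01 set0 = 0%E. Proof. by rewrite /unif01 set0I measure0. Qed.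
Let unif_ge0 A : (0 <= unif01 A)%E. Proof. exact: measure_ge0. Qed.
Let m01 : measurable (`[0%R, 1%R]%classic : set R). Proof. exact: measurable_itv. Qed.
Let unif_sigma_additive : semi_sigma_additive unif01.
Proof.
move=> F mF tF mU.
exact: (@measure_semi_sigma_additive _ _ _ (mrestr (@lebesgue_measure R) m01) F mF tF mU).
Qed.
HB.instance Definition _ := isMeasure.Build _ _ _ unif01 unif0 unif_ge0 unif_sigma_additive.
Let unif_setT : unif01 setT = 1%E.
Proof. by rewrite /unif01 setTI leb01. Qed.
HB.instance Definition _ := Measure_isProbability.Build _ _ _ unif01 unif_setT.
End unif.

(** The distribution function of the uniform law, see [unif01_lt]. *)
Definition clamp (a : R) : R := Num.max 0 (Num.min 1 a).

Lemma clamp_le0 a : a <= 0 -> clamp a = 0.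
Proof. by move=> h; rewrite /clamp (min_idPr _) ?(le_trans h)// (max_idPl _). Qed.
Lemma clamp_id a : 0 <= a -> a <= 1 -> clamp a = a.
Proof. by move=> h h'; rewrite /clamp (min_idPr h') (max_idPr h). Qed.
Lemma clamp_ge1 a : 1 <= a -> clamp a = 1.
Proof. by move=> h; rewrite /clamp (min_idPl h) (max_idPr ler01). Qed.

Lemma clampP a : [\/ a <= 0 /\ clamp a = 0, [/\ 0 <= a, a <= 1 & clamp a = a] | 1 <= a /\ clamp a = 1].
Proof.
have [h|h] := leP a 0; first by constructor 1; rewrite clamp_le0.
have [h'|h'] := leP a 1; first by constructor 2; rewrite clamp_id ?(ltW h)//; split => //; exact: ltW.
by constructor 3; rewrite clamp_ge1// ltW.
Qed.

Lemma unif01_lt a : unif01 `]-oo, a[%classic = (clamp a)%:E.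
Proof.
rewrite /unif01; case: (clampP a) => [[a0 ->]|[a0 a1 ->]|[a1 ->]].
- rewrite (_ : _ `&` _ = set0) ?measure0//; apply/seteqP; split => x //=.
  by rewrite !in_itv /= => -[xa /andP[x0 _]]; have := lt_le_trans xa a0; rewrite ltNge x0.
- have -> : `]-oo, a[%classic `&` `[0, 1]%classic = `[0, a[%classic :> set R.
    apply/seteqP; split => x /=; rewrite !in_itv /=.
      by move=> [-> /andP[->]].
    by move=> /andP[-> xa]; split => //; rewrite (le_trans (ltW xa)).
  rewrite lebesgue_measure_itv /= lte_fin; case: ltP => h; first by rewrite oppr0 adde0.
  by congr EFin; apply/eqP; rewrite eq_le a0 h.
- have -> : `]-oo, a[%classic `&` `[0, 1]%classic = `[0, 1]%classic `\` (if a == 1 then [set 1] else set0) :> set R.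
    apply/seteqP; split => x /=; rewrite !in_itv /=.
      move=> [xa x01]; split => //; case: eqP => [ae|_ []] x1.
      by move: xa; rewrite ae x1 ltxx.
    move=> [/andP[x0 x1] h]; split; last by rewrite x0.
    rewrite lt_neqAle (le_trans x1 a1) andbT; apply/eqP => xa.
    have x1' : x = 1 by apply/eqP; rewrite eq_le x1 xa.
    by move: h; rewrite -xa x1' eqxx; apply.
  rewrite measureD//; last 2 first.
  - by case: ifP.
  - by rewrite [ltLHS](@leb01 R) ltry.
  have : lebesgue_measure (`[0%R, 1%R]%classic `&` (if a == 1 then [set 1] else set0)) = 0%E :> \bar R.
    case: ifP => _; last by rewrite setI0 measure0.
    rewrite setIidr ?lebesgue_measure_set1// => x ->.
    by rewrite /= in_itv /= ler01 lexx.
  move=> this; by rewrite [X in (X - _)%E](@leb01 R) [X in (_ - X)%E]this sube0.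
Qed.

(** Independence in product form: two finite measures of equal total mass that agree on open rays
    are equal. It serves for one binary digit against the rest and for the even against the odd
    digits. *)
Lemma cond_law d (Om : measurableType d) (P : probability Om R) (Q : probability R R)
    (E : set Om) (S : Om -> R) (c : R) :
  measurable E -> measurable_fun setT S -> 0 <= c -> P E = c%:E ->
  (forall a, P (E `&` S @^-1` `]-oo, a[) = c%:E * Q `]-oo, a[%classic)%E ->
  forall A, measurable A -> (P (E `&` S @^-1` A) = c%:E * Q A)%E.
Proof.
move=> mE mS c0 PE h.
have mES B : measurable B -> measurable (E `&` S @^-1` B).
  by move=> mB; apply: measurableI => //; rewrite -[X in measurable X]setTI; exact: mS.
have gen (A : set R) : measurable A -> <<s @RGenInftyO.G R >> A.
  rewrite (_ : <<s @RGenInftyO.G R >> = measurable)//.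
  exact: (esym (RGenInftyO.measurableE R)).
move=> A mA; move: A {mA} (gen A mA).
have := @dynkin_induction _ R (@RGenInftyO.G R) (fun A => P (E `&` S @^-1` A) = c%:E * Q A)%E
  (RGenInftyO.measurableE R).
apply.
- move=> _ _ [x ->] [y ->]; exists (Num.min x y).
  apply/seteqP; split => t /=; rewrite !in_itv /= lt_min.
    by move=> [-> ->].
  by move=> /andP.
- by rewrite preimage_setT setIT PE probability_setT mule1.
- by move=> _ [x ->]; exact: h.
- move=> B mB hB.
  have -> : E `&` S @^-1` (~` B) = E `\` (E `&` S @^-1` B).
    apply/seteqP; split => w /=; first by move=> [? ?]; split => // -[].
    by move=> [? hh]; split => // hB'; apply: hh.
  rewrite measureD//; last 2 first.
  - exact: mES.
  - by rewrite [ltLHS]PE ltry.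
  rewrite (_ : E `&` (E `&` _) = E `&` S @^-1` B); last by rewrite setIA setIid.
  by rewrite [X in (_ - X)%E]hB [X in (X - _)%E]PE probability_setC// muleBr// mule1.
- move=> F mF tF hF.
  rewrite preimage_bigcup setI_bigcupr measure_semi_bigcup//; last 3 first.
  - by move=> n; exact: mES.
  - move/trivIsetP: tF => tF; apply/trivIsetP => i j _ _ ij.
    by rewrite setIACA setIid -preimage_setI tF// preimage_set0 setI0.
  - by apply: bigcup_measurable => n _; exact: mES.
  rewrite measure_semi_bigcup//; last by apply: bigcup_measurable => k _; exact: mF.
  rewrite -nneseriesZl//.
  by apply: eq_eseriesr => n _; exact: hF.
Qed.

Definition bit (x : R) : bool := 2^-1 <= x.
Definition dshift (x : R) : R := 2 * x - (bit x)%:R.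

Lemma measurable_bit b : measurable [set x | bit x = b].
Proof.
have -> : [set x | bit x = b] = if b then `[2^-1, +oo[%classic else `]-oo, 2^-1[%classic.
  apply/seteqP; split => x; rewrite /bit /=; case: b => /=; rewrite in_itv /= ?andbT//.
    by move=> h; rewrite ltNge h.
  by move=> h; apply/negbTE; rewrite -ltNge.
by case: b.
Qed.

Lemma measurable_bitR : measurable_fun setT (fun x => (bit x)%:R : R).
Proof.
have -> : (fun x => (bit x)%:R : R) = \1_[set x | bit x = true].
  by apply/funext => x; rewrite indicE; congr (nat_of_bool _)%:R; apply/idP/idP; rewrite inE.
exact: measurable_indic (measurable_bit true).
Qed.

Lemma measurable_dshift : measurable_fun setT dshift.
Proof. by apply: measurable_funB; [exact: measurable_funM|exact: measurable_bitR]. Qed.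

(** The first binary digit is a fair coin, independent of the shifted point, which is again
    uniform. *)
Lemma dshift_law b A : measurable A ->
  (unif01 ([set x | bit x = b] `&` dshift @^-1` A) = (2^-1)%:E * unif01 A)%E.
Proof.
have cl_half : clamp 2^-1 = 2^-1 by rewrite clamp_id//; lra.
have b0 : [set x | bit x = false] = `]-oo, 2^-1[%classic.
  by apply/seteqP; split => x; rewrite /bit /= in_itv /= => h; [rewrite ltNge h|apply/negbTE; rewrite -ltNge].
have b1 : [set x | bit x = true] = ~` `]-oo, 2^-1[%classic.
  by apply/seteqP; split => x; rewrite /bit /= in_itv /= => h; [rewrite ltNge h|rewrite leNgt; apply/negP].
apply: (@cond_law _ _ unif01 unif01) => //.
- exact: measurable_bit.
- exact: measurable_dshift.
- case: b; last by rewrite b0 [LHS]unif01_lt cl_half.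
  rewrite b1 [LHS]probability_setC// [X in (_ - X)%E]unif01_lt cl_half -EFinB; congr EFin; lra.
- move=> a; rewrite [X in (_ * X)%E]unif01_lt; case: b.
    have [a0|a0] := leP a 0.
      rewrite clamp_le0// mule0 (_ : _ `&` _ = set0) ?measure0//.
      apply/seteqP; split => x //= [xb]; rewrite in_itv /= /dshift xb /= => h.
      by move: xb; rewrite /bit; lra.
    have -> : [set x | bit x = true] `&` dshift @^-1` `]-oo, a[ =
       `]-oo, (a + 1) / 2[%classic `\` `]-oo, 2^-1[%classic.
      apply/seteqP; split => x /=.
        by move=> [xb]; rewrite !in_itv /= /dshift xb /= => h; split; move: xb; rewrite /bit; lra.
      rewrite !in_itv /= => -[h1 /negP]; rewrite -leNgt => h2; rewrite /dshift.
      have -> : bit x = true by [].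
      by split => //=; lra.
    rewrite measureD//; last by rewrite [ltLHS]unif01_lt ltry.
    rewrite (_ : _ `&` _ = `]-oo, 2^-1[%classic); last first.
      by apply/seteqP; split => x /=; rewrite !in_itv /=; [by case|move=> h; split => //; lra].
    rewrite [X in (X - _)%E]unif01_lt [X in (_ - X)%E]unif01_lt cl_half -EFinB -EFinM; congr EFin.
    have [a1|a1] := leP a 1.
      by rewrite !clamp_id//; lra.
    by rewrite !clamp_ge1//; lra.
  have -> : [set x | bit x = false] `&` dshift @^-1` `]-oo, a[ = `]-oo, Num.min (2^-1) (a / 2)[%classic.
    apply/seteqP; split => x /=.
      move=> [xb]; rewrite !in_itv /= /dshift xb /= lt_min => h; move: xb; rewrite /bit => /negbT.
      by rewrite -ltNge => ->; lra.
    rewrite !in_itv /= lt_min => /andP[h1 h2]; rewrite /dshift.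
    have -> : bit x = false by apply/negbTE; rewrite -ltNge.
    by split => //=; lra.
  rewrite [LHS]unif01_lt -EFinM; congr EFin.
  case: (clampP a) => [[a0 ->]|[a0 a1 ->]|[a1 ->]].
  - by rewrite mulr0 clamp_le0// ge_min; apply/orP; right; lra.
  - rewrite (min_idPr _); last lra.
    by rewrite clamp_id; lra.
  - rewrite (min_idPl _); last lra.
    by rewrite cl_half mulr1.
Qed.

End BinaryShift.

(** * Splitting the digits of a uniform point *)

Section UniformSequence.
Context {R : realType}.
Local Notation clampR := (@clamp R).

Lemma bit_split (A : set R) : measurable A ->
  unif01 A = (unif01 ([set x | bit x = false] `&` A) + unif01 ([set x | bit x = true] `&` A))%E.
Proof.
move=> mA; rewrite -measureU.
- congr unif01; rewrite -setIUl [X in X `&` _](_ : _ = setT) ?setTI//.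
  by apply/seteqP; split => x //= _; case: bit; [right|left].
- by apply: measurableI => //; exact: measurable_bit.
- by apply: measurableI => //; exact: measurable_bit.
- apply/seteqP; split => x //= [[-> _] [//]].
Qed.

(* [digits n x] keeps the first [n] binary digits of [x] of even rank. *)
Fixpoint digits (n : nat) (x : R) : R :=
  if n is m.+1 then ((bit x)%:R + digits m (dshift (dshift x))) / 2 else 0.

(** Probability that [digits n] is below [s], computed by conditioning on the leading digit. *)
Fixpoint digits_cdf (n : nat) (s : R) : R :=
  if n is m.+1 then (digits_cdf m (2 * s) + digits_cdf m (2 * s - 1)) / 2 else (0 < s)%R%:R.

Lemma measurable_digits n : measurable_fun setT (digits n).
Proof.
elim: n => [|n ih] /=; first exact: measurable_cst.
apply: measurable_funM => //; apply: measurable_funD; first exact: measurable_bitR.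
by apply: measurableT_comp => //; apply: measurableT_comp; exact: measurable_dshift.
Qed.

Lemma measurable_digits_lt n s : measurable [set x | digits n x < s].
Proof.
rewrite (_ : [set _ | _] = digits n @^-1` `]-oo, s[); last first.
  by apply/seteqP; split => x /=; rewrite in_itv.
by rewrite -[X in measurable X]setTI; exact: measurable_digits.
Qed.

Lemma measurable_preshift (A : set R) : measurable A -> measurable (dshift @^-1` A).
Proof. by move=> mA; rewrite -[X in measurable X]setTI; exact: measurable_dshift. Qed.

(** Induction by conditioning on the first two digits: the first one leads [digits n.+1 x], the
    second one leads [digits n.+1 (dshift x)], and each of the four outcomes has probability 1/4. *)
Lemma digits_law n s t :
  unif01 ([set x | digits n x < s] `&` [set x | digits n (dshift x) < t])
  = (digits_cdf n s * digits_cdf n t)%:E.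
Proof.
have mJ m u v : measurable ([set x | digits m x < u] `&` dshift @^-1` [set x | digits m x < v]).
  by apply: measurableI; [|apply: measurable_preshift]; exact: measurable_digits_lt.
elim: n s t => [|n ih] s t.
  rewrite /=; case: ltP => s0; case: ltP => t0; rewrite ?mulr1 ?mulr0.
  - rewrite (_ : _ `&` _ = setT) ?probability_setT//.
    by apply/seteqP; split.
  - by rewrite (_ : _ `&` _ = set0) ?measure0//; apply/seteqP; split => x //= [].
  - by rewrite (_ : _ `&` _ = set0) ?measure0//; apply/seteqP; split => x //= [].
  - by rewrite (_ : _ `&` _ = set0) ?measure0//; apply/seteqP; split => x //= [].
pose C (b b' : bool) := [set x | bit x = b] `&` dshift @^-1` ([set x | bit x = b'] `&`
  dshift @^-1` ([set x | digits n x < 2 * s - b%:R] `&` [set x | digits n (dshift x) < 2 * t - b'%:R])).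
have lawC b b' : unif01 (C b b') = (4^-1 * (digits_cdf n (2 * s - b%:R) * digits_cdf n (2 * t - b'%:R)))%:E.
  rewrite /C dshift_law; last first.
    apply: measurableI; first exact: measurable_bit.
    by apply: measurable_preshift; exact: mJ.
  rewrite dshift_law; last exact: mJ.
  by rewrite ih -!EFinM; congr EFin; lra.
have eqC b b' : [set x | bit x = b] `&` dshift @^-1` ([set x | bit x = b'] `&`
     [set y | ((b%:R + digits n (dshift y)) / 2 < s) && ((b'%:R + digits n (dshift (dshift y))) / 2 < t)])
   = C b b'.
  have e (u v w : R) : ((u + v) / 2 < w) = (v < 2 * w - u).
    by apply/idP/idP => h; lra.
  apply/seteqP; split => x /= [xb [xb' ]].
    by rewrite !e => /andP[].
  by move=> [h1 h2]; split => //; split => //; rewrite !e h1.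
set L := _ `&` _.
have mL : measurable L by exact: mJ.
have eL b b' : [set x | bit x = b] `&` dshift @^-1` [set x | bit x = b'] `&` L = C b b'.
  rewrite -eqC /L /=; apply/seteqP; split => x /=.
    by move=> [[xb xb'] []]; rewrite xb xb' => -> ->.
  by move=> [xb [xb' /andP[]]]; rewrite xb xb'.
have mS b : measurable (dshift @^-1` [set x : R | bit x = b]).
  by apply: measurable_preshift; exact: measurable_bit.
have split2 b : unif01 ([set x | bit x = b] `&` L) = (unif01 (C b false) + unif01 (C b true))%E.
  rewrite -!eL -measureU.
  - congr unif01; rewrite -setIUl -setIUr [X in _ `&` X `&` _](_ : _ = setT) ?setIT//.
    by apply/seteqP; split => x //= _; case: bit; [right|left].
  - by apply: measurableI => //; apply: measurableI => //; exact: measurable_bit.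
  - by apply: measurableI => //; apply: measurableI => //; exact: measurable_bit.
  - by apply/seteqP; split => x //= [[[_ ->] _] [[_ //]]].
rewrite (bit_split mL) !split2 !lawC -!EFinD; congr EFin => /=.
by rewrite !mulr0n !subr0; field.
Qed.

Lemma digits_cdf01 n s : 0 <= digits_cdf n s <= 1.
Proof.
elim: n s => [|n ih] s /=; first by case: (0 < s); rewrite /= ?lexx ler01.
by have /andP[a b] := ih (2 * s); have /andP[c d] := ih (2 * s - 1); apply/andP; split; lra.
Qed.

Lemma clamp_double (s : R) : clamp s = (clamp (2 * s) + clamp (2 * s - 1)) / 2.
Proof.
have [h1|h1] := leP s 0; first by rewrite !clamp_le0; lra.
have [h2|h2] := leP s 2^-1.
  by rewrite (clamp_le0 (_ : 2 * s - 1 <= 0)) ?clamp_id; lra.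
have [h3|h3] := leP s 1; last by rewrite !clamp_ge1; lra.
by rewrite (clamp_ge1 (_ : 1 <= 2 * s)) ?clamp_id; lra.
Qed.

Lemma digits_cdf_out n s : s <= 0 \/ 1 <= s -> digits_cdf n s = clamp s.
Proof.
elim: n s => [|n ih] s /=.
  by case=> h; [rewrite clamp_le0//; case: ltP => //; lra|rewrite clamp_ge1//; case: ltP => //; lra].
move=> h; rewrite clamp_double !ih//.
- by case: h => h; [left|right]; lra.
- by case: h => h; [left|right]; lra.
Qed.

(* The error is halved at each step because one of [2 * s] and [2 * s - 1] lies
   outside the open unit interval, where [digits_cdf] is exact. *)
Lemma digits_cdf_clamp n s : `|digits_cdf n s - clamp s| <= 2^-1 ^+ n.
Proof.
elim: n s => [|n ih] s.
  rewrite expr0 /= ler_norml; case: (clampP s) => [[h ->]|[h h' ->]|[h ->]];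
    case: ltP => /= ?; apply/andP; split; lra.
rewrite clamp_double /= exprS; move: (2^-1 ^+ n : R) ih => q ih.
have [h|h] := leP s 2^-1.
  rewrite (@digits_cdf_out n (2 * s - 1)); last by left; lra.
  move: (clamp _) => c; have := ih (2 * s); clear ih; rewrite !ler_norml => /andP[h1 h2].
  by apply/andP; split; lra.
rewrite (@digits_cdf_out n (2 * s)); last by right; lra.
move: (clamp (2 * s)) => c; have := ih (2 * s - 1); clear ih; rewrite !ler_norml => /andP[h1 h2].
by apply/andP; split; lra.
Qed.

Lemma clamp_lip1 (s e : R) : 0 <= e -> clamp s - e <= clamp (s - e) <= clamp s.
Proof.
move=> e0; case: (clampP s) => [[h ->]|[h h' ->]|[h ->]];
  case: (clampP (s - e)) => [[k ->]|[k k' ->]|[k ->]]; apply/andP; split; lra.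
Qed.

Lemma digits_ge0 n x : 0 <= digits n x.
Proof. by elim: n x => [//|n ih] x /=; rewrite divr_ge0// addr_ge0. Qed.

Lemma digits_le n k x : digits n x <= digits (n + k) x <= digits n x + 2^-1 ^+ n.
Proof.
elim: n x => [|n ih] x.
  rewrite /= add0n digits_ge0 add0r expr0 /=.
  elim: k x => [|k ih] x /=; first exact: ler01.
  have := ih (dshift (dshift x)); clear ih; case: bit => /=; lra.
have /andP[h1 h2] := ih (dshift (dshift x)); clear ih; rewrite addSn /= exprS.
by apply/andP; split; lra.
Qed.

Definition evenpart (x : R) : R := limn (digits ^~ x).

Lemma digits_cvg x : digits n x @[n --> \oo] --> evenpart x.
Proof.
apply/cvg_ex; exists (sup (range (digits ^~ x))); apply: nondecreasing_cvgn.
  by apply/nondecreasing_seqP => n; have /andP[] := digits_le n 1 x; rewrite addn1.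
exists 1 => _ [n _ <-]; by have /andP[_] := digits_le 0 n x; rewrite /= add0r expr0.
Qed.

Lemma evenpart_digits n x : digits n x <= evenpart x <= digits n x + 2^-1 ^+ n.
Proof.
apply/andP; split.
  apply: limr_ge; first by apply/cvg_ex; exists (evenpart x); exact: digits_cvg.
  by near=> m; have /andP[] := digits_le n (m - n) x; rewrite subnKC//; near: m; exact: nbhs_infty_ge.
apply: limr_le; first by apply/cvg_ex; exists (evenpart x); exact: digits_cvg.
by near=> m; have /andP[_] := digits_le n (m - n) x; rewrite subnKC//; near: m; exact: nbhs_infty_ge.
Unshelve. all: by end_near. Qed.

Lemma measurable_evenpart : measurable_fun setT evenpart.
Proof.
apply: (measurable_fun_cvg (h := fun n => digits n)); first exact: measurable_digits.
by move=> x _; exact: digits_cvg.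
Qed.

Lemma evenpart_ltP s : measurable (evenpart @^-1` `]-oo, s[).
Proof. by rewrite -[X in measurable X]setTI; exact: measurable_evenpart. Qed.

Definition oddpart (x : R) : R := evenpart (dshift x).

Lemma measurable_oddpart : measurable_fun setT oddpart.
Proof. exact: measurableT_comp measurable_evenpart measurable_dshift. Qed.

(** The event is squeezed between two events on finitely many digits, whose thresholds differ by
    [2^-1 ^+ n]; [digits_law] gives the probability of both as a product. *)
Lemma parts_law_rays s t :
  unif01 ((oddpart @^-1` `]-oo, t[) `&` (evenpart @^-1` `]-oo, s[)) = (clamp t * clamp s)%:E.
Proof.
have mI : measurable ((oddpart @^-1` `]-oo, t[) `&` (evenpart @^-1` `]-oo, s[)).
  apply: measurableI; last exact: evenpart_ltP.
  by rewrite -[X in measurable X]setTI; exact: measurable_oddpart.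
have mJ n u v : measurable ([set x : R | digits n x < u] `&` [set x | digits n (dshift x) < v]).
  apply: measurableI; first exact: measurable_digits_lt.
  exact: (measurable_preshift (measurable_digits_lt n v)).
set E := _ `&` _ in mI *.
have [p Ep] : exists p, unif01 E = p%:E.
  by exists (fine (unif01 E)); rewrite fineK// fin_num_measure.
have q_gt0 n : 0 < 2^-1 ^+ n :> R by rewrite exprn_gt0// invr_gt0.
have up n : p <= digits_cdf n s * digits_cdf n t.
  rewrite -lee_fin -Ep -digits_law; apply: meas_le => //.
  move=> x [] /=; rewrite !in_itv /= => h1 h2; split => /=.
    by apply: le_lt_trans h2; have /andP[] := evenpart_digits n x.
  by apply: le_lt_trans h1; have /andP[] := evenpart_digits n (dshift x).
have lo n : digits_cdf n (s - 2^-1 ^+ n) * digits_cdf n (t - 2^-1 ^+ n) <= p.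
  rewrite -lee_fin -Ep -digits_law; apply: meas_le => //.
  move=> x [] /= h1 h2; split => /=; rewrite in_itv /=.
    have /andP[_ h] := evenpart_digits n (dshift x).
    by apply: (le_lt_trans h); rewrite -ltrBrDr.
  have /andP[_ h] := evenpart_digits n x.
  by apply: (le_lt_trans h); rewrite -ltrBrDr.
have prodB (a b c d q : R) : 0 <= a <= 1 -> 0 <= d <= 1 -> 0 <= q -> `|a - c| <= q -> `|b - d| <= q ->
    `|a * b - c * d| <= 2 * q.
  move=> /andP[a0 a1] /andP[d0 d1] q0 h1 h2.
  have -> : a * b - c * d = a * (b - d) + (a - c) * d by ring.
  rewrite (le_trans (ler_normD _ _))// mulr_natl mulr2n lerD// normrM.
    by rewrite -[leRHS]mul1r ler_pM// ger0_norm.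
  by rewrite -[leRHS]mulr1 ler_pM// ger0_norm.
have cl01 u : 0 <= clampR u <= 1.
  by case: (clampP u) => [[h ->]|[h h' ->]|[h ->]]; apply/andP; split; lra.
(* Each factor of the lower bound is off by at most [2 * 2^-1 ^+ n], one half from the shift of the
   threshold and one half from [digits_cdf_clamp]; a product of two factors doubles the error. *)
have bd n : `|p - clamp t * clamp s| <= 4 * 2^-1 ^+ n.
  have q0 := ltW (q_gt0 n).
  have h1 := prodB _ _ _ _ _ (digits_cdf01 n s) (cl01 t) q0 (digits_cdf_clamp n s) (digits_cdf_clamp n t).
  have aux u : `|digits_cdf n (u - 2^-1 ^+ n) - clamp u| <= 2 * 2^-1 ^+ n.
    have := digits_cdf_clamp n (u - 2^-1 ^+ n); have := clamp_lip1 u q0.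
    by rewrite !ler_norml => /andP[k1 k2] /andP[k3 k4]; apply/andP; split; lra.
  have q0' : 0 <= 2 * 2^-1 ^+ n :> R by rewrite mulr_ge0.
  have h2 := prodB _ _ _ _ _ (digits_cdf01 n (s - 2^-1 ^+ n)) (cl01 t) q0' (aux s) (aux t).
  have := up n; have := lo n; move: h1 h2 q0; clear; rewrite [clamp t * _]mulrC !ler_norml.
  move: (2^-1 ^+ n : R) (clamp s * _) => q cc /andP[k1 k2] /andP[k3 k4] q0 k5 k6.
  by apply/andP; split; lra.
rewrite Ep; congr EFin; apply/eqP; rewrite -subr_eq0 -normr_le0.
have c : (fun n => 4 * 2^-1 ^+ n : R) @ \oo --> (0 : R).
  rewrite -[X in _ --> X](mulr0 4); apply: cvgM; first exact: cvg_cst.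
  by apply: cvg_expr; rewrite ger0_norm; lra.
rewrite -(cvg_lim _ c)//; apply: limr_ge; first by apply/cvg_ex; exists 0.
by near=> n; exact: bd.
Unshelve. all: by end_near. Qed.

Lemma evenpart_le1 x : evenpart x <= 1.
Proof. by have /andP[_] := evenpart_digits 0 x; rewrite /= add0r expr0. Qed.

Lemma measurable_preeven (A : set R) : measurable A -> measurable (evenpart @^-1` A).
Proof. by move=> mA; rewrite -[X in measurable X]setTI; exact: measurable_evenpart. Qed.

Lemma measurable_preodd (A : set R) : measurable A -> measurable (oddpart @^-1` A).
Proof. by move=> mA; rewrite -[X in measurable X]setTI; exact: measurable_oddpart. Qed.

(** Two uses of [cond_law]: with a ray for the odd part fixed, the set for the even part is made
    arbitrary; then, with that set fixed, the ray is. *)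
Lemma parts_law A B : measurable A -> measurable B ->
  (unif01 ((evenpart @^-1` A) `&` (oddpart @^-1` B)) = unif01 A * unif01 B)%E.
Proof.
move=> mA mB.
have cl0 t : 0 <= clampR t by case: (clampP t) => [[_ ->]|[h _ ->]|[_ ->]].
(* Both parts are at most one, so the ray below 2 stands for the whole line and gives the marginal
   laws. *)
have odd2 : oddpart @^-1` `]-oo, 2[ = setT.
  by apply/seteqP; split => x //= _; rewrite in_itv /= (le_lt_trans (evenpart_le1 _))// ltr1n.
have even2 : evenpart @^-1` `]-oo, 2[ = setT.
  by apply/seteqP; split => x //= _; rewrite in_itv /= (le_lt_trans (evenpart_le1 _))// ltr1n.
have cl2 : clampR 2 = 1 by rewrite clamp_ge1// ler1n.
have lawo t : unif01 (oddpart @^-1` `]-oo, t[) = (clamp t)%:E.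
  by have := parts_law_rays 2 t; rewrite even2 setIT cl2 mulr1.
have h1 t : (unif01 ((oddpart @^-1` `]-oo, t[) `&` evenpart @^-1` A) = (clamp t)%:E * unif01 A)%E.
  apply: (@cond_law _ _ _ unif01 unif01) => //.
  - exact: measurable_preodd.
  - exact: measurable_evenpart.
  - exact: lawo.
  - by move=> s; rewrite [X in (_ * X)%E]unif01_lt -EFinM; exact: parts_law_rays.
have lawe : unif01 (evenpart @^-1` A) = unif01 A.
  by have := h1 2; rewrite odd2 setTI cl2 mul1e.
have eA : unif01 A = (fine (unif01 A))%:E by rewrite fineK// fin_num_measure.
rewrite eA; apply: (@cond_law _ _ _ unif01 unif01) => //.
- exact: measurable_preeven.
- exact: measurable_oddpart.
- by rewrite fine_ge0.
- by rewrite -eA; exact: lawe.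
- by move=> t; rewrite [X in (_ * X)%E]unif01_lt -eA setIC muleC; exact: h1.
Qed.

Lemma oddpart_law A : measurable A -> unif01 (oddpart @^-1` A) = unif01 A.
Proof.
by move=> mA; have := parts_law measurableT mA; rewrite preimage_setT setTI probability_setT mul1e.
Qed.

Lemma evenpart_law A : measurable A -> unif01 (evenpart @^-1` A) = unif01 A.
Proof.
by move=> mA; have := parts_law mA measurableT; rewrite preimage_setT setIT probability_setT mule1.
Qed.

Definition unif_seq (n : nat) (x : R) : R := evenpart (iter n oddpart x).

Lemma measurable_iter_odd n : measurable_fun setT (iter n oddpart).
Proof.
elim: n => [|n ih]; first exact: measurable_id.
exact: measurableT_comp measurable_oddpart ih.
Qed.

Lemma measurable_unif_seq n : measurable_fun setT (unif_seq n).
Proof. exact: measurableT_comp measurable_evenpart (measurable_iter_odd n). Qed.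

Lemma measurable_preunif n (A : set R) : measurable A -> measurable (unif_seq n @^-1` A).
Proof. by move=> mA; rewrite -[X in measurable X]setTI; exact: measurable_unif_seq. Qed.

Lemma unif_seq_law n A : measurable A -> unif01 (unif_seq n @^-1` A) = unif01 A.
Proof.
move=> mA; have : unif01 (iter n oddpart @^-1` (evenpart @^-1` A)) = unif01 (evenpart @^-1` A).
  move: (evenpart @^-1` A) (measurable_preeven mA) => B mB.
  elim: n => [//|n ih].
  have -> : iter n.+1 oddpart @^-1` B = oddpart @^-1` (iter n oddpart @^-1` B).
    by apply/seteqP; split => x; rewrite /preimage /= -iterSr.
  rewrite oddpart_law ?ih//.
  by rewrite -[X in measurable X]setTI; exact: measurable_iter_odd.
by rewrite evenpart_law.
Qed.

Lemma unif_seq_cyl n (B : nat -> set R) : (forall i, measurable (B i)) ->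
  (unif01 (\big[setI/setT]_(i < n) (unif_seq i @^-1` B i)) = \prod_(i < n) unif01 (B i))%E.
Proof.
elim: n B => [|n ih] B mB; first by rewrite !big_ord0 probability_setT.
rewrite big_ord_recl [RHS]big_ord_recl.
transitivity (unif01 (B 0%N) * unif01 (\big[setI/setT]_(i < n) (unif_seq i @^-1` B i.+1)))%E; last first.
  by congr (_ * _)%E; exact: (ih (fun i => B i.+1) (fun i => mB i.+1)).
rewrite -parts_law//; last by apply: bigsetI_measurable => i _; exact: measurable_preunif.
congr (unif01 (_ `&` _)); apply/seteqP; split => x /= /bigsetI_seqP h; apply/bigsetI_seqP => i _.
  by have := h i (mem_index_enum i); rewrite /preimage /unif_seq /= -iterSr.
by have := h i (mem_index_enum i); rewrite /preimage /unif_seq /= -iterSr.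
Qed.

Lemma iid_unif_seq : iid_unif (@unif01 R) unif_seq.
Proof.
split; first exact: measurable_unif_seq.
  by move=> i B mB; exact: (unif_seq_law i mB).
move=> s B us mB.
(* The finite set of indices is completed to an initial segment, with [setT] at the new indices. *)
have [N sN] : exists N, forall i, i \in s -> (i < N)%N.
  by exists (\max_(i <- s) i).+1 => i is_; rewrite ltnS; exact: leq_bigmax_seq.
pose B' i := if i \in s then B i else setT.
have mB' i : measurable (B' i) by rewrite /B'; case: ifP.
have -> : \big[setI/setT]_(i <- s) (unif_seq i @^-1` B i)
    = \big[setI/setT]_(i < N) (unif_seq i @^-1` B' i).
  apply/seteqP; split => x /bigsetI_seqP h; apply/bigsetI_seqP => i.
    by move=> _; rewrite /B' /preimage /=; case: ifPn => // /h.
  by move=> is_; have := h (Ordinal (sN _ is_)) (mem_index_enum _); rewrite /B' /preimage /= is_.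
rewrite [X in fine X](unif_seq_cyl _ mB') (_ : \prod_(i < N) _ = (\prod_(i < N) fine (unif01 (B' i)))%:E)%E; last first.
  by rewrite -prodEFin; apply: eq_bigr => i _; rewrite fineK// fin_num_measure.
rewrite /= -(big_mkord xpredT (fun i => fine (unif01 (B' i)))).
rewrite (eq_bigr (fun i => if i \in s then fine (unif01 (B i)) else 1)); last first.
  by move=> i _; rewrite /B'; case: ifP => // _; rewrite probability_setT.
rewrite -big_mkcond -big_filter; transitivity (\prod_(i <- s) fine (unif01 (B i))); last first.
  by apply: eq_big_seq => i _; congr fine; exact: (esym (unif_seq_law i (mB i))).
apply: perm_big; apply: uniq_perm; [exact: (filter_uniq _ (iota_uniq _ _))|exact: us|].
move=> i; rewrite mem_filter mem_index_iota /=; case: (boolP (i \in s)) => //= is_.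
exact: sN.
Qed.

End UniformSequence.

(** * The coupling distance *)

Section CouplingDistance.
Context {R : realType}.
Implicit Types (c : gcoef R).

(** Indices are only asked to satisfy [n <= phi n]: this suffices to escape to infinity, and it lets
    a sequence of bad indices be obtained by plain choice. *)
Lemma subseq_cvg (V : topologicalType) (u : nat -> V) (l : V) :
  (forall phi : nat -> nat, (forall n, (n <= phi n)%N) ->
     exists2 psi : nat -> nat, (forall n, (n <= psi n)%N) & u (phi (psi n)) @[n --> \oo] --> l) ->
  u n @[n --> \oo] --> l.
Proof.
move=> h; apply: contrapT => ul.
have [A Al nA] : exists2 A, nbhs l A & ~ (\forall n \near \oo, A (u n)).
  apply: contrapT => h2; apply: ul => A Al; apply: contrapT => h3; apply: h2.
  by exists A.
have /choice[phi phiP] : forall n, exists m, (n <= m)%N /\ ~ A (u m).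
  move=> n; apply: contrapT => h2; apply: nA; exists n => // m /= nm.
  by apply: contrapT => h3; apply: h2; exists m.
have [psi psi_ge /(_ _ Al) [N _ hN]] := h phi (fun n => (phiP n).1).
by apply: (phiP (psi N)).2; apply: hN => /=.
Qed.

Lemma increasing_ge (phi : nat -> nat) : (forall n, (phi n < phi n.+1)%N) ->
  forall n, (n <= phi n)%N.
Proof. by move=> h; elim=> [//|n ih]; exact: leq_ltn_trans (h n). Qed.

Local Notation rate := (fun n => (2^-1 ^+ n) ^+ 2 : R).

(** The rate [(2^-1 ^+ n) ^+ 2] is the one under which [ae_cells] holds with no further
    extraction. *)
Lemma compact_subseq (cs : nat -> gcoef R) : (forall n, is_grapheur (cs n)) ->
  exists c phi pi pi', [/\ is_grapheur c, (forall n, (phi n < phi n.+1)%N),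
    (forall n, cancel (pi n) (pi' n)), (forall n, cancel (pi' n) (pi n)) &
    (forall n, gclose (rate n) (permc (pi n) (cs (phi n))) c)].
Proof.
move=> gcs; have [c gc hc] := grapheur_compact gcs.
have r0 n : 0 < rate n by rewrite !exprn_gt0// invr_gt0.
have /choice[f fP] : forall nm : nat * nat, exists x : nat * (nat -> nat) * (nat -> nat),
    [/\ (nm.2 <= x.1.1)%N, cancel x.1.2 x.2, cancel x.2 x.1.2 &
        gclose (rate nm.1) (permc x.1.2 (cs x.1.1)) c].
  move=> [n m]; have [k [pi [pi' h]]] := hc (rate n) m (r0 n).
  by exists (k, pi, pi').
(* A single choice function [f] returns the index together with its relabelling; [arg] recovers the
   request made at rank [n], so that [phi], [pi] and [pi'] stay matched. *)
pose fix phi (n : nat) : nat := if n is m.+1 then (f (n, (phi m).+1)).1.1 else (f (0, 0)%N).1.1.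
pose arg n := if n is m.+1 then (n, (phi m).+1) else (0, 0)%N.
have phiE n : phi n = (f (arg n)).1.1 by case: n.
have argE n : (arg n).1 = n by case: n.
exists c, phi, (fun n => (f (arg n)).1.2), (fun n => (f (arg n)).2); split => //.
- by move=> n; have [h _ _ _] := fP (n.+1, (phi n).+1).
- by move=> n; have [_ h _ _] := fP (arg n).
- by move=> n; have [_ _ h _] := fP (arg n).
- by move=> n; have [_ _ _ h] := fP (arg n); rewrite argE -phiE in h.
Qed.

Section lip_gap.
Context d (Om : measurableType d) (P : probability Om R) (M1 M2 : Om -> PM R).
Hypotheses (mM1 : measurable_fun setT M1) (mM2 : measurable_fun setT M2).

Lemma bounded_comp_integrable (G : PM R -> R) (M : Om -> PM R) K : measurable_fun setT M ->
  measurable_fun setT G -> (forall mu, `|G mu| <= K) ->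
  P.-integrable setT (EFin \o (G \o M)).
Proof.
move=> mM mG GK.
have K0 : 0 <= K by exact: le_trans (normr_ge0 _) (GK mzero).
have P1 : (P setT <= 1)%E by rewrite probability_setT.
have ae : \forall w \ae P, `|(G \o M) w| <= K by apply: aeW => w; exact: GK.
exact: (ae_bounded_integrable (measurableT_comp mG mM) P1 K0 ae).1.
Qed.

Lemma lip_gap k (h : 'M[R]_k.+1 -> R) K L D : (forall x, `|h x| <= K) -> 0 <= L ->
  (forall x y, `|h x - h y| <= L * \sum_i \sum_j `|x i j - y i j|) ->
  (forall i j : 'I_k.+1, \int[P]_w (`|cv k i j (M1 w) - cv k i j (M2 w)|)%:E <= D%:E)%E ->
  (`|\int[P]_w (h (cmx k (M1 w)))%:E - \int[P]_w (h (cmx k (M2 w)))%:E|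
    <= (L * (k.+1%:R * k.+1%:R * D))%:E)%E.
Proof.
move=> hK L0 hL hD.
have hl : liph h by split; [exists K|exists L].
have mh := measurable_cells (liph_continuous hl).
have i1 := bounded_comp_integrable mM1 mh (fun mu => hK (cmx k mu)).
have i2 := bounded_comp_integrable mM2 mh (fun mu => hK (cmx k mu)).
have mcv (M : Om -> PM R) i j : measurable_fun setT M -> measurable_fun setT (fun w => cv k i j (M w)).
  by move=> mM; exact: (measurableT_comp (measurable_cv k i j) mM).
have md i j : measurable_fun setT (fun w => `|cv k i j (M1 w) - cv k i j (M2 w)|).
  apply: (measurableT_comp (@normr_measurable R setT)).
  by apply: measurable_funB; exact: mcv.
rewrite -integralB_EFin//; apply: le_trans (le_abse_integral _ _ _) _ => //.
  by apply/measurable_EFinP; apply: measurable_funB; [exact: (measurableT_comp mh mM1)|exact: (measurableT_comp mh mM2)].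
apply: (@le_trans _ _ (\int[P]_w (\sum_(p : 'I_k.+1 * 'I_k.+1)
    (L%:E * (`|cv k p.1 p.2 (M1 w) - cv k p.1 p.2 (M2 w)|)%:E)))%E).
  apply: ge0_le_integral => //.
  - apply/measurable_EFinP; apply: measurableT_comp => //.
    by apply: measurable_funB; [exact: (measurableT_comp mh mM1)|exact: (measurableT_comp mh mM2)].
  - apply: emeasurable_sum => p; apply: measurable_funeM; exact/measurable_EFinP/md.
  - move=> w _; rewrite -EFinB abse_EFin; apply: le_trans (_ : _ <= (L * \sum_i \sum_j `|cmx k (M1 w) i j - cmx k (M2 w) i j|)%:E)%E _.
      by rewrite lee_fin; exact: hL.
    rewrite pair_big /= mulr_sumr -sumEFin; apply: lee_sum => p _.
    by rewrite !mxE.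
rewrite ge0_integral_sum//; last 2 first.
- by move=> p; apply: measurable_funeM; exact/measurable_EFinP/md.
- by move=> p w _; rewrite mule_ge0 ?lee_fin.
apply: (@le_trans _ _ (\sum_(p : 'I_k.+1 * 'I_k.+1) (L * D)%:E)%E).
  apply: lee_sum => p _; rewrite ge0_integralZl ?lee_fin//; last exact/measurable_EFinP/md.
  by rewrite EFinM lee_wpmul2l ?lee_fin// hD.
rewrite sumEFin lee_fin sumr_const card_prod !card_ord -[leLHS]mulr_natl natrM.
by rewrite [leRHS]mulrCA.
Qed.

End lip_gap.

Lemma law_integral d1 (O1 : measurableType d1) (P1 : probability O1 R) (M1 : O1 -> PM R)
    d2 (O2 : measurableType d2) (P2 : probability O2 R) (M2 : O2 -> PM R) (G : PM R -> R) K :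
  measurable_fun setT M1 -> measurable_fun setT M2 -> same_law P1 M1 P2 M2 ->
  measurable_fun setT G -> (forall mu, `|G mu| <= K) ->
  (\int[P1]_w (G (M1 w))%:E = \int[P2]_w (G (M2 w))%:E)%E.
Proof.
move=> mM1 mM2 e mG GK.
have mG' : measurable_fun setT (EFin \o G) by exact/measurable_EFinP.
have := @integral_pushforward _ _ _ _ R _ mM1 P1 setT _ mG' (bounded_comp_integrable P1 mM1 mG GK) measurableT.
have := @integral_pushforward _ _ _ _ R _ mM2 P2 setT _ mG' (bounded_comp_integrable P2 mM2 mG GK) measurableT.
rewrite !preimage_setT => /= <- /= <-; apply: eq_measure_integral => A mA _.
exact: e.
Qed.
End CouplingDistance.

(** * Canonical realization, uniqueness of the law, and [Wsq] *)

Section CanonicalRealization.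
Context {R : realType}.
Implicit Types (c : gcoef R).
Local Notation P0 := (@unif01 R : probability _ R).

Definition canM c (gc : is_grapheur c) (w : R) : PM R := gM gc (unif_seq ^~ w).

Lemma canM_realizes c (gc : is_grapheur c) : realizes c unif_seq (canM gc).
Proof. by apply: realizes_gM; exact: measurable_unif_seq. Qed.

Lemma measurable_canM c (gc : is_grapheur c) : measurable_fun setT (canM gc).
Proof. by case: (canM_realizes gc). Qed.

Lemma close_cells d (Om : measurableType d) (P : probability Om R) T c1 c2 (M1 M2 : Om -> PM R)
    (X Y : set R) eta : iid_unif P T -> is_grapheur c1 -> is_grapheur c2 ->
  realizes c1 T M1 -> realizes c2 T M2 -> measurable X -> measurable Y ->
  0 < eta -> eta <= 1 -> gclose (eta ^+ 2) c1 c2 ->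
  (\int[P]_w (`|fine (M1 w (X `*` Y)) - fine (M2 w (X `*` Y))|)%:E <= (30 * eta)%:E)%E.
Proof.
move=> iid gc1 gc2 [_ r1] [_ r2] mX mY e0 e1 cl.
apply: le_trans (close_L1 mX mY iid gc1 gc2 e0 e1 cl).
rewrite le_eqVlt; apply/orP; left; apply/eqP; apply: eq_integral => w _.
by rewrite r1 ?r2//; exact: measurableX.
Qed.

(** Graph and grapheur are realized on the same points [T], where [close_cells] applies. The left
    side does not mention [P], [T] or [M], so the limit depends on [c] only. *)
Lemma approx_integral d (Om : measurableType d) (P : probability Om R) T c (M : Om -> PM R)
    k (h : 'M[R]_k.+1 -> R) : iid_unif P T -> is_grapheur c -> realizes c T M -> liph h ->
  (Equot (approx_graph c n) h)%:E @[n --> \oo] --> (\int[P]_w (h (cmx k (M w)))%:E)%E.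
Proof.
move=> iid gc rM hl; have [[K hK] [L L0 hL]] := hl.
have mT i : measurable_fun setT (T i) by case: iid.
have gg n := graph_grapheur (approx_graph_inDelta gc n).
have rn n := realizes_gM (gg n) mT.
have mM : measurable_fun setT M by case: rM.
have mh := measurable_cells (liph_continuous hl).
have If := integrable_fin_num measurableT (bounded_comp_integrable P mM mh (fun mu => hK (cmx k mu))).
rewrite -(fineK If); apply: cvg_EFin; first by near=> n.
apply/cvgrPdist_le => e e0.
pose A := L * (k.+1%:R * k.+1%:R).
have A0 : 0 <= A by rewrite mulr_ge0// mulr_ge0.
(* The minimum provides [eta <= 1]; the denominator, where [A + 1] cannot vanish, makes
   [A * (30 * eta)] at most [e]. *)
pose eta := Num.min 1 (e / (30 * (A + 1))).
have eta0 : 0 < eta by rewrite lt_min ltr01 divr_gt0// mulr_gt0// ltr_wpDl.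
have eta1 : eta <= 1 by rewrite ge_min lexx.
have /filterS := approx_gclose gc (exprn_gt0 2 eta0); apply => n cl.
have mn : measurable_fun setT (fun w => gM (gg n) (T ^~ w)) by case: (rn n).
have D i j : (\int[P]_w (`|cv k i j (M w) - cv k i j (gM (gg n) (T ^~ w))|)%:E <= (30 * eta)%:E)%E.
  under eq_integral do rewrite distrC.
  apply: (close_cells iid (gg n) gc (rn n) rM) => //; exact: measurable_itv.
have := lip_gap mM mn hK L0 hL (fun i j => D i j).
rewrite (integral_cells_graph iid (approx_graph_inDelta gc n) (rn n) (liph_continuous hl)).
rewrite -(fineK If) -EFinB abse_EFin lee_fin => /le_trans; apply.
rewrite mulrA -/A.
have : eta <= e / (30 * (A + 1)) by rewrite ge_min lexx orbT.
rewrite ler_pdivlMr; last by rewrite mulr_gt0// ltr_wpDl.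
move=> h1; apply: le_trans h1; rewrite -subr_ge0.
have -> : eta * (30 * (A + 1)) - A * (30 * eta) = 30 * eta by ring.
by rewrite mulr_ge0// ltW.
Unshelve. all: by end_near. Qed.

Lemma same_law_trans d1 (O1 : measurableType d1) (P1 : probability O1 R) (M1 : O1 -> PM R)
    d2 (O2 : measurableType d2) (P2 : probability O2 R) (M2 : O2 -> PM R)
    d3 (O3 : measurableType d3) (P3 : probability O3 R) (M3 : O3 -> PM R) :
  same_law P1 M1 P2 M2 -> same_law P2 M2 P3 M3 -> same_law P1 M1 P3 M3.
Proof. by move=> h h' S mS; rewrite h ?h'. Qed.

(** Both realizations give the integrals of Lipschitz cell functionals as the limit of one and the
    same numerical sequence. *)
Lemma grapheur_real_law c d1 (O1 : measurableType d1) (P1 : probability O1 R) (M1 : O1 -> PM R)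
    d2 (O2 : measurableType d2) (P2 : probability O2 R) (M2 : O2 -> PM R) : is_grapheur c ->
  grapheur_real P1 c M1 -> grapheur_real P2 c M2 -> same_law P1 M1 P2 M2.
Proof.
move=> gc [T1 [iid1 r1]] [T2 [iid2 r2]].
apply: cell_same_law; [by case: r1|by case: r2|exact: (ae_P01 iid1 gc r1)|exact: (ae_P01 iid2 gc r2)|].
move=> k h hl.
by apply: (cvg_unique _ (approx_integral iid1 gc r1 hl) (approx_integral iid2 gc r2 hl)).
Qed.

Lemma canM_real c (gc : is_grapheur c) : grapheur_real P0 c (canM gc).
Proof. by exists unif_seq; split; [exact: iid_unif_seq|exact: canM_realizes]. Qed.

(** Removes the existential over probability spaces from [law_is]: by uniqueness of the law,
    comparison with one fixed realization is enough. *)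
Lemma law_isP c (gc : is_grapheur c) d (O : measurableType d) (P : probability O R) (M : O -> PM R) :
  law_is P M c <-> measurable_fun setT M /\ same_law P M P0 (canM gc).
Proof.
split=> [[mM [d' [Om [P' [M' [rM' e]]]]]]|[mM e]].
  split => //; apply: (same_law_trans e).
  exact: (grapheur_real_law gc rM' (canM_real gc)).
by split => //; exists _, _, P0, (canM gc); split => //; exact: canM_real.
Qed.

Lemma canM_permc c pi pi' (gc : is_grapheur c) (gc' : is_grapheur (permc pi c)) :
  cancel pi pi' -> cancel pi' pi -> same_law P0 (canM gc') P0 (canM gc).
Proof.
move=> h h'; apply: (grapheur_real_law gc _ (canM_real gc)).
exact: (grapheur_real_perm h h' gc iid_unif_seq (canM_realizes gc')).
Qed.

Lemma abse_subM (mu nu : PM R) (X Y : set R) : measurable X -> measurable Y ->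
  (`|mu (X `*` Y) - nu (X `*` Y)| = (`|fine (mu (X `*` Y)) - fine (nu (X `*` Y))|)%:E)%E.
Proof.
move=> mX mY; have mA := measurableX mX mY.
by rewrite -(fineK (mu_fin mu mA)) -(fineK (mu_fin nu mA)) -EFinB abse_EFin.
Qed.

Lemma Wsq_sym c1 c2 : Wsq c1 c2 = Wsq c2 c1.
Proof.
wlog suff : c1 c2 / (Wsq c1 c2 <= Wsq c2 c1)%E.
  by move=> h; apply/eqP; rewrite eq_le !h.
apply: le_ereal_inf_tmp => _ [d [Om [P [M1 [M2 [l1 l2 ->]]]]]]; apply: ereal_inf_lbound.
have key (I J : interval R) : (\int[P]_w `|M1 w ([set` I] `*` [set` J]) - M2 w ([set` I] `*` [set` J])|
    = \int[P]_w `|M2 w ([set` I] `*` [set` J]) - M1 w ([set` I] `*` [set` J])|)%E.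
  have mI := measurable_itv I; have mJ := measurable_itv J.
  by apply: eq_integral => w _; rewrite (abse_subM _ _ mI mJ) (abse_subM _ _ mI mJ) distrC.
exists d, Om, P, M2, M1; split; [exact: l2|exact: l1|].
congr (ereal_sup _); apply/seteqP; split => e [I [J [hI hJ ->]]]; exists I, J.
  by split; [exact: hI|exact: hJ|exact: key].
by split; [exact: hI|exact: hJ|exact: (esym (key I J))].
Qed.

Lemma Wsq_le c1 c2 d (O : measurableType d) (P : probability O R) (M1 M2 : O -> PM R) D :
  law_is P M1 c1 -> law_is P M2 c2 ->
  (forall X Y, measurable X -> measurable Y ->
    (\int[P]_w (`|fine (M1 w (X `*` Y)) - fine (M2 w (X `*` Y))|)%:E <= D)%E) ->
  (Wsq c1 c2 <= D)%E.
Proof.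
move=> l1 l2 h; apply: le_trans (ereal_inf_lbound _) _; first by exists d, O, P, M1, M2.
apply: ge_ereal_sup => _ [I [J [hI hJ ->]]].
have mI := measurable_itv I; have mJ := measurable_itv J.
under eq_integral do rewrite (abse_subM _ _ mI mJ).
exact: (h _ _ mI mJ).
Qed.

Lemma Wsq_ge0 c1 c2 : (0 <= Wsq c1 c2)%E.
Proof.
apply: le_ereal_inf_tmp => _ [d [Om [P [M1 [M2 [l1 l2 ->]]]]]].
(* The supremum of an empty family would be [-oo]; the empty interval shows that the family is
   inhabited. *)
apply: le_trans (ereal_sup_ubound _); last by exists `]0, 0[, `]0, 0[; split; [| |reflexivity] => x; rewrite /= in_itv/= => /andP[/lt_trans h /h]; rewrite ltxx.
exact: integral_ge0.
Qed.

(** The strict inequality provides an actual coupling; the cells are pairs of intervals of the unit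
    interval, so their L1 distances are bounded by the supremum in [Wsq]. *)
Lemma Wsq_cells c1 c2 (gc1 : is_grapheur c1) (gc2 : is_grapheur c2) k (h : 'M[R]_k.+1 -> R) K L D :
  (forall x, `|h x| <= K) -> 0 <= L ->
  (forall x y, `|h x - h y| <= L * \sum_i \sum_j `|x i j - y i j|) ->
  (Wsq c1 c2 < D%:E)%E ->
  (`|\int[P0]_w (h (cmx k (canM gc1 w)))%:E - \int[P0]_w (h (cmx k (canM gc2 w)))%:E|
    <= (L * (k.+1%:R * k.+1%:R * D))%:E)%E.
Proof.
move=> hK L0 hL /ereal_inf_lt[_ [d [Om [P [M1 [M2 [l1 l2 ->]]]]]] hD].
have [mM1 e1] := (law_isP gc1 P M1).1 l1; have [mM2 e2] := (law_isP gc2 P M2).1 l2.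
have hl : liph h by split; [exists K|exists L].
have mh := measurable_cells (liph_continuous hl).
rewrite -(law_integral mM1 (measurable_canM gc1) e1 mh (fun mu => hK (cmx k mu))).
rewrite -(law_integral mM2 (measurable_canM gc2) e2 mh (fun mu => hK (cmx k mu))).
apply: lip_gap => // i j; apply: le_trans (ltW hD).
have ik (l : 'I_k.+1) : (l <= k)%N by rewrite -ltnS.
apply: ereal_sup_ubound; exists (cell k i), (cell k j).
split; [exact: cell_sub|exact: cell_sub|].
by apply: eq_integral => w _; rewrite (abse_subM _ _ (measurable_itv (cell k i)) (measurable_itv (cell k j))).
Qed.
End CanonicalRealization.

(** * Identification of subsequential limits *)

Section MainEquivalence.
Context {R : realType}.
Implicit Types (c : gcoef R).
Local Notation P0 := (@unif01 R : probability _ R).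
Local Notation rate n := ((2^-1 ^+ n) ^+ 2 : R).

(** The coupling puts the relabelled [c1] and [c2] on the same points. Here [c2] is a limit found by
    compactness and [c3] the intended one; the two are tied by their law only. *)
Lemma Wsq_gclose c1 c2 c3 (gc1 : is_grapheur c1) (gc2 : is_grapheur c2) (gc3 : is_grapheur c3)
    pi pi' eta : cancel pi pi' -> cancel pi' pi -> 0 < eta -> eta <= 1 ->
  gclose (eta ^+ 2) (permc pi c1) c2 -> same_law P0 (canM gc2) P0 (canM gc3) ->
  (Wsq c1 c3 <= (30 * eta)%:E)%E.
Proof.
move=> pK pK' e0 e1 cl sl.
have gp : is_grapheur (permc pi c1) by apply: permc_grapheur => //; exists pi'.
have l1 : law_is P0 (canM gp) c1.
  by apply/(law_isP gc1); split; [exact: measurable_canM|exact: canM_permc pK pK'].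
have l3 : law_is P0 (canM gc2) c3 by apply/(law_isP gc3); split; [exact: measurable_canM|exact: sl].
apply: (Wsq_le l1 l3) => X Y mX mY.
exact: (close_cells iid_unif_seq gp gc2 (canM_realizes gp) (canM_realizes gc2) mX mY e0 e1 cl).
Qed.

Lemma rate_cvg0 : (30 * 2^-1 ^+ n : R)%:E @[n --> \oo] --> 0%E.
Proof.
apply: cvg_EFin; first by near=> n.
rewrite -[X in _ --> X](mulr0 30); apply: cvgM; first exact: cvg_cst.
by apply: cvg_expr; rewrite ger0_norm; lra.
Unshelve. all: by end_near. Qed.

Lemma cvg_subseq (V : topologicalType) (u : nat -> V) (l : V) (phi : nat -> nat) :
  (forall n, (n <= phi n)%N) -> u n @[n --> \oo] --> l -> u (phi n) @[n --> \oo] --> l.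
Proof.
move=> h ul A Al; have [N _ hN] := ul A Al.
by exists N => // n /= Nn; apply: hN; exact: leq_trans (h n).
Qed.

Section fast.
Context (cs : nat -> gcoef R) (c : gcoef R) (gcs : forall n, is_grapheur (cs n)) (gc : is_grapheur c).
Context (pi pi' : nat -> nat -> nat).
Hypotheses (pK : forall n, cancel (pi n) (pi' n)) (pK' : forall n, cancel (pi' n) (pi n)).
Hypothesis (fast : forall n, gclose (rate n) (permc (pi n) (cs n)) c).

Lemma fast_functional G : grid_fun G ->
  (\int[P0]_w (G (canM (gcs n) w))%:E @[n --> \oo] --> \int[P0]_w (G (canM gc w))%:E)%E.
Proof.
move=> gG; have gp n : is_grapheur (permc (pi n) (cs n)).
  by apply: permc_grapheur => //; exists (pi' n).
have := fast_cvg iid_unif_seq gp gc (fun n => canM_realizes (gp n)) (canM_realizes gc) fast gG.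
apply: cvg_trans; apply: near_eq_cvg; near=> n.
have [mG [K GK] _] := gG.
exact: (law_integral (measurable_canM (gp n)) (measurable_canM (gcs n)) (canM_permc (gcs n) (gp n) (pK n) (pK' n)) mG GK).
Unshelve. all: by end_near. Qed.

Lemma fast_Wsq c' (gc' : is_grapheur c') : same_law P0 (canM gc) P0 (canM gc') ->
  Wsq (cs n) c' @[n --> \oo] --> 0%E.
Proof.
move=> sl; apply: (squeeze_cvge _ (cvg_cst 0%E) rate_cvg0).
near=> n; apply/andP; split; first exact: Wsq_ge0.
have q0 : 0 < 2^-1 ^+ n :> R by rewrite exprn_gt0// invr_gt0.
have q1 : 2^-1 ^+ n <= 1 :> R by rewrite exprn_ile1 ?invr_ge0// invf_le1// ler1n.
exact: (Wsq_gclose (gcs n) (pK n) (pK' n) q0 q1 (fast n) sl).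
Unshelve. all: by end_near. Qed.

End fast.

Lemma canM_P01 c (gc : is_grapheur c) : \forall w \ae P0, P01 (canM gc w).
Proof. exact: (ae_P01 iid_unif_seq gc (canM_realizes gc)). Qed.

Lemma cell_canM_law c c' (gc : is_grapheur c) (gc' : is_grapheur c') :
  (forall k (h : 'M[R]_k.+1 -> R), liph h ->
    \int[P0]_w (h (cmx k (canM gc w)))%:E = \int[P0]_w (h (cmx k (canM gc' w)))%:E)%E ->
  same_law P0 (canM gc) P0 (canM gc').
Proof.
exact: (cell_same_law (measurable_canM gc) (measurable_canM gc') (canM_P01 gc) (canM_P01 gc')).
Qed.

Lemma liph_grid k (h : 'M[R]_k.+1 -> R) : liph h -> grid_fun (fun mu => h (cmx k mu)).
Proof. by move=> hl; apply: grid_fun_cells; [exact: liph_continuous|case: hl]. Qed.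

Lemma Wsq_liph (cs : nat -> gcoef R) c (gcs : forall n, is_grapheur (cs n)) (gc : is_grapheur c)
    k (h : 'M[R]_k.+1 -> R) : liph h -> Wsq (cs n) c @[n --> \oo] --> 0%E ->
  (\int[P0]_w (h (cmx k (canM (gcs n) w)))%:E @[n --> \oo]
    --> \int[P0]_w (h (cmx k (canM gc w)))%:E)%E.
Proof.
move=> hl W0; have [[K hK] [L L0 hL]] := hl.
have mh := measurable_cells (liph_continuous hl).
have If c' (gc' : is_grapheur c') : (\int[P0]_w (h (cmx k (canM gc' w)))%:E)%E \is a fin_num.
  exact: (integrable_fin_num measurableT
    (bounded_comp_integrable P0 (measurable_canM gc') mh (fun mu => hK (cmx k mu)))).
rewrite -(fineK (If _ gc)); under eq_cvg do rewrite -(fineK (If _ (gcs _))).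
apply: cvg_EFin; first by near=> n.
apply/cvgrPdist_le => e e0.
pose A := L * (k.+1%:R * k.+1%:R).
have A0 : 0 <= A by rewrite mulr_ge0// mulr_ge0.
have D0 : 0 < e / (A + 1) by rewrite divr_gt0// ltr_wpDl.
have hn : \forall n \near \oo, (Wsq (cs n) c < (e / (A + 1))%:E)%E.
  by apply: (W0 [set x | x < (e / (A + 1))%:E]%E); apply: open_nbhs_nbhs; split; [exact: open_ereal_lt_ereal|rewrite /= lte_fin].
apply: filterS hn => n hn.
have := Wsq_cells (gcs n) gc hK L0 hL hn.
rewrite -(fineK (If _ gc)) -(fineK (If _ (gcs n))) -EFinB abse_EFin lee_fin /= distrC => /le_trans; apply.
have A1 : 0 < A + 1 by rewrite ltr_wpDl.
have -> : L * (k.+1%:R * k.+1%:R * (e / (A + 1))) = e * (A / (A + 1)) by rewrite /A; ring.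
by apply: ler_piMr; [exact: ltW|rewrite ler_pdivrMr// mul1r lerDl].
Unshelve. all: by end_near. Qed.

(** From Lipschitz functionals to all of [grid_fun]: by [Wsq_liph] every subsequential limit has the
    law of [c], and along the fast subsequences all grid functionals converge. *)
Lemma Wsq_functional (cs : nat -> gcoef R) c (gcs : forall n, is_grapheur (cs n)) (gc : is_grapheur c) G :
  Wsq (cs n) c @[n --> \oo] --> 0%E -> grid_fun G ->
  (\int[P0]_w (G (canM (gcs n) w))%:E @[n --> \oo] --> \int[P0]_w (G (canM gc w))%:E)%E.
Proof.
move=> W0 gG; apply: subseq_cvg => phi phi_ge.
have [c' [psi [pi [pi' [gc' psi_lt pK pK' fast]]]]] := compact_subseq (fun n => gcs (phi n)).
have psi_ge := increasing_ge psi_lt.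
exists psi => //.
have [mG [K GK] _] := gG.
have ff := @fast_functional (fun n => cs (phi (psi n))) c' (fun n => gcs (phi (psi n))) gc' pi pi' pK pK' fast.
rewrite (_ : (\int[P0]_w (G (canM gc w))%:E = \int[P0]_w (G (canM gc' w))%:E)%E); first exact: ff.
apply: (law_integral (measurable_canM gc) (measurable_canM gc') _ mG GK).
apply: cell_canM_law => k h hl.
apply: (cvg_unique _ _ (ff _ (liph_grid hl))) => //.
have W1 := Wsq_liph gcs (gc := gc) hl W0.
exact: (cvg_subseq (fun n => leq_trans (psi_ge n) (phi_ge _)) W1).
Qed.

Lemma test_fun_law d (O : measurableType d) (P : probability O R) T c (M : O -> PM R)
    (gc : is_grapheur c) Phi G : iid_unif P T -> realizes c T M -> test_fun Phi -> grid_fun G ->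
  (forall mu, P01 mu -> G mu = Phi mu) ->
  (\int[P]_w (Phi (M w))%:E = \int[P0]_w (G (canM gc w))%:E)%E.
Proof.
move=> iid rM [mPhi _ _] [mG [K GK] _] GPhi.
have mM : measurable_fun setT M by case: rM.
have sl : same_law P M P0 (canM gc).
  by apply: (grapheur_real_law gc _ (canM_real gc)); exists T.
rewrite -(law_integral mM (measurable_canM gc) sl mG GK).
apply: ae_eq_integral => //.
- exact/measurable_EFinP/(measurableT_comp mPhi mM).
- exact/measurable_EFinP/(measurableT_comp mG mM).
- by apply: filterS (ae_P01 iid gc rM) => w h _; rewrite GPhi.
Qed.

Lemma Psi_canM_law c c' (gc : is_grapheur c) (gc' : is_grapheur c') :
  (forall Phi, test_fun Phi -> (\int[P0]_w (Phi (canM gc w))%:E = \int[P0]_w (Phi (canM gc' w))%:E)%E) ->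
  same_law P0 (canM gc) P0 (canM gc').
Proof.
move=> h; apply: (Psi_same_law (measurable_canM gc) (measurable_canM gc')) => m r f a gf.
exact: (h _ (test_fun_Psi m r a gf)).
Qed.

(** Forwards, the hypothesis is used on the canonical realization and the test functions identify
    the law of each subsequential limit. Backwards, a test function on an arbitrary space is moved
    to the canonical one by [test_fun_law]. *)
Lemma grapheur_cvg_Wsq (cs : nat -> gcoef R) c : (forall n, is_grapheur (cs n)) -> is_grapheur c ->
  (grapheur_cvg cs c <-> Wsq (cs n) c @[n --> \oo] --> 0%E).
Proof.
move=> gcs gc; split=> [cvgc|W0].
  apply: subseq_cvg => phi phi_ge.
  have [c' [psi [pi [pi' [gc' psi_lt pK pK' fast]]]]] := compact_subseq (fun n => gcs (phi n)).
  have psi_ge := increasing_ge psi_lt; exists psi => //.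
  pose gs n := gcs (phi (psi n)).
  apply: (@fast_Wsq (fun n => cs (phi (psi n))) c' gs gc' pi pi' pK pK' fast _ gc).
  apply: Psi_canM_law => Phi tPhi.
  have [G gG GPhi] := test_fun_grid tPhi.
  have tl c'' (gc'' : is_grapheur c'') := test_fun_law gc'' iid_unif_seq (canM_realizes gc'') tPhi gG GPhi.
  have ff := @fast_functional (fun n => cs (phi (psi n))) c' gs gc' pi pi' pK pK' fast G gG.
  have := cvgc _ _ P0 unif_seq (fun n => canM (gcs n)) (canM gc) iid_unif_seq
    (fun n => canM_realizes (gcs n)) (canM_realizes gc) Phi tPhi.
  move/(cvg_subseq (phi := fun n => phi (psi n)) (fun n => leq_trans (psi_ge n) (phi_ge _))) => gg.
  rewrite (tl _ gc'); apply: (cvg_unique _ ff) => //.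
  have E : (fun n => \int[P0]_w (Phi (canM (gcs (phi (psi n))) w))%:E)%E
      = (fun n => \int[P0]_w (G (canM (gs n) w))%:E)%E by apply/funext => n; exact: tl.
  by move: gg; rewrite E; apply.
move=> d Om P T Ms M iid rMs rM Phi tPhi.
have [G gG GPhi] := test_fun_grid tPhi.
rewrite (test_fun_law gc iid rM tPhi gG GPhi).
under eq_cvg do rewrite (test_fun_law (gcs _) iid (rMs _) tPhi gG GPhi).
exact: Wsq_functional.
Qed.

Lemma Wsq_cvg_sym (cs : nat -> gcoef R) c :
  (Wsq (cs n) c @[n --> \oo] --> 0%E) = (Wsq c (cs n) @[n --> \oo] --> 0%E).
Proof.
by rewrite (_ : (fun n => Wsq (cs n) c) = (fun n => Wsq c (cs n)))//; apply/funext => n; exact: Wsq_sym.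
Qed.

Lemma Equot_canM m (G : 'M[R]_m) (GD : inDelta G) k (h : 'M[R]_k.+1 -> R) : continuous h ->
  ((Equot G h)%:E = \int[P0]_w (h (cmx k (canM (graph_grapheur GD) w)))%:E)%E.
Proof.
by move=> hc; rewrite (integral_cells_graph iid_unif_seq GD (canM_realizes _) hc).
Qed.

Lemma quot_cvg_limit (sz : nat -> nat) (G : forall n, 'M[R]_(sz n)) c (gc : is_grapheur c) :
  (forall k (h : 'M[R]_k.+1 -> R), continuous h -> (exists K, forall x, `|h x| <= K) ->
    ((Equot (G n) h)%:E @[n --> \oo] --> \int[P0]_w (h (cmx k (canM gc w)))%:E)%E) ->
  quot_cvg G.
Proof.
move=> H k; exists _, _, P0, (fun i j w => cv k i j (canM gc w)); split; last exact: H.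
by move=> i j; exact: (measurableT_comp (measurable_cv k i j) (measurable_canM gc)).
Qed.

(** The limit [c] is taken along one fast subsequence. Any other subsequential limit has the same
    integrals of Lipschitz cell functionals, namely those of the limiting quotient matrices, hence
    the same law. *)
Lemma quot_cvg_Wsq (sz : nat -> nat) (G : forall n, 'M[R]_(sz n)) : (forall n, inDelta (G n)) ->
  (quot_cvg G <-> exists c, is_grapheur c /\ Wsq c (graph_coef (G n)) @[n --> \oo] --> 0%E).
Proof.
move=> GD; have gcs n := graph_grapheur (GD n).
split=> [qG|[c [gc W0]]]; last first.
  apply: (quot_cvg_limit (gc := gc)) => k h hc hb.
  under eq_cvg do rewrite (Equot_canM (GD _) hc).
  apply: (Wsq_functional _ _ (grid_fun_cells hc hb)).
  by rewrite (Wsq_cvg_sym (fun n => graph_coef (G n))).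
have [c [phi [pi [pi' [gc phi_lt pK pK' fast]]]]] := compact_subseq gcs.
have phi_ge := increasing_ge phi_lt.
exists c; split; first exact: gc.
rewrite -(Wsq_cvg_sym (fun n => graph_coef (G n))).
(* In this proof [rho] and [rho'] are inverse relabellings and not the quotient map. *)
have lim (chi : nat -> nat) c' (gc' : is_grapheur c') rho rho' : (forall n, (n <= chi n)%N) ->
    (forall n, cancel (rho n) (rho' n)) -> (forall n, cancel (rho' n) (rho n)) ->
    (forall n, gclose (rate n) (permc (rho n) (graph_coef (G (chi n)))) c') ->
    forall k (h : 'M[R]_k.+1 -> R) (hl : liph h) l, (Equot (G n) h)%:E @[n --> \oo] --> l ->
    (\int[P0]_w (h (cmx k (canM gc' w)))%:E)%E = l.
  move=> chi_ge rK rK' fast' k h hl l /(cvg_subseq chi_ge).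
  under eq_cvg do rewrite (Equot_canM (GD _) (liph_continuous hl)).
  apply: cvg_unique => //.
  exact: (@fast_functional _ c' (fun n => graph_grapheur (GD (chi n))) gc' rho rho' rK rK' fast'
    _ (liph_grid hl)).
apply: subseq_cvg => chi chi_ge.
have [c' [psi [rho [rho' [gc' psi_lt rK rK' fast']]]]] := compact_subseq (fun n => gcs (chi n)).
have psi_ge := increasing_ge psi_lt; exists psi => //.
apply: (@fast_Wsq _ c' (fun n => gcs (chi (psi n))) gc' rho rho' rK rK' fast' _ gc).
apply: cell_canM_law => k h hl.
have [d [Om [P [X [mX HX]]]]] := qG k.
have hX := HX h (liph_continuous hl) hl.1.
rewrite (lim (fun n => chi (psi n)) _ gc' rho rho' _ rK rK' fast' _ _ hl _ hX).
  by rewrite (lim phi _ gc pi pi' phi_ge pK pK' fast _ _ hl _ hX).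
by move=> n; exact: leq_trans (psi_ge n) (chi_ge _).
Qed.

End MainEquivalence.

Theorem mainTheorem2 (R : realType) :
  (* weak convergence of grapheurs <-> W_square convergence *)
  (forall (cs : nat -> gcoef R) (c : gcoef R),
     (forall n, is_grapheur (cs n)) -> is_grapheur c ->
     (grapheur_cvg cs c <-> Wsq (cs n) c @[n --> \oo] --> 0%E))
  /\
  (* (1) G_n in Delta^{n x n}, n >= 1 (here G n has size n.+1) *)
  (forall G : forall n : nat, 'M[R]_n.+1,
     (forall n, inDelta (G n)) ->
     (quot_cvg G <->
      exists c : gcoef R, is_grapheur c /\
        Wsq c (graph_coef (G n)) @[n --> \oo] --> 0%E))
  /\
  (* (2) every graph sequence has a quotient-convergent subsequence *)
  (forall G : forall n : nat, 'M[R]_n.+1,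
     (forall n, inDelta (G n)) ->
     exists phi : nat -> nat, (forall n, (phi n < phi n.+1)%N) /\
       quot_cvg (fun n => G (phi n)))
  /\
  (* (3) every grapheur is a W_square-limit of graphs *)
  (forall c : gcoef R, is_grapheur c ->
     exists G : forall n : nat, 'M[R]_n.+1,
       (forall n, inDelta (G n)) /\
       Wsq c (graph_coef (G n)) @[n --> \oo] --> 0%E).
Proof.
split; first exact: grapheur_cvg_Wsq.
split; first by move=> G; exact: quot_cvg_Wsq.
split=> [G GD|c gc].
  have [c [phi [pi [pi' [gc phi_lt pK pK' fast]]]]] := compact_subseq (fun n => graph_grapheur (GD n)).
  exists phi; split => //.
  apply: (quot_cvg_limit (gc := gc)) => k h hc hb.
  under eq_cvg do rewrite (Equot_canM (GD _) hc).
  exact: (@fast_functional _ _ _ (fun n => graph_grapheur (GD (phi n))) gc pi pi' pK pK' fast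
    _ (grid_fun_cells hc hb)).
exists (approx_graph c); split; first by move=> n; exact: approx_graph_inDelta.
rewrite -(Wsq_cvg_sym (fun n => graph_coef (approx_graph c n))).
have gn n := graph_grapheur (approx_graph_inDelta gc n).
apply: subseq_cvg => phi phi_ge.
(* The heavy vertices of [approx_graph] keep their labels in [c], so the identity serves as
   relabelling; thinning out provides the rate that [fast_Wsq] asks for. *)
have /choice[psi psiP] : forall n, exists m, (n <= m)%N /\
    gclose (((2^-1 : R) ^+ n) ^+ 2) (permc id (graph_coef (approx_graph c (phi m)))) c.
  move=> n; have r0 : 0 < ((2^-1 : R) ^+ n) ^+ 2 by rewrite !exprn_gt0// invr_gt0.
  have [N _ hN] := approx_gclose gc r0.
  exists (maxn N n); split; first exact: leq_maxr.
  by apply: hN; apply: leq_trans (phi_ge _) => /=; exact: leq_maxl.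
exists psi; first by move=> n; case: (psiP n).
exact: (@fast_Wsq _ _ c (fun n => gn (phi (psi n))) gc (fun _ => id) (fun _ => id)
  (fun _ _ => erefl) (fun _ _ => erefl) (fun n => (psiP n).2) c gc).
Qed.
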